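(* Assume that the base flow $(\Omega,\sigma,\mathbb{R})$ is minimal and that H1 and H2 hold. Let $\mathcal{P}\subset\Omega\times W^{1,\infty}$ be a positively $\Pi$-invariant compact set such that $\lambda_{\mathcal{M}}<0$ for any minimal subset $\mathcal{M}\subseteq\mathcal{P}$. Then: (i) The omega-limit set $\mathcal{O}(\omega,x)$ of any $(\omega,x)\in\mathcal{P}$ is a minimal subset of $\mathcal{P}$. (ii) $\mathcal{P}$ contains a finite number of minimal sets, $\mathcal{M}_1,\ldots,\mathcal{M}_l$. (iii) If $\mathcal{D}(\mathcal{M}_1),\ldots,\mathcal{D}(\mathcal{M}_l)$ are the corresponding domains of attraction, then the sets $\mathcal{P}\cap\mathcal{D}(\mathcal{M}_j)$ are compact and connected positively $\Pi$-invariant sets for $j=1,\ldots,l$, they are pairwise disjoint, and $\mathcal{P}=\bigcup_{j=1}^{l}\big(\mathcal{P}\cap\mathcal{D}(\mathcal{M}_j)\big)$. In particular, if $\mathcal{P}$ is connected, it contains just one minimal set.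
   Context: Fix $r>0$ and $n\ge1$. $C=C([-r,0],\mathbb{R}^n)$ with the supremum norm $\|\cdot\|_C$; $W^{1,\infty}$ is the Banach space of Lipschitz functions $\psi:[-r,0]\to\mathbb{R}^n$ with norm $\|\psi\|_{W^{1,\infty}}=\max\{\|\psi\|_C,\|\dot\psi\|_{L^\infty}\}$. For a continuous function $y$ on $[t-r,t]$, $y_t(s)=y(t+s)$, $s\in[-r,0]$. $(\Omega,\sigma,\mathbb{R})$ is a continuous flow on a compact metric space, and $\omega\cdot t=\sigma(t,\omega)$; it is minimal if every orbit is dense in $\Omega$. $\mathrm{Lin}(X,Y)$ is the space of bounded linear maps with the operator norm. Consider the family of equations, for $\omega\in\Omega$, $$\dot y(t)=F(\omega\cdot t,\,y(t),\,y(t-\tau(\omega\cdot t,y_t))),\quad t\ge0,$$ with $F:\Omega\times\mathbb{R}^n\times\mathbb{R}^n\to\mathbb{R}^n$ and $\tau:\Omega\times C\to[0,r]$. Conditions: H1: $F$ is continuous and its partial derivatives with respect to the second and third arguments exist and are continuous on $\Omega\times\mathbb{R}^n\times\mathbb{R}^n$. H2: (1) $\tau$ is continuous and differentiable with respect to its second argument, with $D_2\tau:\Omega\times C\to\mathrm{Lin}(C,\mathbb{R})$ continuous. (2) For every compact subset $\mathcal{C}\subset\Omega\times C$ there is $L_2=L_2(\mathcal{C})>0$ with $\|D_2\tau(\omega,x_1)-D_2\tau(\omega,x_2)\|_{\mathrm{Lin}(C,\mathbb{R})}\le L_2\|x_1-x_2\|_C$ for all $(\omega,x_1),(\omega,x_2)\in\mathcal{C}$.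 Under these conditions, for each $\omega\in\Omega$ and $x\in W^{1,\infty}$ there is a unique maximal solution $y(t,\omega,x)$ with $y(s,\omega,x)=x(s)$ for $s\in[-r,0]$, defined on $[-r,\beta_{\omega,x})$, $0<\beta_{\omega,x}\le\infty$. Put $u(t,\omega,x)(s)=y(t+s,\omega,x)$, which belongs to $W^{1,\infty}$, and $\Pi(t,\omega,x)=(\omega\cdot t,u(t,\omega,x))$ for $t\in[0,\beta_{\omega,x})$. A set $\mathcal{P}$ is positively $\Pi$-invariant if $\beta_{\omega,x}=\infty$ and $\Pi(t,\omega,x)\in\mathcal{P}$ for all $(\omega,x)\in\mathcal{P}$, $t\ge0$. The omega-limit set $\mathcal{O}(\omega,x)$ of a point of such a compact set is the set of limits in $\Omega\times W^{1,\infty}$ of sequences $(\Pi(t_m,\omega,x))$ with $t_m\uparrow\infty$. A minimal set is a nonempty positively $\Pi$-invariant compact set containing properly no nonempty positively $\Pi$-invariant compact set. Every point $(\omega,\bar x)$ of a minimal set $\mathcal{M}$ admits a backward extension in $\mathcal{M}$ (a continuous $\theta:(-\infty,0]\to\mathcal{M}$ with $\theta(0)=(\omega,\bar x)$ and $\Pi(t,\theta(s))=\theta(t+s)$ whenever $s\le-t\le0$), and hence $\bar x$ is $C^1$. For a minimal set $\mathcal{M}$, $(\omega,\bar x)\in\mathcal{M}$ and $\phi\in C$ define $$\begin{aligned}L(\omega,\bar x)\phi={}&D_2F(\omega,\bar x(0),\bar x(-\tau(\omega,\bar x)))\phi(0)+D_3F(\omega,\bar x(0),\bar x(-\tau(\omega,\bar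 x)))\phi(-\tau(\omega,\bar x))\\&-D_3F(\omega,\bar x(0),\bar x(-\tau(\omega,\bar x)))\,\dot{\bar x}(-\tau(\omega,\bar x))\cdot D_2\tau(\omega,\bar x)\phi .\end{aligned}$$ For $v\in C$ let $z(t,\omega,\bar x,v)$, $t\ge-r$, be the solution of $\dot z(t)=L(\Pi(t,\omega,\bar x))z_t$, $t\ge0$, with $z(s)=v(s)$ on $[-r,0]$, and let $w(t,\omega,\bar x,v)(s)=z(t+s,\omega,\bar x,v)$, $s\in[-r,0]$ (which lies in $W^{1,\infty}$ if $v$ does). The upper Lyapunov exponent of $\mathcal{M}$ is (with $\ln0=-\infty$) $$\lambda_{\mathcal{M}}=\sup_{(\omega,\bar x)\in\mathcal{M}}\ \sup_{0\ne v\in W^{1,\infty}}\limsup_{t\to\infty}\tfrac1t\ln\|w(t,\omega,\bar x,v)\|_{W^{1,\infty}},$$ which coincides with the analogous quantity $\sup_{(\omega,\bar x)\in\mathcal{M}}\sup_{0\ne v\in C}\limsup_{t\to\infty}\frac1t\ln\|w(t,\omega,\bar x,v)\|_C$. The domain of attraction of a minimal set $\mathcal{M}$ with $\lambda_{\mathcal{M}}<0$ is the set $\mathcal{D}(\mathcal{M})$ of all $(\omega,x)\in\Omega\times W^{1,\infty}$ (with $\beta_{\omega,x}=\infty$) for which there exists $(\omega,\bar x)\in\mathcal{M}$ with $\lim_{t\to\infty}\|u(t,\omega,x)-u(t,\omega,\bar x)\|_{W^{1,\infty}}=0$. *)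

(* Defs.v *)
From HB Require Import structures.
From mathcomp Require Import all_boot all_order all_algebra.
From mathcomp Require Import all_classical all_reals all_analysis ess_sup_inf.
From mathcomp Require Import ring lra.

Set Implicit Arguments.
Unset Strict Implicit.
Unset Printing Implicit Defensive.

Import Order.TTheory GRing.Theory Num.Theory.
Import numFieldNormedType.Exports.
Local Open Scope classical_set_scope.
Local Open Scope ring_scope.

Section ae_derivable.
Context {R : realType}.
Notation mu := (@lebesgue_measure R).

Lemma monotone_lip1_ae_derivable (h : R -> R) (a b : R) : a < b ->
  {homo h : x y / x <= y} -> (forall x y, x <= y -> h y - h x <= y - x) ->
  {ae mu, forall x, x \in `]a, b[ -> derivable h x 1}.
Proof.
move=> ab hnd hlip.
have h_lip x y : `|h x - h y| <= `|x - y|.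
  have [xy|/ltW yx] := leP x y.
    by rewrite distrC [leRHS]distrC !ger0_norm ?subr_ge0 ?hnd// hlip.
  by rewrite !ger0_norm ?subr_ge0 ?hnd// hlip.
pose k x := x - h x.
have knd : {homo k : x y / x <= y}.
  by move=> x y xy; rewrite /k; have := hlip _ _ xy; lra.
have hc : continuous h.
  move=> x; apply/cvgrPdist_le => e e0; near=> y.
  apply: le_trans (h_lip _ _) _.
  by near: y; apply: cvgr_dist_le.
have kc : continuous k.
  by move=> x; apply: cvgB; [exact: cvg_id|exact: hc].
pose hC := isCumulative.Build R _ R h hnd (right_continuousW hc).
pose H : cumulative R R := HB.pack h hC.
pose kC := isCumulative.Build R _ R k knd (right_continuousW kc).
pose K : cumulative R R := HB.pack k kC.
pose lh := lebesgue_stieltjes_measure H.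
pose lk := lebesgue_stieltjes_measure K.
have LSE (G : cumulative R R) x y : x <= y ->
    lebesgue_stieltjes_measure G `]x, y]%classic = (G y - G x)%:E.
  move=> xy; rewrite /lebesgue_stieltjes_measure /measure_extension.
  rewrite measurable_mu_extE/=; last exact: is_ocitv.
  by rewrite wlength_itv_bnd// EFinB.
have sumE A : measurable A -> mu A = (lh A + lk A)%E.
  move=> mA.
  have E X : ocitv X -> mu X = measure_add lh lk X.
    move/ocitvP => [->|[[x y] /= xy ->]]; first by rewrite !measure0.
    have E0 : mu `]x, y]%classic = (y - x)%:E by exact: LSE (ltW xy).
    have E1 : lh `]x, y]%classic = (h y - h x)%:E by exact: LSE (ltW xy).
    have E2 : lk `]x, y]%classic = (k y - k x)%:E by exact: LSE (ltW xy).
    rewrite measure_addE E0; transitivity ((h y - h x)%:E + (k y - k x)%:E)%E.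
      by rewrite -EFinD; congr (_%:E); rewrite /k; ring.
    by rewrite -E1 -E2.
  by rewrite (lebesgue_measure_unique E mA); exact: measure_addE.
have le A : measurable A -> (lh A <= mu A)%E.
  by move=> mA; rewrite sumE// leeDl.
have lhoo : (lh `]a, b]%classic < +oo)%E.
  by rewrite /lh LSE ?ltW// ltry.
pose nu : {finite_measure set (measurableTypeR R) -> \bar R} :=
  mfrestr (measurable_itv `]a, b] : measurable (`]a,b]%classic : set (measurableTypeR R))) lhoo.
have nE A : nu A = lh (A `&` `]a, b]%classic) by [].
have dom : nu `<< mu.
  apply/null_content_dominatesP => A mA muA0; rewrite nE.
  apply/eqP; rewrite -measure_le0 -muA0 (le_trans (le _ _))//.
    exact: measurableI.
  by rewrite le_measure ?inE//; exact: measurableI.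
have [phi [phi0 phifin phiint phiE]] := radon_nikodym_sigma_finite dom.

pose F y := (\int[mu]_(t in [set` Interval (BRight a) (BRight y)]) (fine (phi t)))%R.
have phiint' : mu.-integrable setT (EFin \o (fun t => fine (phi t))).
  apply: eq_integrable phiint => //= x _; rewrite fineK//.
have hF x : a < x -> x < b -> h x = h a + F x.
  move=> ax xb; rewrite /F /Rintegral.
  under eq_integral do rewrite /= fineK//.
  rewrite -phiE// nE setIidl; last by apply: subset_itvl; rewrite bnd_simp ltW.
  have -> : lh `]a, x]%classic = (h x - h a)%:E by exact: LSE (ltW ax).
  by rewrite /= addrC subrK.
have intT : (setT : set R) = [set: measurableTypeR R] by [].
have phiint'' y : mu.-integrable [set` Interval (BRight a) (BRight y)]
    (EFin \o (fun t => fine (phi t))).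
  by apply: integrableS phiint' => //; exact: measurable_itv.
have := FTC1 phiint'' (open_integrable_locally openT phiint').
apply: (@filterS _ _ (ae_filter_ringOfSetsType mu)) => x dF; rewrite in_itv/= => /andP[ax xb].
have [dFx _] := dF ax.
have : derivable (fun y => h a + F y) x 1.
  apply: derivableD; last exact: dFx.
  exact: derivable_cst.
apply: near_eq_derivable; near=> y.
have : y \in `]a, b[ by near: y; apply: near_in_itvoo; rewrite in_itv/= ax.
by rewrite in_itv/= => /andP[ay yb]; rewrite -hF.
Unshelve. all: by end_near. Qed.

Lemma lipschitz_ae_derivable (f : R -> R) (a b K : R) : a < b ->
  (forall x y, `|f x - f y| <= K * `|x - y|) ->
  {ae mu, forall x, x \in `]a, b[ -> derivable f x 1}.
Proof.
move=> ab flip.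
wlog K0 : K flip / 0 < K.
  move=> /(_ (`|K| + 1)); apply; last by rewrite ltr_wpDl.
  move=> x y; apply: le_trans (flip x y) _; rewrite ler_wpM2r//.
  by apply: le_trans (ler_norm _) _; rewrite lerDl.
pose h x := (2 * K)^-1 * (f x + K * x).
have K20 : 0 < 2 * K by rewrite mulr_gt0.
have fxy x y : x <= y -> - (K * (y - x)) <= f y - f x <= K * (y - x).
  by move=> xy; rewrite -ler_norml (le_trans (flip _ _))// ger0_norm ?subr_ge0.
have hnd : {homo h : x y / x <= y}.
  move=> x y xy; rewrite /h ler_pM2l ?invr_gt0//.
  by have /andP[+ _] := fxy _ _ xy; lra.
have hlip x y : x <= y -> h y - h x <= y - x.
  move=> xy; rewrite /h -mulrBr ler_pdivrMl//.
  by have /andP[_ +] := fxy _ _ xy; lra.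
have := monotone_lip1_ae_derivable ab hnd hlip.
apply: (@filterS _ _ (ae_filter_ringOfSetsType mu)) => x hx xab.
have -> : f = (fun y => (2 * K) *: h y - K *: y).
  apply/funext => y; rewrite /h /GRing.scale/= mulrA divff ?gt_eqF// mul1r; ring.
apply: derivableB; apply: derivableZ => //.
exact: hx.
Qed.
End ae_derivable.

Section relative_derivative.
Context {R : realType} {V : normedModType R}.
Implicit Types (A : set R) (f : R -> V) (x : R).

(* One-sided at an endpoint of an interval A, two-sided in its interior. *)
Definition has_rderiv A f x (l : V) : Prop :=
  h^-1 *: (f (x + h) - f x) @[h --> within [set h | A (x + h)] 0^'] --> l.

Definition rderiv A f x : V :=
  lim (h^-1 *: (f (x + h) - f x) @[h --> within [set h | A (x + h)] 0^']).

End relative_derivative.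

Section initial_interval.
Context {R : realType} (r : {posnum R}).

Definition hist_itv : set R := `[- r%:num, 0]%classic.

Definition clamp (s : R) : R := Num.max (- r%:num) (Num.min s 0).

Lemma clamp_id s : hist_itv s -> clamp s = s.
Proof.
rewrite /hist_itv/= in_itv/= => /andP[rs s0].
by rewrite /clamp min_l// max_r.
Qed.

Lemma clamp_itv s : hist_itv (clamp s).
Proof.
rewrite /hist_itv/= in_itv/= /clamp le_max lexx/=.
by rewrite ge_max ge_min lexx orbT oppr_le0 ltW.
Qed.

Lemma clamp_dist s t : `|clamp s - clamp t| <= `|s - t|.
Proof.
have r0 : 0 < r%:num by [].
rewrite /clamp; move: r0; set a := r%:num => r0.
have E u : Num.max (- a) (Num.min u 0) =
    if u <= - a then - a else if u <= 0 then u else 0.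
  have [u0|u0] := leP u 0; have [ua|ua] := leP u (- a) => //.
  - lra.
  - by rewrite max_r// oppr_le0 ltW.
rewrite !E; have := ler_norm (s - t); have := ler_norm (t - s).
rewrite (distrC t s) ler_norml => h1 h2.
case: ifPn; rewrite -?ltNge => ?; case: ifPn; rewrite -?ltNge => ?;
  do ?(case: ifPn; rewrite -?ltNge => ?); apply/andP; split; lra.
Qed.

End initial_interval.

Section continuous_functions.
Context {R : realType} (r : {posnum R}) (n : nat).
Local Notation I := (hist_itv r).

(* A function on [-r, 0] is represented by its unique extension to R that is
   constant on each side of [-r, 0], so that Leibniz equality is equality on
   [-r, 0]. *)
Definition segC_pred : {pred R -> 'rV[R]_n} := fun f =>
  `[< {within I, continuous f} /\ forall s, f (clamp r s) = f s >].

Record segC := SegC { segC_fun :> R -> 'rV[R]_n ; _ : segC_fun \in segC_pred }.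

HB.instance Definition _ := [isSub for segC_fun].
HB.instance Definition _ := [Choice of segC by <:].

Lemma segC_submod_closed : submod_closed segC_pred.
Proof.
split.
  by apply/asboolP; split => // s; exact: cst_continuous.
move=> a f g /asboolP[cf kf] /asboolP[cg kg]; apply/asboolP; split.
  move=> s; apply: (@continuousD _ _ (subspace I)).
    by apply: (@continuousZr _ _ (subspace I)); exact: cf.
  exact: cg.
by move=> s; rewrite !fctE kf kg.
Qed.

HB.instance Definition _ :=
  GRing.isSubmodClosed.Build _ _ segC_pred segC_submod_closed.
HB.instance Definition _ := [SubChoice_isSubLmodule of segC by <:].

Lemma segC_continuous (x : segC) : {within I, continuous x}.
Proof. by case: x => f /= /asboolP[]. Qed.

Lemma segC_clamp (x : segC) s : x (clamp r s) = x s.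
Proof. by case: x => f /= /asboolP[]. Qed.

Lemma segCP (x y : segC) : {in I, x =1 y} -> x = y.
Proof.
move=> xy; apply/val_inj/funext => s /=.
by rewrite -segC_clamp -[RHS]segC_clamp xy// inE; exact: clamp_itv.
Qed.

Definition segC_norm (x : segC) : R := sup [set `|x s| | s in I].

Lemma segC_has_sup (x : segC) : has_sup [set `|x s| | s in I].
Proof.
split; first by exists `|x 0|, 0 => //; rewrite /hist_itv/= in_itv/= oppr_le0 lexx ltW.
have cI : compact I by exact: segment_compact.
have /compact_bounded[M [_ MA]] :=
  continuous_compact (segC_continuous (x := x)) cI.
exists (M + 1) => _ [s Is <-]; apply: (MA (M + 1)); first by rewrite ltrDl.
by exists s.
Qed.

Lemma segC_norm_ub (x : segC) s : `|x s| <= segC_norm x.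
Proof.
rewrite -segC_clamp; apply: sup_upper_bound; first exact: segC_has_sup.
by exists (clamp r s) => //; exact: clamp_itv.
Qed.

Lemma segC_norm_le (x : segC) c : (forall s, I s -> `|x s| <= c) ->
  segC_norm x <= c.
Proof.
move=> xc; apply: ge_sup; first exact: (segC_has_sup x).1.
by move=> _ [s Is <-]; exact: xc.
Qed.

Lemma segC_normD x y : segC_norm (x + y) <= segC_norm x + segC_norm y.
Proof.
apply: segC_norm_le => s _; apply: le_trans (ler_normD _ _) _.
by rewrite lerD// segC_norm_ub.
Qed.

Lemma segC_normZ (a : R) x : segC_norm (a *: x) = `|a| * segC_norm x.
Proof.
have le b z : segC_norm (b *: z) <= `|b| * segC_norm z.
  apply: segC_norm_le => s _; rewrite [leLHS]normrZ.
  by rewrite ler_wpM2l// segC_norm_ub.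
apply/eqP; rewrite eq_le le/=; have [->|a0] := eqVneq a 0.
  by rewrite normr0 mul0r (le_trans _ (segC_norm_ub _ 0)).
rewrite -ler_pdivlMl ?normr_gt0// -normfV.
by apply: le_trans (le _ _); rewrite scalerA mulVf// scale1r.
Qed.

Lemma segC_norm0_eq0 x : segC_norm x = 0 -> x = 0.
Proof.
move=> x0; apply: segCP => s _; apply/eqP; rewrite -normr_le0 -x0.
exact: segC_norm_ub.
Qed.

HB.instance Definition _ :=
  Lmodule_isNormed.Build R segC segC_normD segC_normZ segC_norm0_eq0.

End continuous_functions.

Section lipschitz_functions.
Context {R : realType} (r : {posnum R}) (n : nat).
Local Notation I := (hist_itv r).
Local Notation mu := (@lebesgue_measure R).

Definition segW_pred : {pred segC r n} := fun x =>
  `[< [lipschitz x s | s in I] >].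

Record segW := SegW { segW_segC :> segC r n ; _ : segW_segC \in segW_pred }.

HB.instance Definition _ := [isSub for segW_segC].
HB.instance Definition _ := [Choice of segW by <:].

Lemma segW_predP (x : segC r n) :
  (x \in segW_pred) <-> exists K, forall s t, `|x s - x t| <= K * `|s - t|.
Proof.
split.
  move=> /asboolP[M [_ /(_ (M + 1))]]; rewrite ltrDl => /(_ ltr01) xM.
  exists `|M + 1| => s t; rewrite -(segC_clamp x s) -(segC_clamp x t).
  apply: le_trans (xM (_, _) _) _ => /=; first by split; exact: clamp_itv.
  apply: le_trans (ler_wpM2r (normr_ge0 _) (ler_norm (M + 1))) _.
  by rewrite ler_wpM2l// clamp_dist.
move=> [K xK]; apply/asboolP; apply: (@klipschitzW _ _ _ K).
  apply: (@globally_properfilter _ _ (0, 0)).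
  by split; rewrite /hist_itv/= in_itv/= oppr_le0 lexx ltW.
by move=> [s t] _; exact: xK.
Qed.

Lemma segW_submod_closed : submod_closed segW_pred.
Proof.
split.
  by apply/segW_predP; exists 0 => s t; rewrite subrr normr0 mul0r.
move=> a x y /segW_predP[K xK] /segW_predP[L yL]; apply/segW_predP.
exists (`|a| * K + L) => s t /=; rewrite !fctE opprD addrACA -scalerBr.
apply: le_trans (ler_normD _ _) _; rewrite normrZ mulrDl lerD//.
by rewrite -mulrA ler_wpM2l.
Qed.

HB.instance Definition _ :=
  GRing.isSubmodClosed.Build _ _ segW_pred segW_submod_closed.
HB.instance Definition _ := [SubChoice_isSubLmodule of segW by <:].

(* By [segW_ae_deriv] below, the limit exists for almost every s in [-r, 0]. *)
Definition segW_deriv (x : segW) (s : R) : 'rV[R]_n := rderiv I x s.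

Definition segW_deriv_norm (x : segW) : \bar R :=
  ess_sup mu ((fun s => `|segW_deriv x s|%:E) \_ I).

Definition segW_norm (x : segW) : R :=
  Num.max `|x : segC r n| (fine (segW_deriv_norm x)).

Local Definition quot (x : segW) s h := h^-1 *: (x (s + h) - x s).

Local Definition quotF (s : R) : set_system R :=
  within [set h | I (s + h)] 0^'.

Lemma interior_quotF s : s \in `]- r%:num, 0[ -> quotF s = 0^'.
Proof.
move=> sr; apply/seteqP; split=> A; last exact: cvg_within.
rewrite /quotF /within/= => nA; near=> h.
have : I (s + h); last by near: h.
suff : s + h \in `]- r%:num, 0[ by apply: subset_itv_oo_cc.
near: h; apply: nbhs_dnbhs.
by apply/(nbhs0P [set z | z \in `]- r%:num, 0[]); exact: near_in_itvoo.
Unshelve. all: by end_near. Qed.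

Lemma segW_ae_deriv (x : segW) : {ae mu, forall s, I s ->
  ProperFilter (quotF s) /\ cvg (quot x s @ quotF s)}.
Proof.
have [K xK] := (segW_predP x).1 (valP x).
have dx : {ae mu, forall s, forall i j, s \in `]- r%:num, 0[ ->
    derivable (fun t => x t i j) s 1}.
  have aeij i j : {ae mu, forall s, s \in `]- r%:num, 0[ ->
      derivable (fun t => x t i j) s 1}.
    apply: (@lipschitz_ae_derivable _ _ _ _ K) => [|s t]; first by rewrite oppr_lt0.
    apply: le_trans (xK s t); rewrite [leRHS]/Num.Def.normr/= mx_normrE.
    by apply: le_trans (le_bigmax _ _ (i, j)); rewrite /= !mxE.
  have F := ae_filter_ringOfSetsType mu.
  have : {ae mu, forall s, forall ij : 'I_1 * 'I_n, s \in `]- r%:num, 0[ ->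
      derivable (fun t => x t ij.1 ij.2) s 1}.
    by apply: filter_forall => ij; exact: aeij.
  by apply: filterS => s xs i j; exact: (xs (i, j)).
have n0 (a : R) : {ae mu, forall s : R, s != a}.
  exists [set a]; split => //.
    exact: lebesgue_measure_set1.
  by move=> s /= /negP; rewrite negbK => /eqP.
have F := ae_filter_ringOfSetsType mu.
move: dx (n0 0) (n0 (- r%:num)); apply: filterS3 => s dx s0 sr.
rewrite /hist_itv/= in_itv/= => /andP[rs s0'].
have si : s \in `]- r%:num, 0[.
  by rewrite in_itv/= !lt_neqAle rs s0' s0 eq_sym sr.
rewrite interior_quotF//; split; first exact: Proper_dnbhs_numFieldType.
have /derivable_mxP : forall i j, derivable (fun t => x t i j) s 1.
  by move=> i j; exact: dx.
rewrite /derivable; suff -> : quot x s =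
  (fun h => h^-1 *: ((x \o shift s) (h *: 1) - x s)) by [].
by apply/funext => h; rewrite /quot /= [_ *: 1]mulr1 [h + s]addrC.
Qed.

Lemma segW_derivD (x y : segW) : {ae mu, forall s, I s ->
  segW_deriv (x + y) s = segW_deriv x s + segW_deriv y s}.
Proof.
have F := ae_filter_ringOfSetsType mu.
move: (segW_ae_deriv x) (segW_ae_deriv y); apply: filterS2 => s dx dy Is.
have [PF cx] := dx Is; have [_ cy] := dy Is.
rewrite /segW_deriv /rderiv -/(quotF s) -/(quot x s) -/(quot y s) -/(quot (x + y) s).
have -> : quot (x + y) s = quot x s + quot y s.
  apply/funext => h; apply: etrans (_ : quot x s h + quot y s h = _) => //.
  by rewrite /quot -scalerDr addrACA -opprD.
apply: cvg_lim; first exact: norm_hausdorff.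
exact: (cvgD cx cy).
Qed.

Lemma segW_derivZ (a : R) (x : segW) : {ae mu, forall s, I s ->
  segW_deriv (a *: x) s = a *: segW_deriv x s}.
Proof.
have F := ae_filter_ringOfSetsType mu.
move: (segW_ae_deriv x); apply: filterS => s dx Is.
have [PF cx] := dx Is.
rewrite /segW_deriv /rderiv -/(quotF s) -/(quot x s) -/(quot (a *: x) s).
have -> : quot (a *: x) s = a *: quot x s.
  apply/funext => h.
  apply: etrans (_ : h^-1 *: (a *: x (s + h) - a *: x s) = _) => //.
  apply: etrans (_ : a *: quot x s h = _) => //.
  by rewrite /quot -scalerBr !scalerA mulrC.
apply: cvg_lim; first exact: norm_hausdorff.
by apply: cvgZl_tmp.
Qed.

Lemma lebesgueT_gt0 : (0 < mu [set: R])%E.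
Proof.
have : (mu `[0%R, 1%R]%classic <= mu [set: R])%E by apply: le_measure; rewrite ?inE.
by apply: lt_le_trans; rewrite lebesgue_measure_itv/= lte_fin ltr01 oppr0 adde0.
Qed.

Lemma segW_deriv_norm_fin (x : segW) :
  segW_deriv_norm x \is a fin_num.
Proof.
have [K xK] := (segW_predP x).1 (valP x).
rewrite ge0_fin_numE; last first.
  apply: ess_sup_gee; first exact: lebesgueT_gt0.
  by apply: nearW => s; rewrite patchE; case: ifP.
apply: (@le_lt_trans _ _ `|K|%:E); last exact: ltry.
apply/ess_supP.
have F := ae_filter_ringOfSetsType mu.
move: (segW_ae_deriv x); apply: filterS => s dx.
rewrite patchE; case: ifPn => [|_]; last by rewrite lee_fin.
rewrite inE => Is; have [PF cx] := dx Is; rewrite lee_fin.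
rewrite /segW_deriv /rderiv -/(quotF s) -/(quot x s).
rewrite -lim_norm//; apply: limr_le; first exact: is_cvg_norm.
near=> h; rewrite /quot /= normrZ normfV.
have h0 : h != 0.
  by near: h; have := nbhs_dnbhs_neq (0 : R); apply: cvg_within.
rewrite ler_pdivrMl ?normr_gt0//; apply: le_trans (xK _ _) _.
by rewrite addrC addKr mulrC ler_wpM2l// ler_norm.
Unshelve. all: by end_near. Qed.

Local Lemma patch_leD (A : set R) (f g h : R -> \bar R) s :
  (A s -> f s <= g s + h s)%E -> ((f \_ A) s <= ((g \_ A) \+ (h \_ A)) s)%E.
Proof.
move=> fgh; rewrite /= !patchE; case: ifPn => [|_]; last by rewrite adde0.
by rewrite inE.
Qed.

Local Lemma patch_eqZ (A : set R) (f g : R -> \bar R) (c : \bar R) s :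
  (A s -> f s = c * g s)%E -> ((f \_ A) s = (cst c \* (g \_ A)) s)%E.
Proof.
move=> fg; rewrite /= !patchE; case: ifPn => [|_]; last by rewrite mule0.
by rewrite inE.
Qed.

Lemma le_segW_deriv_normD (x y : segW) :
  (segW_deriv_norm (x + y)%R <= segW_deriv_norm x + segW_deriv_norm y)%E.
Proof.
apply: le_trans (ess_supD _ _ _); apply: le_ess_sup.
have F := ae_filter_ringOfSetsType mu.
move: (segW_derivD x y); apply: filterS => s dxy; apply: patch_leD => Is.
by rewrite dxy// -EFinD lee_fin ler_normD.
Qed.

Lemma segW_deriv_normZ (a : R) (x : segW) :
  segW_deriv_norm (a *: x) = (`|a|%R%:E * segW_deriv_norm x)%E.
Proof.
apply: etrans (ess_supZl _ lebesgueT_gt0 (normr_ge0 a)).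
apply: eq_ess_sup.
have F := ae_filter_ringOfSetsType mu.
move: (segW_derivZ a x); apply: filterS => s dxy; apply: patch_eqZ => Is.
by rewrite dxy// normrZ EFinM.
Qed.

Lemma segW_normD x y : segW_norm (x + y) <= segW_norm x + segW_norm y.
Proof.
have dD : fine (segW_deriv_norm (x + y)) <=
    fine (segW_deriv_norm x) + fine (segW_deriv_norm y).
  have := le_segW_deriv_normD x y.
  move: (segW_deriv_norm_fin x) (segW_deriv_norm_fin y).
  move: (segW_deriv_norm_fin (x + y)).
  move: (segW_deriv_norm (x + y)) (segW_deriv_norm x) (segW_deriv_norm y).
  by move=> [a| |] [b| |] [c| |].
rewrite /segW_norm ge_max; apply/andP; split.
  by apply: le_trans (ler_normD _ _) _; rewrite lerD// le_max lexx.
by apply: le_trans dD _; rewrite lerD// le_max lexx orbT.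
Qed.

Lemma segW_normZ (a : R) x : segW_norm (a *: x) = `|a| * segW_norm x.
Proof.
rewrite /segW_norm segW_deriv_normZ maxr_pMr// fineM//.
  by congr Num.max; exact: normrZ.
exact: segW_deriv_norm_fin.
Qed.

Lemma segW_norm0_eq0 x : segW_norm x = 0 -> x = 0.
Proof.
move=> x0; apply/val_inj/eqP; rewrite -normr_le0 -x0.
by rewrite /segW_norm le_max lexx.
Qed.

HB.instance Definition _ :=
  Lmodule_isNormed.Build R segW segW_normD segW_normZ segW_norm0_eq0.

End lipschitz_functions.

Section operator_norm.
Context {R : realType} {V W : normedModType R}.

Definition opnorm (f : V -> W) : R := sup [set `|f v| | v in [set v | `|v| <= 1]].

End operator_norm.

Section flow.
Context {R : realType} {Omega : metricType R}.
Implicit Type sigma : R -> Omega -> Omega.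

Definition continuous_flow sigma : Prop :=
  [/\ continuous (fun p : R * Omega => sigma p.1 p.2),
      forall om, sigma 0 om = om &
      forall s t om, sigma (s + t) om = sigma s (sigma t om)].

Definition minimal_flow sigma : Prop :=
  forall om, dense (range (fun t => sigma t om)).

End flow.

Section delay_equation.
Context {R : realType} {r : {posnum R}} {n : nat} {Omega : metricType R}.
Local Notation E := 'rV[R]_n.
Local Notation I := (hist_itv r).
Local Notation C := (segC r n).
Local Notation W := (segW r n).
Variables (sigma : R -> Omega -> Omega).
Variables (F : Omega * E * E -> E) (tau : Omega * C -> R).

Definition D2F (om : Omega) (a b : E) : E -> E := 'd (fun y => F (om, y, b)) a.

Definition D3F (om : Omega) (a b : E) : E -> E := 'd (fun z => F (om, a, z)) b.

Definition D2tau (om : Omega) (x : C) : C -> R :=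
  'd (fun x' => tau (om, x')) x.

Definition cond_H1 : Prop :=
  [/\ continuous F,
      forall om a b, differentiable (fun y => F (om, y, b)) a,
      forall om a b, differentiable (fun z => F (om, a, z)) b,
      continuous
        (fun p : Omega * E * E => 'J (fun y => F (p.1.1, y, p.2)) p.1.2) &
      continuous
        (fun p : Omega * E * E => 'J (fun z => F (p.1.1, p.1.2, z)) p.2)].

Definition cond_H2 : Prop :=
  [/\ continuous tau,
      forall om x, differentiable (fun x' => tau (om, x')) x,
      forall p : Omega * C,
        opnorm (D2tau q.1 q.2 \- D2tau p.1 p.2) @[q --> p] --> 0 &
      forall K : set (Omega * C), compact K -> exists2 L2 : R, 0 < L2 &
        forall om x1 x2, K (om, x1) -> K (om, x2) ->
          opnorm (D2tau om x1 \- D2tau om x2) <= L2 * `|x1 - x2|].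

(* The segment y_t; meaningful when y is continuous on [t - r, t], and 0 by
   convention otherwise. *)
Definition hist (y : R -> E) (t : R) : C :=
  insubd (0 : C) (fun s => y (t + clamp r s)).

(* p = (omega, x); at t = 0 the equation involves the right derivative. *)
Definition is_solution (p : Omega * W) (b : \bar R) (y : R -> E) : Prop :=
  [/\ (0 < b)%E,
      {within [set t | - r%:num <= t /\ (t%:E < b)%E], continuous y},
      forall s, I s -> y s = p.2 s &
      forall t, 0 <= t -> (t%:E < b)%E ->
        has_rderiv `[0, +oo[ y t
          (F (sigma t p.1, y t, y (t - tau (sigma t p.1, hist y t))))].

Definition is_maximal_solution p b y : Prop :=
  is_solution p b y /\
  forall b' y', is_solution p b' y' -> (b <= b')%E ->
    (forall t, - r%:num <= t -> (t%:E < b)%E -> y' t = y t) -> b' = b.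

(* Under H1 and H2 the pair is unique up to the values of the function outside
   [-r, b), which are arbitrary. *)
Definition maxsol p : \bar R * (R -> E) :=
  xget (0%E, cst 0) [set q | is_maximal_solution p q.1 q.2].

Definition lifetime p : \bar R := (maxsol p).1.

Definition sol p : R -> E := (maxsol p).2.

Definition usol (t : R) p : W := insubd (0 : W) (hist (sol p) t).

Definition Pi (t : R) (p : Omega * W) : Omega * W := (sigma t p.1, usol t p).

Definition pos_invariant (P : set (Omega * W)) : Prop :=
  forall p, P p -> lifetime p = +oo%E /\ forall t, 0 <= t -> P (Pi t p).

Definition omega_limit (p : Omega * W) : set (Omega * W) :=
  [set q | exists tm : R^nat,
    [/\ forall m, 0 <= tm m, nondecreasing_seq tm,
        tm @ \oo --> +oo & Pi (tm m) p @[m --> \oo] --> q]].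

Definition minimal_set (M : set (Omega * W)) : Prop :=
  [/\ M !=set0, pos_invariant M, compact M &
      forall N, N `<=` M -> N !=set0 -> pos_invariant N -> compact N -> N = M].

Definition linop (p : Omega * W) (phi : C) : E :=
  let: (om, x) := p in
  let d := tau (om, x : C) in
  D2F om (x 0) (x (- d)) (phi 0) + D3F om (x 0) (x (- d)) (phi (- d))
  - D2tau om x phi *: D3F om (x 0) (x (- d)) (segW_deriv x (- d)).

Definition is_variational_solution (p : Omega * W) (v : C) (z : R -> E) : Prop :=
  [/\ {within `[- r%:num, +oo[, continuous z},
      forall s, I s -> z s = v s &
      forall t, 0 <= t -> has_rderiv `[0, +oo[ z t (linop (Pi t p) (hist z t))].

Definition varsol p v : R -> E := xget (cst 0) (is_variational_solution p v).

Definition wsol (t : R) p (v : W) : W := insubd (0 : W) (hist (varsol p v) t).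

Definition upper_lyapunov (M : set (Omega * W)) : \bar R :=
  ereal_sup [set limf_esup
      (fun t : R => (t^-1)%:E * lne `|wsol t pv.1 pv.2|%:E)%E
      (+oo : set_system R)
    | pv in M `*` [set v : W | v != 0]].

Definition attraction_domain (M : set (Omega * W)) : set (Omega * W) :=
  [set p | lifetime p = +oo%E /\ exists2 x, M (p.1, x) &
    `|usol t p - usol t (p.1, x)| @[t --> +oo] --> 0].

Definition minimal_subsets (P : set (Omega * W)) : set (set (Omega * W)) :=
  [set M | minimal_set M /\ M `<=` P].

End delay_equation.

(* Main.v *)
(** Fix a minimal set M in P.  If the C-distance d between points of P and of M
    over the same base point did not contract uniformly near M, there would be
    p_m in P and q_m in M over the same base point, with d(p_m, q_m) -> 0, whose
    distance stays above half of its initial value on [r, m + r].  The normalized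
    differences of the two solutions are equi-Lipschitz, and along an ultrafilter
    they converge to a solution of the variational equation along M whose norm
    stays above 1/2; this contradicts lambda_M < 0.  (The derivative of the state
    enters the variational equation only at time -tau in the past, where it is
    continuous since one delay r has elapsed.)

    The rest is topological dynamics.  Uniform contraction makes the points of a
    fiber of M uniformly separated along backward orbits, and minimality of the
    base flow lets one transport fibers, so that M is open over Omega; hence the
    set of points of P attracted by M is open in P, and any p in P whose
    omega-limit set contains M is attracted by M, so that this omega-limit set is
    M.  The basins are therefore disjoint, open and cover the compact set P: they
    are finitely many and compact.  A clopen piece of a basin is positively
    invariant along with its complement in the basin, and each of the two, if
    nonempty, would contain M, so that basins are connected.  In P, attraction in
    C and in W are equivalent because P is compact in W. *)

Require Import Defs.
From HB Require Import structures.
From mathcomp Require Import all_boot all_order all_algebra.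
From mathcomp Require Import all_classical all_reals all_analysis ess_sup_inf.
From mathcomp Require Import ring lra.

Set Implicit Arguments.
Unset Strict Implicit.
Unset Printing Implicit Defensive.

Import Order.TTheory GRing.Theory Num.Theory.
Import numFieldNormedType.Exports.
Local Open Scope classical_set_scope.
Local Open Scope ring_scope.

(** Distances are measured in C although states live in W. Normalized differences of solutions are
    relatively compact in C on later time windows, while linearizing in W would require control of
    differences of derivatives. The price is that a normalized initial difference has no Lipschitz
    bound, so the quotients are usable only after one delay; hence the lower bound [r] on
    contraction times. What W still has to provide is compactness of [P], which turns C-limits into
    W-limits. A negative exponent gives no uniform time at which variational solutions start to
    decay. Only one halving within bounded time is therefore claimed; its failure on windows of
    every length produces a single variational solution bounded below forever, and iterating the
    halving recovers uniform decay. The semiflow has no inverse: surjectivity on [M], a consequence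
    of minimality, supplies preimages, and limits of many chosen preimages are needed at once, just
    as limits of solutions are needed at all times at once. Ultrafilters handle both without
    diagonal subsequences. *)

Section ultrafilters.

Lemma ultra_fmap (J T : Type) (f : J -> T) (G : set_system J) :
  UltraFilter G -> UltraFilter (f @ G).
Proof.
move=> GU; split; first exact: fmap_proper_filter.
move=> H HF sGH; apply/seteqP; split=> // A HA.
have [//|GnA] := in_ultra_setVsetC (f @^-1` A) GU.
have /filter_ex[x [Ax nAx]] : H (A `&` ~` A) by apply: filterI => //; exact: sGH.
by [].
Qed.

(** Plays the part of extracting a convergent subsequence; any number of families converge along the
    same [G]. *)
Lemma ultra_conv (J : Type) (T : topologicalType) (A : set T) (f : J -> T)
    (G : set_system J) : UltraFilter G -> compact A ->
  (\forall j \near G, A (f j)) -> exists2 a, A a & f @ G --> a.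
Proof.
move=> GU; rewrite compact_ultra => cA GA.
by have [a [Aa fa]] := cA _ (ultra_fmap f GU) GA; exists a.
Qed.

(** If a neighbourhood [V] of [l] were missed, [F] restricted to the complement of the preimage of
    [V] would be proper, and an ultrafilter above it would contradict the hypothesis. *)
Lemma cvg_ultra (J : Type) (T : topologicalType) (f : J -> T) (F : set_system J)
    (l : T) : Filter F ->
  (forall G, UltraFilter G -> F `<=` G -> f @ G --> l) -> f @ F --> l.
Proof.
move=> FF fl V lV; apply: contrapT => nFV.
pose F' := within (~` (f @^-1` V)) F.
have F'P : ProperFilter F'.
  apply: Build_ProperFilter_ex => A F'A.
  apply: contrapT => nA; apply: nFV; apply: (@filterS _ F FF _ _ _ F'A) => j Aj.
  by apply: contrapT => nVj; apply: nA; exists j; exact: Aj.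
have [G [GU sG]] := ultraFilterLemma F'P.
have GV : G (f @^-1` V).
  by apply: (fl G GU _ V lV) => A FA; apply: sG; apply: filterS FA.
have GnV : G (~` (f @^-1` V)) by apply: sG; apply: nearW.
have : G ((f @^-1` V) `&` (~` (f @^-1` V))) by exact: filterI.
by move/filter_ex => [j []].
Qed.

Lemma ultra_cluster (J : Type) (T : topologicalType) (f : J -> T)
    (F : set_system J) (a : T) : Filter F -> cluster (f @ F) a ->
  exists G, [/\ UltraFilter G, F `<=` G & f @ G --> a].
Proof.
move=> FF fa.
pose D := [set AV : set J * set T | F AV.1 /\ nbhs a AV.2].
pose B (AV : set J * set T) := AV.1 `&` f @^-1` AV.2.
have PF : ProperFilter (filter_from D B).
  apply: filter_from_proper; last first.
    move=> [A V] [/= FA aV].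
    have [_ [[j Aj <-] Vj]] : (f @` A) `&` V !=set0.
      by apply: fa => //; apply: (@filterS _ F FF A) => // j Aj; exists j.
    by exists j.
  apply: filter_from_filter; first by exists (setT, setT); split; exact: filterT.
  move=> [A V] [A' V'] [/= FA aV] [/= FA' aV'].
  exists (A `&` A', V `&` V'); first by split; exact: filterI.
  by move=> j [[/= ? ?] [? ?]].
have [G [GU sG]] := ultraFilterLemma PF; exists G; split => //.
  by move=> A FA; apply: sG; exists (A, setT); [split => //; exact: filterT|move=> j []].
move=> V aV; apply: sG; exists (setT, V); first by split => //; exact: filterT.
by move=> j [].
Qed.

Lemma cvg_ultra_unique (T : topologicalType) (J : Type) (f : J -> T)
    (G : set_system J) (a b : T) : hausdorff_space T -> ProperFilter G ->
  f @ G --> a -> f @ G --> b -> a = b.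
Proof. by move=> hT GP fa fb; exact: (@cvg_unique _ hT (f @ G)). Qed.

Lemma filter_ex2 (T : Type) (F : set_system T) (A B : set T) :
  ProperFilter F -> F A -> F B -> exists2 x, A x & B x.
Proof.
move=> PF FA FB; have /filter_ex[x [Ax Bx]] : F (A `&` B) by exact: filterI.
by exists x.
Qed.

(** [G] refines [\oo], so it is not concentrated on one index. This is the pigeonhole behind
    recurrence and finiteness. *)
Lemma ultra_oo_pair (G : set_system nat) (A : set nat) : ProperFilter G ->
  \oo `<=` G -> G A -> exists k l : nat, [/\ (k < l)%N, A k & A l].
Proof.
move=> PG ooG GA; have /filter_ex[k Ak] := GA.
have : G (A `&` [set l | (k < l)%N]).
  by apply: filterI => //; apply: ooG; exists k.+1.
by move=> /filter_ex[l [Al /= kl]]; exists k, l.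
Qed.

End ultrafilters.

Section positive_part.
Context {R : realType}.
Implicit Types s t : R.

Lemma maxr0_dist s t : `|Num.max s 0 - Num.max t 0| <= `|s - t|.
Proof.
have := ler_norm (s - t); have := ler_norm (t - s); rewrite (distrC t s).
move=> h1 h2; rewrite ler_norml.
by have [s0|s0] := leP s 0; have [t0|t0] := leP t 0; apply/andP; split; lra.
Qed.

Lemma maxr0_continuous : continuous (fun t : R => Num.max t 0).
Proof.
move=> t; apply/cvgrPdist_lt => e e0; near=> s.
by apply: le_lt_trans (maxr0_dist _ _) _; near: s; exact: cvgr_dist_lt.
Unshelve. all: by end_near. Qed.

End positive_part.

(** * Semiflows contracting along the fibers of minimal sets *)

Section semiflow.
Context {R : realType} {X : pseudoMetricType R} {Omega : metricType R}.
Variables (sigma : R -> Omega -> Omega) (pi : X -> Omega) (Phi : R -> X -> X).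
Variables (d : X -> X -> R) (P : set X) (r : R).

Definition semiflow_inv (N : set X) : Prop :=
  forall p, N p -> forall t, 0 <= t -> N (Phi t p).

Definition minset (M : set X) : Prop :=
  [/\ M !=set0, semiflow_inv M, compact M &
      forall N, N `<=` M -> N !=set0 -> semiflow_inv N -> compact N -> N = M].

(** The lower bound [r] makes successive halving times tend to infinity, the upper bound [T] makes
    the decay geometric, and [K] controls the distance between halvings. *)
Definition fiber_contraction (M : set X) (T eps K : R) : Prop :=
  [/\ 0 < T, 0 < eps, 0 <= K &
    forall p q, P p -> M q -> pi p = pi q -> d p q < eps ->
      (exists2 t, r <= t <= T & d (Phi t p) (Phi t q) <= d p q / 2) /\
      (forall t, 0 <= t <= T -> d (Phi t p) (Phi t q) <= K * d p q)].

Definition basin (M : set X) : set X := [set p | exists q,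
  [/\ M q, pi q = pi p & d (Phi t p) (Phi t q) @[t --> +oo] --> 0]].

Definition omega_lim (p : X) : set X :=
  [set q | exists tm : R^nat,
    [/\ forall m, 0 <= tm m, nondecreasing_seq tm,
        tm @ \oo --> +oo & Phi (tm m) p @[m --> \oo] --> q]].

(** [d] models the distance of states in C: it is continuous for the topology of [X] but separates
    points of one fibre only. [Phi_ultra] is joint continuity in time and state, restricted to [P],
    outside of which no continuity is available. *)
Hypotheses (compact_Omega : compact [set: Omega])
  (flow_sigma : continuous_flow sigma) (minimal_sigma : minimal_flow sigma)
  (hX : hausdorff_space X) (pi_cont : continuous pi) (r_gt0 : 0 < r)
  (P_compact : compact P) (P_inv : semiflow_inv P)
  (Phi0 : forall p, P p -> Phi 0 p = p)
  (PhiD : forall p (s t : R), P p -> 0 <= s -> 0 <= t ->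
     Phi (s + t) p = Phi s (Phi t p))
  (pi_Phi : forall t p, pi (Phi t p) = sigma t (pi p))
  (Phi_ultra : forall (J : Type) (G : set_system J) (s : J -> R) (p : J -> X) (t : R) a,
     UltraFilter G -> (forall j, 0 <= s j) -> (forall j, P (p j)) ->
     0 <= t -> P a -> s @ G --> t -> p @ G --> a ->
     Phi (s j) (p j) @[j --> G] --> Phi t a)
  (d_cont : continuous (fun z : X * X => d z.1 z.2))
  (d_ge0 : forall p q, 0 <= d p q)
  (d_refl : forall p, d p p = 0)
  (d_sym : forall p q, d p q = d q p)
  (d_tri : forall p q s, d p s <= d p q + d q s)
  (d_eq0 : forall p q, pi p = pi q -> d p q = 0 -> p = q).

Local Lemma hO : hausdorff_space Omega. Proof. exact: metric_hausdorff. Qed.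

Local Lemma d_cvg (J : Type) (G : set_system J) (p q : J -> X) a b : Filter G ->
  p @ G --> a -> q @ G --> b -> d (p j) (q j) @[j --> G] --> d a b.
Proof.
move=> GF pa qb.
apply: continuous2_cvg => //.
by have := @d_cont (a, b); rewrite /continuous_at/=; exact.
Qed.

Local Lemma d_near (J : Type) (G : set_system J) (p : J -> X) a e : Filter G ->
  p @ G --> a -> 0 < e -> \forall j \near G, d (p j) a < e.
Proof.
by move=> GF pa e0; apply: (cvgr_lt _ (d_cvg _ pa (cvg_cst a))); rewrite d_refl.
Qed.

Local Lemma Phi_cvg (J : Type) (G : set_system J) (s : R) (p : J -> X) a :
  Filter G -> (forall j, P (p j)) -> 0 <= s -> P a -> p @ G --> a ->
  Phi s (p j) @[j --> G] --> Phi s a.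
Proof.
move=> GF Pp s0 Pa pa; apply: cvg_ultra => H HU sH.
apply: Phi_ultra => //; first exact: cvg_cst.
by apply: cvg_trans pa => A; exact: sH.
Qed.

(** * Decay of distances near a minimal set *)

Section decay.
Variables (M : set X) (T eps K : R).
Hypotheses (sMP : M `<=` P) (M_inv : semiflow_inv M)
  (MC : fiber_contraction M T eps K).

Lemma decay_bounded p q t : P p -> M q -> pi p = pi q -> d p q < eps -> 0 <= t ->
  d (Phi t p) (Phi t q) <= K * d p q.
Proof.
have [T0 e0 K0 C] := MC; move=> Pp Mq pq dpq t0.
(* Every halving uses up at least [r] of time, so at most [k] restarts exhaust [t]; the last stretch
   is at most [T] long, where [K] applies. *)
have [k tk] : exists k : nat, t <= k%:R * r.
  exists (Num.bound (t / r)); rewrite -ler_pdivrMr//.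
  by apply: ltW; apply: archi_boundP; rewrite divr_ge0// ltW.
elim: k p q t Pp Mq pq dpq t0 tk => [|k IH] p q t Pp Mq pq dpq t0 tk.
  by apply: (C _ _ Pp Mq pq dpq).2; rewrite t0 (le_trans tk)// mul0r ltW.
have [tT|Tt] := leP t T; first by apply: (C _ _ Pp Mq pq dpq).2; rewrite t0.
have [[s /andP[rs sT] ds] _] := C _ _ Pp Mq pq dpq.
have s0 : 0 <= s by rewrite (le_trans _ rs)// ltW.
have Et z : P z -> Phi t z = Phi (t - s) (Phi s z).
  by move=> Pz; rewrite -PhiD ?subrK ?subr_ge0// (le_trans sT)// ltW.
rewrite !Et//; last exact: sMP.
apply: le_trans (IH _ _ _ _ _ _ _ _ _) _ => //.
- exact: P_inv.
- exact: M_inv.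
- by rewrite !pi_Phi pq.
- by apply: le_lt_trans ds (le_lt_trans _ dpq); rewrite ler_pdivrMr// mulr2n mulrDr !mulr1 lerDl.
- by rewrite subr_ge0 (le_trans sT)// ltW.
- by rewrite lerBlDr (le_trans tk)// -natr1 mulrDl mul1r lerD2l.
- rewrite ler_wpM2l// (le_trans ds)// ler_pdivrMr// mulr2n mulrDr !mulr1 lerDl.
  exact: d_ge0.
Qed.

(** [k] successive halvings, each within time [T], take at most [k * T]; from there on
    [decay_bounded] holds for all later times. *)
Lemma decay_geometric (k : nat) p q t : P p -> M q -> pi p = pi q -> d p q < eps ->
  k%:R * T <= t -> d (Phi t p) (Phi t q) <= K * (d p q / 2 ^+ k).
Proof.
have [T0 e0 K0 C] := MC; elim: k p q t => [|k IH] p q t Pp Mq pq dpq kt.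
  by rewrite expr0 divr1 decay_bounded// (le_trans _ kt)// mul0r.
have [[s /andP[rs sT] ds] _] := C _ _ Pp Mq pq dpq.
have s0 : 0 <= s by rewrite (le_trans _ rs)// ltW.
have kts : k%:R * T <= t - s.
  by rewrite lerBrDr (le_trans _ kt)// -natr1 mulrDl mul1r lerD2l.
have ts : 0 <= t - s by rewrite (le_trans _ kts)// mulr_ge0// ltW.
have Et z : P z -> Phi t z = Phi (t - s) (Phi s z).
  by move=> Pz; rewrite -PhiD ?subrK.
rewrite !Et//; last exact: sMP.
apply: le_trans (IH _ _ _ _ _ _ _ kts) _.
- exact: P_inv.
- exact: M_inv.
- by rewrite !pi_Phi pq.
- by apply: le_lt_trans ds (le_lt_trans _ dpq); rewrite ler_pdivrMr// mulr2n mulrDr !mulr1 lerDl.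
- by rewrite ler_wpM2l// exprS invfM mulrA ler_wpM2r// invr_ge0 exprn_ge0.
Qed.

Lemma decay_uniform eta : 0 < eta -> exists2 S, 0 <= S &
  forall p q t, P p -> M q -> pi p = pi q -> d p q < eps -> S <= t ->
    d (Phi t p) (Phi t q) < eta.
Proof.
have [T0 e0 K0 C] := MC; move=> eta0.
have Ke : 0 <= K * eps / eta by rewrite !mulr_ge0// ?invr_ge0 ltW.
(* This choice gives [K * eps < k * eta], and [k < 2 ^+ k] turns it into
   [K * eps / 2 ^+ k < eta]. *)
pose k := Num.bound (K * eps / eta).
exists (k%:R * T); first by rewrite mulr_ge0// ltW.
move=> p q t Pp Mq pq dpq kt.
apply: le_lt_trans (decay_geometric Pp Mq pq dpq kt) _.
rewrite mulrA ltr_pdivrMr ?exprn_gt0//.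
have : K * eps < k%:R * eta by rewrite -ltr_pdivrMr// archi_boundP.
move=> h; apply: le_lt_trans (lt_le_trans h _).
  by rewrite ler_wpM2l// ltW.
rewrite mulrC ler_pM2l// -natrX ler_nat ltnW//.
exact: ltn_expl.
Qed.

End decay.

(** * Backward limits in the base and preimages in minimal sets *)

Lemma sigma_cvg (J : Type) (G : set_system J) (s : J -> R) (om : J -> Omega)
    (t : R) (a : Omega) : Filter G -> s @ G --> t -> om @ G --> a ->
  sigma (s j) (om j) @[j --> G] --> sigma t a.
Proof.
move=> GF st oma; have [cs _ _] := flow_sigma.
apply: continuous2_cvg => //.
by have := cs (t, a); rewrite /continuous_at/=; exact.
Qed.

(** Minimality makes full orbits dense, but backward times are wanted. A limit [c] of the backward
    orbit of [a] has a dense orbit, and each point [sigma s c] of it is again approached by the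
    backward orbit of [a], with times shifted by the fixed [s]. *)
Lemma alpha_limit_full (a b : Omega) : exists G : set_system R,
  [/\ UltraFilter G, pinfty_nbhs R `<=` G & sigma (- t) a @[t --> G] --> b].
Proof.
have [_ s0 sD] := flow_sigma.
apply: ultra_cluster => A B /= [N [_ NA]] bB.
have [U [UU sU]] := ultraFilterLemma (@proper_pinfty_nbhs R).
have Ut : \forall t \near U, setT (sigma (- t) a) by exact: nearW.
have [c _ ac] := ultra_conv UU compact_Omega Ut.
have : (B^° `&` range (fun t => sigma t c)) !=set0.
  apply: minimal_sigma; last exact: open_interior.
  by exists b; exact: bB.
move=> [c' [+ [s _ sc]]]; rewrite -sc => Bs.
have : \forall t \near U, B (sigma s (sigma (- t) a)).
  by have := sigma_cvg _ (@cvg_cst _ s _ U _) ac; exact.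
have : \forall t \near U, N + s < t.
  by apply: sU; exists (N + s); split => //; exact: num_real.
move=> Us UB; have [t Nt Bt] := filter_ex2 _ Us UB.
exists (sigma (- (t - s)) a); split; last by rewrite opprB sD.
by apply: NA; rewrite ltrBrDr.
Qed.

(** The image of [M] under [Phi t] is a nonempty compact invariant subset of [M], hence all of [M].
    This is the source of backward extensions. *)
Lemma minset_onto M t : minset M -> M `<=` P -> 0 <= t ->
  forall q, M q -> exists2 p, M p & Phi t p = q.
Proof.
move=> [[m0 Mm0] Minv Mc Mmin] sMP t0 q.
suff E : Phi t @` M = M by rewrite -[in X in X -> _]E => -[p Mp <-]; exists p.
apply: Mmin.
- by move=> _ [p Mp <-]; exact: Minv.
- by exists (Phi t m0), m0.
- move=> _ [p Mp <-] s s0; exists (Phi s p); first exact: Minv.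
  by rewrite -!PhiD// 1?addrC//; exact: sMP.
- rewrite compact_ultra => G GU GM.
  (* [g] is a section of [Phi t] over the image, with the default [m0] elsewhere; it carries the
     ultrafilter into the compact set [M], and [Phi t] brings the limit back. *)
  pose g y := if pselect ((Phi t @` M) y) is left h then sval (cid2 h) else m0.
  have gP y : M (g y) /\ ((Phi t @` M) y -> Phi t (g y) = y).
    rewrite /g; case: pselect => // h; split; last by move=> _; case: cid2.
    by case: cid2.
  have [a Ma ga] := ultra_conv GU Mc (nearW _ (fun y => (gP y).1)).
  exists (Phi t a); split; first by exists a.
  have : Phi t (g y) @[y --> G] --> Phi t a.
    apply: Phi_cvg => // [y|]; last exact: sMP.
    by apply: sMP; exact: (gP y).1.
  move=> + A aA => /(_ A aA) h; apply: (@filterS2 _ G _ _ _ _ _ h GM) => y /= Ay yM.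
  by rewrite -(gP y).2.
Qed.

(** * Openness of a minimal set over the base *)

Section openness.
Variables (M : set X) (T eps K : R).
Hypotheses (sMP : M `<=` P) (M_min : minset M) (MC : fiber_contraction M T eps K).

Let M_inv : semiflow_inv M. Proof. by case: M_min. Qed.
Let M_compact : compact M. Proof. by case: M_min. Qed.

(* Each point of a fiber of M is followed backwards in time, along times at
   which the base point tends to b; points that get close to each other again
   and again in the past coincide. *)
Lemma fiber_transport (a b : Omega) : exists f : X -> X,
  (forall x, M x -> pi x = a -> M (f x) /\ pi (f x) = b) /\
  (forall x y, M x -> M y -> pi x = a -> pi y = a -> d (f x) (f y) < eps -> x = y).
Proof.
have [sc s0 sD] := flow_sigma.
have [G [GU ooG Gb]] := alpha_limit_full a b.
have GP : ProperFilter G := @ultra_proper _ _ GU.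
have /choice[th thP] : forall x : X, exists th : R -> X, M x -> forall t, 0 <= t ->
    M (th t) /\ Phi t (th t) = x.
  move=> x; have [Mx|nMx] := pselect (M x); last by exists (fun=> x).
  have /choice[th thP] : forall t : R, exists y, 0 <= t -> M y /\ Phi t y = x.
    move=> t; have [t0|t0] := leP 0 t; last by exists x.
    by have [y My yx] := minset_onto M_min sMP t0 Mx; exists y.
  by exists th.
have tge S : \forall t \near G, S <= t.
  by apply: ooG; exists S; split; [exact: num_real|move=> t /ltW].
have /choice[f fP] : forall x : X, exists l, M x -> M l /\ th x t @[t --> G] --> l.
  move=> x; have [Mx|nMx] := pselect (M x); last by exists x.
  have [|l Ml xl] := ultra_conv GU M_compact (f := th x); last by exists l.
  by apply: filterS (tge 0) => t t0; apply: (thP x Mx t t0).1.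
exists f; split.
  move=> x Mx xa; have [Mf xf] := fP x Mx; split => //.
  apply: (cvg_ultra_unique hO GP (f := fun t => pi (th x t))).
    apply: (@cvg_comp _ _ _ (th x) pi G (nbhs (f x))) => //.
    exact: pi_cont.
  apply: cvg_trans Gb; apply: near_eq_cvg.
  apply: filterS (tge 0) => t t0.
  have [_ <-] := thP x Mx t t0.
  rewrite -xa -[in LHS](thP x Mx t t0).2 pi_Phi -sD addNr s0.
  by rewrite (thP x Mx t t0).2.
move=> x y Mx My xa ya fxy.
apply: d_eq0; first by rewrite xa ya.
apply/eqP; rewrite eq_le d_ge0 andbT; apply/ler_addgt0Pl => e e0; rewrite addr0.
have [S S0 SP] := decay_uniform sMP M_inv MC e0.
have [Mfx xf] := fP x Mx; have [Mfy yf] := fP y My.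
have dxy : \forall t \near G, d (th x t) (th y t) < eps.
  by apply: (cvgr_lt _ (d_cvg _ xf yf)).
have [t St dt] := filter_ex2 _ (tge S) dxy.
have t0 := le_trans S0 St.
have [Mx' ex] := thP x Mx t t0; have [My' ey] := thP y My t t0.
rewrite -ex -ey; apply/ltW/SP => //; first exact: sMP.
apply: (can_inj (g := sigma (- t)) (f := sigma t)) => [om|].
  by rewrite -sD addNr s0.
by rewrite -!pi_Phi ex ey xa ya.
Qed.

(* Limits of the transport maps as b tends to a form an injective self-map Th of
   the fiber over a; its iterates at x return close to each other, so x is in
   the range of Th. *)
Lemma fiber_open x (V : set X) : M x -> nbhs x V ->
  \forall b \near nbhs (pi x), exists q, [/\ M q, pi q = b & V q].
Proof.
move=> Mx xV; apply: contrapT => nV.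
pose a := pi x.
(* If the claim fails, some ultrafilter tends to [a] through base points over which [M] misses [V];
   a transported point tending to [x] will contradict this. *)
pose bad := ~` [set b | exists q, [/\ M q, pi q = b & V q]].
have PF : ProperFilter (within bad (nbhs a)).
  apply: Build_ProperFilter_ex => A FA; apply: contrapT => nA; apply: nV.
  apply: (@filterS _ (nbhs a) _ _ _ _ FA) => b Ab; apply: contrapT => nb; apply: nA.
  by exists b; exact: Ab.
have [G [GU sG]] := ultraFilterLemma PF.
have GP : ProperFilter G := @ultra_proper _ _ GU.
have Gbad : G bad by apply: sG; exact: nearW.
have Ga : id @ G --> a.
  by move=> A aA; apply: sG; apply: filterS aA => b.
have [f fP] := choice (fiber_transport a).
have /choice[Th ThP] : forall y, exists l, M y -> pi y = a ->
    [/\ M l, pi l = a & f b y @[b --> G] --> l].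
  move=> y; have [[My ya]|nMy] := pselect (M y /\ pi y = a); last first.
    by exists y => My ya; exfalso; exact: nMy.
  have [|l Ml yl] := ultra_conv GU M_compact (f := f ^~ y).
    by apply: nearW => b; apply: ((fP b).1 y My ya).1.
  exists l => _ _; split => //.
  apply: (cvg_ultra_unique hO GP (f := fun b => pi (f b y))).
    by apply: (@cvg_comp _ _ _ (f ^~ y) pi G (nbhs l)) => //; exact: pi_cont.
  apply: cvg_trans Ga; apply: near_eq_cvg; apply: nearW => b.
  by rewrite ((fP b).1 y My ya).2.
have Thinj y z : M y -> M z -> pi y = a -> pi z = a ->
    d (Th y) (Th z) < eps -> y = z.
  move=> My Mz ya za dyz.
  have [_ _ yl] := ThP y My ya; have [_ _ zl] := ThP z Mz za.
  have /filter_ex[b] : \forall b \near G, d (f b y) (f b z) < eps.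
    by apply: (cvgr_lt _ (d_cvg _ yl zl)).
  exact: (fP b).2.
pose u k := iter k Th x.
have uP k : M (u k) /\ pi (u k) = a.
  by elim: k => [|k [Mu au]] //=; have [] := ThP _ Mu au.
have eps0 : 0 < eps by case: MC.
have [y [My ya Thy]] : exists y, [/\ M y, pi y = a & Th y = x].
  have [U [UU sU]] := ultraFilterLemma (eventually_filter).
  have UP : ProperFilter U := @ultra_proper _ _ UU.
  have [l Ml ul] := ultra_conv UU M_compact (nearW _ (fun k => (uP k).1)).
  have : \forall k \near U, d (u k) l < eps / 2.
    by apply: d_near ul _; rewrite divr_gt0.
  (* Closeness of [u k] and [u m] gives equality only one index lower, so [k] must be positive;
     equality then descends to [u 0 = u (m - k)], which exhibits [x] as a value of [Th]. *)
  have U0 : \forall k \near U, (0 < k)%N by apply: sU; exists 1%N.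
  move=> Ul; have [|k [m [km [dk k0] [dm _]]]] := ultra_oo_pair UP sU (A :=
    [set k | d (u k) l < eps / 2] `&` [set k | (0 < k)%N]); first exact: filterI.
  have : d (u k) (u m) < eps.
    rewrite (splitr eps); apply: le_lt_trans (d_tri _ l _) _.
    by rewrite ltrD// d_sym.
  rewrite -(subnKC (ltnW km)).
  have : (0 < m - k)%N by rewrite subn_gt0.
  case: (m - k)%N => // j _; case: k k0 {km dk dm Ul} => // k _ dk.
  exists (u j); have [Mj aj] := uP j; split => //.
  suff : u 0%N = u j.+1 by move=> E; exact: (esym E).
  elim: k dk => [|k IH] dk.
    by apply: Thinj dk; [exact: (uP 0%N).1|exact: (uP j.+1).1
      |exact: (uP 0%N).2|exact: (uP j.+1).2].
  apply: IH; rewrite -(_ : u k.+1 = u (k.+1 + j.+1)%N) ?d_refl//.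
  by apply: Thinj dk; [exact: (uP k.+1).1|exact: (uP (k.+1 + j.+1)%N).1
      |exact: (uP k.+1).2|exact: (uP (k.+1 + j.+1)%N).2].
have [_ _ yx] := ThP y My ya; rewrite Thy in yx.
have GV : \forall b \near G, V (f b y) by exact: yx.
have [b bb Vb] := filter_ex2 _ Gbad GV.
apply: bb; exists (f b y); have [My' yb] := (fP b).1 y My ya.
by split.
Qed.

(** A point close to [M] could have no partner in [M] over its own base point; [fiber_open] provides
    one close to [x]. Both points lie within [eps / 2] of [x]. *)
Lemma contraction_nbhs x : M x ->
  \forall p \near nbhs x, exists q, [/\ M q, pi q = pi p & d p q < eps].
Proof.
move=> Mx; have eps0 : 0 < eps by case: MC.
have e20 : 0 < eps / 2 by rewrite divr_gt0.
have dx : \forall p \near nbhs x, d p x < eps / 2.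
  by apply: (d_near (p := id)) e20; exact: cvg_id.
have := fiber_open Mx dx.
move=> /(@pi_cont x) H; apply: (@filterS2 _ (nbhs x) _ _ _ _ _ dx H) => p xp [q [Mq qp xq]].
exists q; split => //; rewrite (splitr eps); apply: le_lt_trans (d_tri _ x _) _.
by rewrite ltrD// d_sym.
Qed.

Lemma basin_of_contraction p q : P p -> M q -> pi q = pi p -> d p q < eps ->
  basin M p.
Proof.
move=> Pp Mq qp dpq; exists q; split => //.
apply/cvgrPdist_lt => e e0.
have [S S0 SP] := decay_uniform sMP M_inv MC e0.
exists S; split; first exact: num_real.
move=> t St; rewrite sub0r normrN ger0_norm//.
by apply: SP => //; exact: ltW.
Qed.

End openness.

(** * Basins, omega-limit sets and existence of minimal sets *)

(** The partner of [Phi t p] is pulled back through [Phi t] inside [M]; its base point is the right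
    one because [sigma t] is injective. *)
Lemma basin_preimage M p t : minset M -> M `<=` P -> P p -> 0 <= t ->
  basin M (Phi t p) -> basin M p.
Proof.
have [_ s0 sD] := flow_sigma.
move=> Mm sMP Pp t0 [q [Mq qp dpq]].
have [q0 Mq0 qq] := minset_onto Mm sMP t0 Mq.
exists q0; split => //.
  apply: (can_inj (g := sigma (- t)) (f := sigma t)) => [om|].
    by rewrite -sD addNr s0.
  by rewrite -!pi_Phi qq.
apply/cvgrPdist_lt => e e0; move/cvgrPdist_lt : dpq => /(_ e e0)[N [_ NP]].
(* Beyond this time [s - t] exceeds [N] and is nonnegative, as the semigroup law requires. *)
exists (N + t + `|N|); split; first exact: num_real.
move=> s Ns; have := NP (s - t); rewrite -qq.
have st : 0 <= s - t by have := ler_norm (- N); rewrite normrN; lra.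
rewrite -!PhiD// ?subrK//; last exact: sMP.
by apply; have := normr_ge0 N; lra.
Qed.

Lemma basin_forward M p t : minset M -> M `<=` P -> P p -> 0 <= t ->
  basin M p -> basin M (Phi t p).
Proof.
move=> [_ Minv _ _] sMP Pp t0 [q [Mq qp dpq]].
exists (Phi t q); split; [exact: Minv|by rewrite !pi_Phi qp|].
apply/cvgrPdist_lt => e e0; move/cvgrPdist_lt : dpq => /(_ e e0)[N [_ NP]].
exists (`|N|); split; first exact: num_real.
move=> s Ns; have s0 : 0 <= s by rewrite (le_trans _ (ltW Ns)).
rewrite -!PhiD//; last exact: sMP.
by apply: NP; have := ler_norm N; lra.
Qed.

Lemma basin_self M p : M p -> basin M p.
Proof.
move=> Mp; exists p; split => //.
by under eq_fun do rewrite d_refl; exact: cvg_cst.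
Qed.

(** The definition asks for a monotone sequence of times, whereas compactness arguments speak of
    cluster points; balls of radius [m.+1%:R^-1] link the two. *)
Lemma omega_limP p a : P p -> omega_lim p a <->
  cluster (Phi t p @[t --> +oo]) a.
Proof.
move=> Pp; split.
  move=> [tm [tm0 _ tmoo tma]] A B /= pA aB.
  have h1 : \forall m \near \oo, A (Phi (tm m) p) by have := tmoo _ pA.
  have h2 : \forall m \near \oo, B (Phi (tm m) p) by have := tma _ aB.
  have [m ? ?] := filter_ex2 _ h1 h2.
  by exists (Phi (tm m) p).
move=> ca.
have ex (T : R) (m : nat) : exists t : R,
    [/\ 0 <= t, T <= t & ball a m.+1%:R^-1 (Phi t p)].
  have [_ [[t [t0 Tt] <-] bt]] : ((fun t => Phi t p) @` [set t | 0 <= t /\ T <= t]) `&`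
      ball a m.+1%:R^-1 !=set0.
    apply: ca; last exact: nbhsx_ballx.
    exists (`|T|); split; first exact: num_real.
    move=> t Tt; exists t => //=; split; first by rewrite (le_trans _ (ltW Tt)).
    by rewrite (le_trans (ler_norm T))// ltW.
  by exists t.
have /choice[g gP] : forall Tm : R * nat, exists t : R,
    [/\ 0 <= t, Tm.1 <= t & ball a Tm.2.+1%:R^-1 (Phi t p)].
  by move=> [T m]; exact: ex.
(* Each time exceeds its predecessor by at least 1, which forces both monotonicity and
   divergence. *)
pose fix tm (m : nat) : R :=
  if m is k.+1 then g (tm k + 1, m) else g (0, 0%N).
have tm0 m : 0 <= tm m by case: m => [|k] /=; [have [] := gP (0, 0%N)|have [] := gP (tm k + 1, k.+1)].
have tmS m : tm m + 1 <= tm m.+1 by have [] := gP (tm m + 1, m.+1).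
have tmm m : m%:R <= tm m.
  elim: m => [|m IH] //; apply: le_trans (tmS m).
  by rewrite -natr1 lerD2r.
exists tm; split => //.
- apply/nondecreasing_seqP => m; apply: le_trans (tmS m).
  by rewrite lerDl.
- by apply: ger_cvgy (@cvgr_idn R); exact: nearW.
- have tmb m : ball a m.+1%:R^-1 (Phi (tm m) p).
    by case: m => [|k] /=; [have [] := gP (0, 0%N)|have [] := gP (tm k + 1, k.+1)].
  apply/cvg_ballP => e e0; near=> m.
  apply: le_ball (tmb m); apply: ltW; near: m.
  exact: (near_infty_natSinv_lt (PosNum e0)).
Unshelve. all: by end_near. Qed.

Lemma omega_limW p a : P p -> omega_lim p a -> exists G : set_system R,
  [/\ UltraFilter G, pinfty_nbhs R `<=` G & Phi t p @[t --> G] --> a].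
Proof. by move=> Pp /(omega_limP a Pp); exact: ultra_cluster. Qed.

Lemma omega_lim_near p a (V : set X) T : P p -> omega_lim p a -> nbhs a V ->
  exists t, [/\ 0 <= t, T <= t & V (Phi t p)].
Proof.
move=> Pp /(omega_limW Pp)[G [GU ooG pa]] aV.
have GT : \forall t \near G, 0 <= t /\ T <= t.
  apply: ooG; exists `|T|; split; first exact: num_real.
  move=> t Tt; split; first by rewrite (le_trans _ (ltW Tt)).
  by rewrite (le_trans (ler_norm T))// ltW.
have GV : \forall t \near G, V (Phi t p) by exact: pa.
by have [t [t0 Tt] Vt] := filter_ex2 _ GT GV; exists t.
Qed.

Local Lemma P_ultra_sub (J : Type) (G : set_system J) (p : J -> X) a : ProperFilter G ->
  (\forall j \near G, P (p j)) -> p @ G --> a -> P a.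
Proof.
move=> GF GP pa; have Pcl := compact_closed hX P_compact.
by apply: (closed_cvg P) pa => //; exact: Pcl.
Qed.

Lemma omega_lim_sub p : P p -> omega_lim p `<=` P.
Proof.
move=> Pp a /(omega_limW Pp)[G [GU ooG pa]].
apply: (P_ultra_sub _ _ pa); apply: ooG; exists 0; split; first exact: num_real.
by move=> t /ltW t0; exact: P_inv.
Qed.

Lemma omega_lim_neq0 p : P p -> omega_lim p !=set0.
Proof.
move=> Pp; have [a [Pa ca]] : P `&` cluster (Phi t p @[t --> +oo]) !=set0.
  apply: P_compact; exists 0; split; first exact: num_real.
  by move=> t /ltW t0; exact: P_inv.
by exists a; apply/omega_limP.
Qed.

Lemma omega_lim_compact p : P p -> compact (omega_lim p).
Proof.
move=> Pp; apply: (subclosed_compact _ P_compact (omega_lim_sub Pp)).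
rewrite (_ : omega_lim p = cluster (Phi t p @[t --> +oo])).
  by rewrite clusterE; apply: closed_bigI => A _; exact: closed_closure.
by apply/seteqP; split => a /(omega_limP a Pp).
Qed.

Lemma omega_lim_inv p : P p -> semiflow_inv (omega_lim p).
Proof.
move=> Pp a pa s s0; have Pa := omega_lim_sub Pp pa.
have [tm [tm0 tmnd tmoo tma]] := pa.
exists (fun m => s + tm m); split.
- by move=> m; rewrite addr_ge0.
- by move=> m k mk; rewrite lerD2l; exact: tmnd.
- by apply: ger_cvgy tmoo; apply: nearW => m; rewrite lerDr.
- under eq_fun do rewrite PhiD//.
  by apply: Phi_cvg => // m; exact: P_inv.
Qed.

(** Along an ultrafilter, the limits of [Phi t p] and of its partner [Phi t q] lie on the same fibre
    at distance 0, hence agree and belong to [M]. Minimality of [M] does the rest. *)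
Lemma omega_lim_basin M p : minset M -> M `<=` P -> P p -> basin M p ->
  omega_lim p = M.
Proof.
move=> [M0 Minv Mc Mmin] sMP Pp [q [Mq qp dpq]].
apply: Mmin; [|exact: omega_lim_neq0|exact: omega_lim_inv|exact: omega_lim_compact].
move=> a /(omega_limW Pp)[G [GU ooG pa]].
have GT : \forall t \near G, 0 <= t.
  by apply: ooG; exists 0; split; [exact: num_real|move=> t /ltW].
have [|b Mb qb] := ultra_conv GU Mc (f := fun t => Phi t q).
  by apply: filterS GT => t; exact: Minv.
suff -> : a = b by [].
apply: d_eq0.
  apply: (cvg_ultra_unique hO (@ultra_proper _ _ GU) (f := fun t => pi (Phi t p))).
    by apply: (@cvg_comp _ _ _ (Phi^~ p) pi G (nbhs a)) => //; exact: pi_cont.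
  rewrite (_ : (fun t => pi (Phi t p)) = fun t => pi (Phi t q)).
    by apply: (@cvg_comp _ _ _ (Phi^~ q) pi G (nbhs b)) => //; exact: pi_cont.
  by apply/funext => t; rewrite !pi_Phi qp.
apply: (cvg_ultra_unique (@norm_hausdorff _ R^o) (@ultra_proper _ _ GU)
  (f := fun t => d (Phi t p) (Phi t q))); first exact: d_cvg.
by apply: cvg_trans dpq => A; exact: ooG.
Qed.

(** Zorn's lemma for unions is applied to the removed parts [A], the candidates being their
    complements in [N]. The union of a chain stays admissible because, by compactness, the
    complements have a common point. *)
Lemma minset_sub N : N !=set0 -> semiflow_inv N -> compact N ->
  exists2 M, minset M & M `<=` N.
Proof.
move=> N0 Ninv Nc.
have Ncl : closed N := compact_closed hX Nc.
pose good B := [/\ B !=set0, semiflow_inv B & compact B].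
pose Q A := A `<=` N /\ good (N `\` A).
have [F FQ Ftot|A [[AN [A0 Ainv Ac]] Amax]] := @Zorn_bigcup X Q.
  split; first by move=> x [A FA Ax]; exact: (FQ A FA).1.
  (* The empty chain is admissible because [N] itself is a candidate; the filter built below needs a
     member of [F]. *)
  have [->|/set0P[A0 FA0]] := eqVneq F set0; first by rewrite bigcup_set0 setD0.
  have FG A : F A -> good (N `\` A) by move=> /FQ[].
  split.
  - pose G := filter_from F (fun A => N `\` A).
    have GP : ProperFilter G.
      apply: filter_from_proper; last by move=> A /FG[].
      apply: filter_from_filter; first by exists A0.
      move=> A B FA FB; have [AB|BA] := Ftot _ _ FA FB.
        exists B => //; rewrite subsetI; split=> // x [Nx nB].
        by split => // /AB.
      exists A => //; rewrite subsetI; split=> // x [Nx nA].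
      by split => // /BA.
    have [a [Na ca]] : N `&` cluster G !=set0.
      by apply: Nc; exists A0 => // x [].
    exists a; split => // -[A FA Aa].
    have [_ _ cA] := FG _ FA.
    have : (N `\` A) a.
      apply: (compact_closed hX cA) => V aV; apply: ca => //.
      by exists A.
    by case.
  - move=> p [Np nFp] t t0; split; first exact: Ninv.
    move=> [A FA Apt]; have [_ iA _] := FG _ FA.
    have : (N `\` A) (Phi t p).
      by apply: iA => //; split => // Ap; apply: nFp; exists A.
    by case.
  - apply: (subclosed_compact _ Nc); last by move=> x [].
    have -> : N `\` \bigcup_(A in F) A = \bigcap_(A in F) (N `\` A).
      apply/seteqP; split => [x [Nx nFx] A FA|x Fx].
        by split => // Ax; apply: nFx; exists A.
      split; first exact: (Fx _ FA0).1.
      by move=> [A FA Ax]; exact: (Fx _ FA).2.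
    apply: closed_bigI => A FA; have [_ _ cA] := FG _ FA.
    exact: compact_closed.
exists (N `\` A) => //; split => // N' sN' N'0 N'inv N'c.
have EN' : N `\` (N `\` N') = N'.
  by rewrite setDD; apply/setIidPr => x /sN'[].
have nA : ~ A `<` N `\` N'.
  move=> /Amax; apply; split; first by move=> x [].
  by rewrite /good EN'.
apply/seteqP; split => // x [Nx nAx].
apply: contrapT => nN'x; apply: nA; split; last by move=> h; apply: nAx; exact: h.
move=> y Ay; split; first exact: AN.
by move=> /sN'[].
Qed.

(** * Consequences of contraction near every minimal set *)

Hypothesis contraction : forall M, minset M -> M `<=` P ->
  exists T eps K, fiber_contraction M T eps K.

Lemma minset_omega p : P p -> minset (omega_lim p) /\ basin (omega_lim p) p.
Proof.
move=> Pp.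
have [M Mm sM] := minset_sub (omega_lim_neq0 Pp) (omega_lim_inv Pp) (omega_lim_compact Pp).
have sMP : M `<=` P by move=> x /sM; exact: omega_lim_sub.
have [T [eps [K MC]]] := contraction Mm sMP.
have [[x Mx] _ _ _] := Mm.
have [t [t0 _ [q [Mq qp dq]]]] := omega_lim_near 0 Pp (sM _ Mx)
  (contraction_nbhs sMP Mm MC Mx).
have bM : basin M p.
  apply: (basin_preimage Mm sMP Pp t0).
  exact: (basin_of_contraction sMP Mm MC (P_inv Pp t0) Mq qp dq).
by rewrite (omega_lim_basin Mm sMP Pp bM).
Qed.

Lemma basin_open M p : minset M -> M `<=` P -> P p -> basin M p ->
  \forall p' \near nbhs p, P p' -> basin M p'.
Proof.
move=> Mm sMP Pp bM.
have [T [eps [K MC]]] := contraction Mm sMP.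
have [[x Mx] _ _ _] := Mm.
have px : omega_lim p x by rewrite (omega_lim_basin Mm sMP Pp bM).
have [t [t0 _]] := omega_lim_near 0 Pp px
  (nbhs_interior (contraction_nbhs sMP Mm MC Mx)).
set V := (X in X^°) => Vt.
(* [Phi t] is continuous along points of [P] only, so points outside [P] are replaced by [p]
   itself. *)
have : Phi t (if pselect (P p') is left _ then p' else p) @[p' --> p] --> Phi t p.
  apply: Phi_cvg => //; first by move=> p'; case: pselect.
  apply/cvg_ballP => e e0; near=> p'; case: pselect => _; last exact: ballxx.
  by near: p'; exact: nbhsx_ballx.
move=> h; apply: (@filterS _ (nbhs p) _ _ _ _ (h _ Vt)) => p' + Pp'; rewrite /=; case: pselect => // _.
move=> [q [Mq qp dq]]; apply: (basin_preimage Mm sMP Pp' t0).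
exact: (basin_of_contraction sMP Mm MC (P_inv Pp' t0) Mq qp dq).
Unshelve. all: by end_near. Qed.

(** Representatives of infinitely many minimal sets would accumulate at some [a] in [P]. The
    relatively open basin containing [a] would hold two of them, and a point of a minimal set
    determines that set as its omega-limit. *)
Lemma minsets_finite : finite_set [set M | minset M /\ M `<=` P].
Proof.
apply: contrapT => /infiniteP/pcard_leP[f].
have fP k : minset (f k) /\ f k `<=` P by have := @funS _ _ _ _ f k I.
have /choice[p pP] : forall k, exists p, f k p.
  by move=> k; have [[[p fp] _ _ _] _] := fP k; exists p.
have [U [UU sU]] := ultraFilterLemma eventually_filter.
have [a Pa pa] := ultra_conv UU P_compact (nearW _ (fun k => (fP k).2 _ (pP k))).
have [Mm Ma] := minset_omega Pa.
have Ub : \forall k \near U, P (p k) -> basin (omega_lim a) (p k).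
  have := basin_open Mm (omega_lim_sub Pa) Pa Ma; exact: pa.
have [k [l [kl bk bl]]] := ultra_oo_pair (@ultra_proper _ _ UU) sU Ub.
have fE m : (P (p m) -> basin (omega_lim a) (p m)) -> f m = omega_lim a.
  move=> bm; have [fm fmP] := fP m; have Ppm := fmP _ (pP m).
  rewrite -(omega_lim_basin fm fmP Ppm (basin_self (pP m))).
  exact: (omega_lim_basin Mm (omega_lim_sub Pa) Ppm (bm Ppm)).
have : k = l.
  apply: (@inj _ _ _ f); rewrite ?inE//.
  exact: etrans (fE _ bk) (esym (fE _ bl)).
by move=> klE; rewrite klE ltnn in kl.
Qed.

Section one_basin.
Variable M : set X.
Hypotheses (Mm : minset M) (sMP : M `<=` P).

(** The limit [a] has a basin of its own, which is relatively open and therefore shares a point with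
    that of [M]; so the two minimal sets agree. *)
Lemma basin_compact : compact (P `&` basin M).
Proof.
rewrite compact_ultra => G GU GB.
have GP : G P by apply: filterS GB => p [].
have [a Pa Ga] := ultra_conv GU P_compact (f := id) GP.
exists a; split => //; split => //.
have [Mam ba] := minset_omega Pa.
have Gb : \forall p \near G, P p -> basin (omega_lim a) p.
  have := basin_open Mam (omega_lim_sub Pa) Pa ba; exact: Ga.
have [p [Pp bp] bap] := filter_ex2 (@ultra_proper _ _ GU) GB Gb.
rewrite -(omega_lim_basin Mm sMP Pp bp).
by rewrite (omega_lim_basin Mam (omega_lim_sub Pa) Pp (bap Pp)).
Qed.

Lemma basin_compl_compact : compact (P `\` basin M).
Proof.
rewrite compact_ultra => G GU GB.
have GP : G P by apply: filterS GB => p [].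
have [a Pa Ga] := ultra_conv GU P_compact (f := id) GP.
exists a; split => //; split => // ba.
have Gb : \forall p \near G, P p -> basin M p.
  have := basin_open Mm sMP Pa ba; exact: Ga.
by have [p [Pp nbp] bp] := filter_ex2 (@ultra_proper _ _ GU) GB Gb; exact/nbp/bp.
Qed.

Lemma basin_inv : semiflow_inv (P `&` basin M).
Proof. by move=> p [Pp bp] t t0; split; [exact: P_inv|exact: basin_forward]. Qed.

Lemma orbit_connected p t : P p -> 0 <= t ->
  connected ((fun s => Phi s p) @` `[0, t]).
Proof.
move=> Pp t0; apply: connected_continuous_connected.
  exact: segment_connected.
apply/subspace_continuousP => s; rewrite /= in_itv/= => /andP[s0 st].
(* Freezing negative times at 0 keeps the times admissible for [Phi_ultra]. *)
pose f (u : R) := Phi (Num.max u 0) p.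
have fc : f u @[u --> s] --> Phi s p.
  apply: cvg_ultra => G GU sG; apply: Phi_ultra => //.
  - by move=> u; rewrite le_max lexx orbT.
  - have := @maxr0_continuous R s; rewrite /continuous_at max_l// => h; apply: cvg_trans h => A; exact: sG.
  - exact: cvg_cst.
apply: (@cvg_trans _ (f u @[u --> within [set` `[0, t]] (nbhs s)])).
  apply: near_eq_cvg; near=> u; rewrite /f max_l//.
  have : `[0, t]%classic u by near: u; exact: withinT.
  by rewrite /= in_itv/= => /andP[].
by apply: cvg_trans fc; apply: cvg_app; exact: cvg_within.
Unshelve. all: by end_near. Qed.

Lemma basin_connected : connected (P `&` basin M).
Proof.
set S := P `&` basin M.
(* An orbit segment starting in a relatively clopen part is connected, so it never leaves that
   part. *)
have clopen_inv B : (exists2 C, open C & B = S `&` C) ->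
    (exists2 C, closed C & B = S `&` C) -> semiflow_inv B.
  move=> [V oV BV] [C cC BC] p Bp t t0.
  have Sp : S p by move: Bp; rewrite BV => -[].
  pose J := (fun s => Phi s p) @` `[0, t].
  have JS : J `<=` S.
    move=> _ [s + <-]; rewrite /= in_itv/= => /andP[s0 _].
    exact: basin_inv.
  have BJ D : B = S `&` D -> B `&` J = J `&` D.
    move=> ->; apply/seteqP; split => [x [[_ ?] ?]//|x [Jx ?]].
    by split => //; split => //; exact: JS.
  have E : B `&` J = J.
    apply: (orbit_connected Sp.1 t0).
    - exists p; split => //; exists 0; last exact: (Phi0 Sp.1).
      by rewrite /= in_itv/= lexx.
    - by exists V => //; exact: BJ.
    - by exists C => //; exact: BJ.
  suff : J (Phi t p) by rewrite -E => -[].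
  by exists t => //; rewrite /= in_itv/= t0 lexx.
have cS : closed S := compact_closed hX basin_compact.
(* A minimal set inside [B] is the omega-limit set of its points, which are attracted by [M]; hence
   it equals [M]. *)
have sub_contains B : B `<=` S -> B !=set0 -> semiflow_inv B -> closed B -> M `<=` B.
  move=> BS B0 iB cB.
  have [M1 M1m sM1] := minset_sub B0 iB (subclosed_compact cB basin_compact BS).
  have sM1P : M1 `<=` P by move=> x /sM1/BS[].
  have [[x M1x] _ _ _] := M1m.
  have [Px bx] := BS _ (sM1 _ M1x).
  rewrite -(omega_lim_basin Mm sMP Px bx).
  by rewrite (omega_lim_basin M1m sM1P Px (basin_self M1x)).
move=> B B0 hO' hC; have iB := clopen_inv B hO' hC.
have [V oV BV] := hO'; have [C cC BC] := hC.
have BS : B `<=` S by rewrite BV => x [].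
have MB : M `<=` B.
  by apply: sub_contains => //; rewrite BC; exact: closedI.
apply: contrapT => BneS.
have D0 : (S `\` B) !=set0.
  apply: contrapT => /nonemptyPn; rewrite -subset0 => D0; apply: BneS.
  by apply/seteqP; split => // x Sx; apply: contrapT => nBx; exact: (D0 x).
have E1 : S `\` B = S `&` ~` V.
  rewrite BV; apply/seteqP; split => x [Sx h]; split => //; last by case.
  by move=> ?; apply: h.
have E2 : S `\` B = S `&` ~` C.
  rewrite BC; apply/seteqP; split => x [Sx h]; split => //; last by case.
  by move=> ?; apply: h.
have iD : semiflow_inv (S `\` B).
  by apply: clopen_inv; [exists (~` C) => //; exact: closed_openC
                        |exists (~` V) => //; exact: open_closedC].
have MD : M `<=` S `\` B.
  by apply: sub_contains => //; rewrite E1; apply: closedI => //; exact: open_closedC.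
by have [[x Mx] _ _ _] := Mm; have [_] := MD _ Mx; apply; exact: MB.
Qed.

End one_basin.

Lemma connected_minset : P !=set0 -> connected P ->
  exists M, [set M | minset M /\ M `<=` P] = [set M].
Proof.
move=> [p Pp] cP; have [Mm Mp] := minset_omega Pp.
have sMP := omega_lim_sub Pp.
set M := omega_lim p in Mm Mp sMP *; exists M.
have E : P `&` basin M = P.
  apply: cP; first by exists p.
  - exists (~` (P `\` basin M)).
      apply: closed_openC; apply: compact_closed => //.
      exact: basin_compl_compact.
    apply/seteqP; split => [x [Px bx]|x [Px /not_andP h]]; split => //; first by case.
    by case: h => // /contrapT.
  - exists (P `&` basin M); last by rewrite setIA setIid.
    by apply: compact_closed => //; exact: basin_compact.
apply/seteqP; split => [M' [M'm sM'P]|_ ->] //=.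
have [[x M'x] _ _ _] := M'm; have Px := sM'P _ M'x.
rewrite -(omega_lim_basin M'm sM'P Px (basin_self M'x)).
by apply: omega_lim_basin => //; rewrite -E in Px; case: Px.
Qed.

Lemma semiflow_decomposition : let mins := [set M | minset M /\ M `<=` P] in
  [/\ forall p, P p -> mins (omega_lim p), finite_set mins,
    [/\ forall M, mins M -> [/\ compact (P `&` basin M), connected (P `&` basin M) &
          semiflow_inv (P `&` basin M)],
        trivIset mins (fun M => P `&` basin M) &
        P = \bigcup_(M in mins) (P `&` basin M)] &
    P !=set0 -> connected P -> exists M, mins = [set M]].
Proof.
have omP p : P p -> minset (omega_lim p) /\ omega_lim p `<=` P.
  by move=> Pp; split; [exact: (minset_omega Pp).1|exact: omega_lim_sub].
split => //; [exact: minsets_finite|split|exact: connected_minset].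
- move=> M [Mm sMP]; split.
  + exact: basin_compact.
  + exact: basin_connected.
  + exact: basin_inv.
- move=> M N [Mm sMP] [Nm sNP] [p [[Pp Mp] [_ Np]]].
  by rewrite -(omega_lim_basin Mm sMP Pp Mp) (omega_lim_basin Nm sNP Pp Np).
- apply/seteqP; split=> [p Pp|p [M _ []]//].
  by exists (omega_lim p); [exact: omP|split => //; exact: (minset_omega Pp).2].
Qed.

End semiflow.

Lemma subrACA (V : zmodType) (a b c d : V) : a - b - (c - d) = a - c - (b - d).
Proof. by rewrite !opprB addrACA [in RHS]addrACA [- b + _]addrC. Qed.

(** * Right derivatives *)

Section mean_value.
Context {R : realType} {V : normedModType R}.
Implicit Types (A : set R) (f g : R -> V) (x t : R).

(** Multiplied out by [h], the estimate is trivial at [h = 0], so the punctured filter and the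
    division disappear. *)
Lemma has_rderivP A f x l : has_rderiv A f x l <->
  forall e, 0 < e -> \forall h \near (0 : R),
    A (x + h) -> `|f (x + h) - f x - h *: l| <= e * `|h|.
Proof.
have E h : h != 0 -> `|l - h^-1 *: (f (x + h) - f x)| =
    `|h|^-1 * `|f (x + h) - f x - h *: l|.
  by move=> h0; rewrite -normfV -normrZ distrC [in RHS]scalerBr scalerA mulVf// scale1r.
split.
  move=> /cvgrPdist_le H e e0; have := H e e0.
  rewrite !near_withinE => {}H; apply: (@filterS _ (nbhs (0 : R)) _ _ _ _ H) => h + Ah /=.
  have [->|h0] := eqVneq h 0; first by rewrite addr0 subrr scale0r subrr !normr0 mulr0.
  by move=> /(_ isT Ah); rewrite E// ler_pdivrMl ?normr_gt0// mulrC.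
move=> H; apply/cvgrPdist_le => e e0; have {}H := H e e0; rewrite !near_withinE.
apply: (@filterS _ (nbhs (0 : R)) _ _ _ _ H) => h + h0 Ah /=.
by move=> /(_ Ah); rewrite E// ler_pdivrMl ?normr_gt0// mulrC.
Qed.

Lemma has_rderivW A B f x l : A `<=` B -> has_rderiv B f x l -> has_rderiv A f x l.
Proof.
move=> AB /has_rderivP H; apply/has_rderivP => e e0.
by apply: filterS (H e e0) => h + Ah; apply; exact: AB.
Qed.

Lemma has_rderivB A f g x l m : has_rderiv A f x l -> has_rderiv A g x m ->
  has_rderiv A (fun t => f t - g t) x (l - m).
Proof.
move=> /has_rderivP F /has_rderivP G; apply/has_rderivP => e e0.
have e20 : 0 < e / 2 by rewrite divr_gt0.
apply: filterS2 (F _ e20) (G _ e20) => h Fh Gh Ah.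
rewrite scalerBr (subrACA (f (x + h))) (subrACA (f (x + h) - f x)).
apply: le_trans (ler_normB _ _) _.
by rewrite (splitr e) mulrDl; exact: (lerD (Fh Ah) (Gh Ah)).
Qed.

Lemma has_rderivZ A f c x l : has_rderiv A f x l ->
  has_rderiv A (fun t => c *: f t) x (c *: l).
Proof.
move=> /has_rderivP F; apply/has_rderivP => e e0.
have c0 : 0 < `|c| + 1 by rewrite ltr_wpDl.
have e0' : 0 < e / (`|c| + 1) by rewrite divr_gt0.
apply: filterS (F _ e0') => h Fh Ah.
rewrite scalerA mulrC -scalerA -!scalerBr normrZ.
apply: le_trans (ler_wpM2l (normr_ge0 c) (Fh Ah)) _.
rewrite mulrA ler_wpM2r// mulrCA; apply: ler_piMr; first exact: ltW.
by rewrite ler_pdivrMr// mul1r lerDl.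
Qed.

Lemma has_rderiv_shift A f c x l : has_rderiv A f (x + c) l ->
  has_rderiv [set t | A (t + c)] (fun t => f (t + c)) x l.
Proof.
move=> /has_rderivP F; apply/has_rderivP => e e0.
by apply: filterS (F _ e0) => h Fh /=; rewrite (addrAC x h c).
Qed.

(** Only right increments are controlled. The infimum [c] of the points where the estimate with
    slope [N + e'] fails still satisfies it by continuity, and the right increment at [c] extends it
    beyond [c], a contradiction. *)
Lemma mean_value_le f (a b N : R) : a <= b -> continuous f ->
  (forall t, a <= t < b -> forall e, 0 < e -> \forall h \near 0^'+,
     `|f (t + h) - f t| <= (N + e) * h) ->
  `|f b - f a| <= N * (b - a).
Proof.
move=> ab cf fN; apply/ler_addgt0Pr => e e0.
have [e' e'0 ee'] : exists2 e', 0 < e' & e' * (b - a) <= e.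
  exists (e / (b - a + 1)).
    by rewrite divr_gt0// ltr_wpDl// subr_ge0.
  rewrite mulrAC ler_pdivrMr; last by rewrite ltr_wpDl// subr_ge0.
  by rewrite ler_pM2l// lerDl.
apply: le_trans (_ : (N + e') * (b - a) <= _); last by rewrite mulrDl lerD2l.
pose u t := `|f t - f a| - (N + e') * (t - a).
have cu : continuous u.
  move=> t; apply: cvgB.
    by apply: cvg_norm; apply: cvgB; [exact: cf|exact: cvg_cst].
  by apply: cvgMr; apply: cvgB; [exact: cvg_id|exact: cvg_cst].
rewrite -subr_le0 -/(u b) leNgt; apply/negP => ub.
pose B := [set t | a <= t <= b /\ 0 < u t].
have Bb : B b by rewrite /B/= ab lexx.
have hB : has_inf B by split; [exists b|exists a => t [/andP[]]].
pose c := inf B.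
have ca : a <= c by apply: lb_le_inf; [exists b|move=> t [/andP[]]].
have cb : c <= b by apply: ge_inf => //; exact: hB.2.
have uc : u c <= 0.
  have [ac|ca'] := ltP a c; last first.
    by rewrite /u (@le_anti _ _ c a) ?ca ?ca'// !subrr mulr0 normr0 subrr.
  rewrite leNgt; apply/negP => uc0.
  have : \forall t \near c, 0 < u t by apply: (cvgr_gt _ (cu c)).
  move=> /nbhs_ballP[d /= d0 dP].
  pose t := Num.max a (c - d / 2).
  have tc : t < c by rewrite /t gt_max ac/=; lra.
  have : B t.
    split; first by rewrite le_max lexx/= (le_trans (ltW tc)).
    apply: dP; rewrite /ball/= gtr0_norm ?subr_gt0//.
    have : c - d / 2 <= t by rewrite le_max lexx orbT.
    by lra.
  by move=> /(ge_inf hB.2); rewrite -/c leNgt tc.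
have cb' : c < b.
  rewrite lt_neqAle cb andbT; apply/eqP => cE; move: uc; rewrite cE leNgt.
  by rewrite ub.
have cab : a <= c < b by rewrite ca.
have := fN c cab e' e'0.
rewrite near_withinE => /nbhs_ballP[d /= d0 dP].
have [t Bt tcd] : exists2 t, B t & t < c + d.
  by have := @inf_adherent _ B d d0 hB; move=> [t Bt]; exists t.
have ct : c <= t by exact: ge_inf hB.2 _ Bt.
have ct' : c < t.
  rewrite lt_neqAle ct andbT; apply/eqP => cE; move: Bt => -[_].
  by rewrite -cE ltNge uc.
have : `|f (c + (t - c)) - f c| <= (N + e') * (t - c).
  apply: dP; last by rewrite subr_gt0.
  by rewrite /ball/= sub0r normrN gtr0_norm ?subr_gt0// ltrBlDl.
rewrite (addrC c) subrK => h.
have [_] := Bt; rewrite ltNge => /negP; apply; rewrite /u subr_le0.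
have -> : f t - f a = (f t - f c) + (f c - f a) by rewrite addrA subrK.
apply: le_trans (ler_normD _ _) _.
have -> : (N + e') * (t - a) = (N + e') * (t - c) + (N + e') * (c - a) by ring.
by rewrite lerD// -subr_le0.
Qed.

(** The mean value inequality applied to [f t - t *: c]. The comparison vector [c] gives first-order
    precision, which limits of derivatives and strict differentiability need. *)
Lemma mean_value_rderiv f (g : R -> V) (a0 a b : R) (c : V) (eta : R) :
  a0 <= a -> a <= b -> continuous f ->
  (forall t, a <= t < b -> has_rderiv `[a0, +oo[ f t (g t)) ->
  (forall t, a <= t < b -> `|g t - c| <= eta) ->
  `|f b - f a - (b - a) *: c| <= eta * (b - a).
Proof.
move=> a0a ab cf fg gc.
pose k t := f t - t *: c.
have ck : continuous k.
  by move=> t; apply: cvgB; [exact: cf|apply: cvgZr_tmp; exact: cvg_id].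
have <- : k b - k a = f b - f a - (b - a) *: c.
  by rewrite /k subrACA scalerBl.
apply: mean_value_le => // t tab e e0.
have [at_ tb] := andP tab.
have /has_rderivP/(_ e e0) H := fg t tab.
rewrite near_withinE; apply: filterS H => h + h0.
have Ath : `[a0, +oo[%classic (t + h).
  rewrite /= in_itv/= andbT (le_trans a0a)// (le_trans at_)//.
  by rewrite lerDl ltW.
move=> /(_ Ath) fh.
have -> : k (t + h) - k t = (f (t + h) - f t - h *: g t) + h *: (g t - c).
  by rewrite /k subrACA -scalerBl (addrC t) addrK scalerBr addrA subrK.
apply: le_trans (ler_normD _ _) _.
rewrite normrZ; move: fh; rewrite (gtr0_norm h0) => fh.
by rewrite mulrDl addrC lerD// mulrC ler_wpM2r ?gc// ltW.
Qed.

Lemma rderiv_lipschitz f (g : R -> V) (a0 a b N : R) :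
  a0 <= a -> continuous f ->
  (forall t, a <= t <= b -> has_rderiv `[a0, +oo[ f t (g t)) ->
  (forall t, a <= t <= b -> `|g t| <= N) ->
  forall s t, a <= s <= b -> a <= t <= b -> `|f s - f t| <= N * `|s - t|.
Proof.
move=> a0a cf fg gN.
have W s t : a <= s -> s <= t -> t <= b -> `|f t - f s| <= N * (t - s).
  move=> as_ st tb.
  have := @mean_value_rderiv f g a0 s t 0 N (le_trans a0a as_) st cf.
  rewrite scaler0 subr0; apply => u /andP[su ut].
    by apply: fg; rewrite (le_trans as_)// ltW// (lt_le_trans ut).
  by rewrite subr0 gN// (le_trans as_)// ltW// (lt_le_trans ut).
move=> s t /andP[as_ sb] /andP[at_ tb].
have [st|/ltW ts] := leP s t.
  by rewrite distrC (distrC s) (ger0_norm (_ : 0 <= t - s)) ?subr_ge0// W.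
by rewrite (ger0_norm (_ : 0 <= s - t)) ?subr_ge0// W.
Qed.

(** Continuous convergence puts the values of [g_] near [t] within [e] of [g t]; the mean value
    inequality turns this into a bound on increments of [z_ j], and such bounds pass to pointwise
    limits. *)
Lemma rderiv_limit (J : Type) (G : set_system J) (z_ g_ : J -> R -> V)
    (z g : R -> V) (a : R) : ProperFilter G ->
  (forall j, continuous (z_ j)) ->
  (forall j t, a <= t -> has_rderiv `[a, +oo[ (z_ j) t (g_ j t)) ->
  (forall t, a <= t -> z_ j t @[j --> G] --> z t) ->
  (forall t, a <= t ->
     g_ jt.1 jt.2 @[jt --> filter_prod G (within `[a, +oo[ (nbhs t))] --> g t) ->
  forall t, a <= t -> has_rderiv `[a, +oo[ z t (g t).
Proof.
move=> GP cz zg zl gl t at_; apply/has_rderivP => e e0.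
have /cvgrPdist_le/(_ e e0)[[A B] [/= GA tB] AB] := gl t at_.
move: tB; rewrite /within => /nbhs_ballP[d /= d0 dB].
have H j u : A j -> a <= u -> `|u - t| < d -> `|g_ j u - g t| <= e.
  move=> Aj au ut; rewrite distrC; apply: (AB (j, u)); split => //=.
  by apply: dB; rewrite /ball/= 1?distrC// in_itv/= au.
have near_d : \forall h \near (0 : R), `|h| < d.
  apply/nbhs_ballP; exists d => // h; rewrite /ball/= sub0r normrN.
  exact.
apply: filterS near_d => h hd; rewrite /= in_itv/= andbT => ath.
have zlim : `|z_ j (t + h) - z_ j t - h *: g t| @[j --> G] -->
    `|z (t + h) - z t - h *: g t|.
  apply: cvg_norm; apply: cvgB; last exact: cvg_cst.
  by apply: cvgB; exact: zl.
apply: (@closed_cvg _ _ G _ _ [set x : R | x <= e * `|h|] _ _ _ zlim).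
  exact: closed_le.
apply: filterS GA => j Aj /=.
have [h0|h0] := leP 0 h.
  have := @mean_value_rderiv (z_ j) (g_ j) a t (t + h) (g t) e at_ _ (cz j).
  rewrite (_ : t + h - t = h); last by rewrite addrC addKr.
  rewrite (ger0_norm h0); apply.
  - by rewrite lerDl.
  - by move=> u /andP[tu _]; apply: zg; rewrite (le_trans at_).
  - move=> u /andP[tu uth]; apply: H => //; first by rewrite (le_trans at_).
    rewrite ger0_norm ?subr_ge0//; apply: le_lt_trans hd.
    by rewrite ger0_norm//; lra.
have := @mean_value_rderiv (z_ j) (g_ j) a (t + h) t (g t) e ath _ (cz j).
rewrite (_ : t - (t + h) = - h); last by rewrite opprD addrA subrr add0r.
rewrite (ltr0_norm h0) scaleNr opprK => M.
have <- : - (z_ j t - z_ j (t + h) + h *: g t) = z_ j (t + h) - z_ j t - h *: g t.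
  by rewrite opprD opprB.
rewrite normrN; apply: M.
- by rewrite gerDl ltW.
- by move=> u /andP[tu _]; apply: zg; rewrite (le_trans ath).
- move=> u /andP[tu uth]; apply: H => //; first by rewrite (le_trans ath).
  rewrite ltr0_norm ?subr_lt0//; apply: le_lt_trans hd.
  by rewrite ltr0_norm//; lra.
Qed.

End mean_value.

(** * History segments *)

Section history.
Context {R : realType} (r : {posnum R}) (n : nat).
Local Notation E := 'rV[R]_n.
Local Notation I := (hist_itv r).
Local Notation C := (segC r n).
Local Notation hst := (@hist R r n).
Implicit Types (y z : R -> E) (s t : R).

Lemma clamp_continuous : continuous (@clamp R r).
Proof.
move=> t; apply/cvgrPdist_lt => e e0; near=> s.
by apply: le_lt_trans (clamp_dist _ _ _) _; near: s; exact: cvgr_dist_lt.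
Unshelve. all: by end_near. Qed.

Lemma clamp_idem s : clamp r (clamp r s) = clamp r s.
Proof. by rewrite clamp_id//; exact: clamp_itv. Qed.

(** [hist] falls back on 0 unless the clamped window is continuous. Global continuity of [y] rules
    this out, and solutions known only from time [- r] on will be extended for this purpose. *)
Lemma histE y t s : continuous y -> hst y t s = y (t + clamp r s).
Proof.
move=> cy; suff E : val (hst y t) = (fun s => y (t + clamp r s)).
  by rewrite -[LHS]/(val (hst y t) s) E.
apply: insubdK; apply/asboolP; split; last by move=> u; rewrite clamp_idem.
apply: continuous_subspaceT => u.
apply: (@continuous_comp _ _ _ (fun s => t + clamp r s) y); last exact: cy.
by apply: cvgD; [exact: cvg_cst|exact: clamp_continuous].
Qed.

Lemma hist_itvE s : I s <-> - r%:num <= s <= 0.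
Proof. by rewrite /hist_itv/= in_itv. Qed.

Lemma hist_in y t s : continuous y -> I s -> hst y t s = y (t + s).
Proof. by move=> cy Is; rewrite histE// clamp_id. Qed.

Lemma hist_le y t c : continuous y ->
  (forall s, t - r%:num <= s <= t -> `|y s| <= c) -> `|hst y t| <= c.
Proof.
move=> cy yc; apply: segC_norm_le => s Is; rewrite hist_in//; apply: yc.
by move/hist_itvE: Is => /andP[? ?]; apply/andP; split; lra.
Qed.

Lemma hist_ub y t s : continuous y -> t - r%:num <= s <= t -> `|y s| <= `|hst y t|.
Proof.
move=> cy /andP[ts st].
have -> : y s = hst y t (s - t).
  by rewrite hist_in// 1?addrC ?subrK//; apply/hist_itvE/andP; split; lra.
exact: segC_norm_ub.
Qed.

Lemma histB y z t : continuous y -> continuous z ->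
  hst (fun s => y s - z s) t = hst y t - hst z t.
Proof.
move=> cy cz; apply: segCP => s _.
rewrite histE; last by move=> u; apply: cvgB; [exact: cy|exact: cz].
by rewrite -[RHS]/(hst y t s - hst z t s) !histE.
Qed.

Lemma hist_shift y c t : continuous y ->
  hst (fun s => y (s + c)) t = hst y (t + c).
Proof.
move=> cy; apply: segCP => s _; rewrite !histE//; first by rewrite addrAC.
move=> u; apply: (@continuous_comp _ _ _ (fun s => s + c) y); last exact: cy.
by apply: cvgD; [exact: cvg_id|exact: cvg_cst].
Qed.

(* On a step of length 1/(2c) the supremum of e at most doubles. *)
Lemma delay_gronwall (e g : R -> E) (c T : R) : 0 < c -> continuous e ->
  (forall t, 0 <= t <= T -> has_rderiv `[0, +oo[ e t (g t)) ->
  (forall t, 0 <= t <= T -> `|g t| <= c * `|hst e t|) ->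
  forall (k : nat) t, 0 <= t <= T -> t <= k%:R / (2 * c) ->
    `|hst e t| <= 2 ^+ k * `|hst e 0|.
Proof.
move=> c0 ce eg gc; elim=> [|k IH] t /andP[t0 tT] tk.
  rewrite expr0 mul1r (_ : t = 0)//; apply/eqP; rewrite eq_le t0 andbT.
  by rewrite (le_trans tk)// mul0r.
have c20 : 0 < (2 * c)^-1 by rewrite invr_gt0 mulr_gt0.
pose a := Num.max 0 (t - (2 * c)^-1).
have a0 : 0 <= a by rewrite le_max lexx.
have ta : t - (2 * c)^-1 <= a by rewrite le_max lexx orbT.
have at_ : a <= t by rewrite ge_max t0/= gerBl ltW.
have aT : 0 <= a <= T by rewrite a0 (le_trans at_).
have ak : a <= k%:R / (2 * c).
  rewrite ge_max; apply/andP; split; first by rewrite divr_ge0// mulr_ge0// ltW.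
  by rewrite lerBlDr (le_trans tk)// -natr1 mulrDl mul1r.
set A := `|hst e 0| in IH *.
have {IH} := IH a aT ak; set B := `|hst e a| => IH.
apply: (@le_trans _ _ (2 * B)); last by rewrite exprS -mulrA ler_pM2l.
have cne : {within `[a, t], continuous (fun s => `|e s|)}.
  by apply: continuous_subspaceT => s; apply: cvg_norm; exact: ce.
have [t1 + t1max] := EVT_max at_ cne; rewrite in_itv/= => /andP[at1 t1t].
(* [S] dominates the histories on [a, t], so [e] moves by at most [c * S / (2 * c)] from [a] to
   [t1]; if [S] is attained at [t1], then [S <= B + S / 2], which gives [S <= 2 * B]. *)
pose S := Num.max B `|e t1|.
have SB : B <= S by rewrite le_max lexx.
have St : `|e t1| <= S by rewrite le_max lexx orbT.
have uS u : a <= u <= t -> `|hst e u| <= S.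
  move=> /andP[au ut]; apply: hist_le => // s /andP[us su].
  have [sa|as_] := leP s a.
    apply: le_trans SB; apply: hist_ub => //; rewrite sa andbT.
    by apply: le_trans us; rewrite lerD2r.
  apply: le_trans St; apply: t1max; rewrite in_itv/= (ltW as_)/=.
  exact: le_trans su ut.
have et1 : `|e t1 - e a| <= c * S * (t1 - a).
  have := @mean_value_rderiv R E e g 0 a t1 0 (c * S) a0 at1 ce.
  rewrite scaler0 subr0; apply => u /andP[au ut1].
    by apply: eg; rewrite (le_trans a0 au)/= (le_trans (ltW ut1))// (le_trans t1t).
  rewrite subr0; apply: le_trans (gc _ _) _.
    by rewrite (le_trans a0 au)/= (le_trans (ltW ut1))// (le_trans t1t).
  rewrite ler_pM2l//; apply: uS; rewrite au/= (le_trans (ltW ut1))//.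
have S0 : 0 <= S by apply: le_trans SB; exact: normr_ge0.
have eB : `|e a| <= B.
  by apply: hist_ub => //; rewrite lexx andbT gerBl.
have e1 : `|e t1| <= B + S / 2.
  rewrite -[e t1](subrK (e a)) addrC; apply: le_trans (ler_normD _ _) _.
  apply: lerD; first exact: eB.
  apply: le_trans et1 _.
  have -> : S / 2 = c * S * (2 * c)^-1 by field; rewrite gt_eqF.
  by rewrite ler_wpM2l ?mulr_ge0 ?(ltW c0)//; lra.
have B0 : 0 <= B by exact: normr_ge0.
have S2B : S <= 2 * B.
  have [h|h] := leP B `|e t1|.
    have SE : S = `|e t1| by rewrite /S max_r.
    by rewrite SE; rewrite SE in e1; lra.
  by rewrite /S max_l ?(ltW h)//; lra.
by apply: le_trans S2B; apply: uS; rewrite at_ lexx.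
Qed.

(** Continuous convergence at each point of the window becomes uniform over the window because
    [- r, 0] is compact. *)
Lemma hist_cvg (J : Type) (G : set_system J) (z_ : J -> R -> E) z t : Filter G ->
  (forall j, continuous (z_ j)) -> continuous z ->
  (forall s, t - r%:num <= s <= t ->
     z_ js.1 js.2 @[js --> filter_prod G (nbhs s)] --> z s) ->
  hst (z_ js.1) js.2 @[js --> filter_prod G (nbhs t)] --> hst z t.
Proof.
move=> GF cz_ cz zl; apply/cvgrPdist_le => e e0.
have cI : compact I by exact: segment_compact.
have /near_covering_withinP cov := (compact_near_coveringP I).1 cI.
have H : \forall js \near filter_prod G (nbhs t), I `<=`
    (fun s => `|z (t + s) - z_ js.1 (js.2 + s)| <= e).
  apply: cov => s Is.
  have sr : t - r%:num <= t + s <= t.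
    by move/hist_itvE: Is => /andP[? ?]; apply/andP; split; lra.
  have e20 : 0 < e / 2 by rewrite divr_gt0.
  have /cvgrPdist_le/(_ _ e20)[[A B] [/= GA Bt] AB] := zl _ sr.
  have /cvgrPdist_le/(_ _ e20) Zt := cz (t + s).
  have : nbhs (t + s) (B `&` [set t0 | `|z (t + s) - z t0| <= e / 2]).
    by apply: filterI => //; exact: Zt.
  move=> /nbhs_ballP[d /= d0 dP].
  have d20 : 0 < d / 2 by rewrite divr_gt0.
  exists (ball s (d / 2), A `*` ball t (d / 2)).
    split; first exact: nbhsx_ballx.
    by exists (A, ball t (d / 2)) => //; split => //; exact: nbhsx_ballx.
  move=> [s' [j u]] [/= ss' [Aj tu]] Is'.
  move: ss' tu; rewrite /ball/= => ss' tu.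
  have [Bu _] : (B `&` [set t0 | `|z (t + s) - z t0| <= e / 2]) (u + s').
    apply: dP; rewrite /ball/= (_ : _ - _ = (s - s') + (t - u)); last by ring.
    by rewrite (splitr d); apply: le_lt_trans (ler_normD _ _) _; rewrite ltrD.
  have [_ zs'] : (B `&` [set t0 | `|z (t + s) - z t0| <= e / 2]) (t + s').
    apply: dP; rewrite /ball/= (_ : _ - _ = s - s'); last by ring.
    by rewrite (lt_trans ss')// ltr_pdivrMr// mulr2n mulrDr mulr1 ltrDl.
  have zju := AB (j, u + s') (conj Aj Bu); rewrite /= in zju.
  rewrite (splitr e) -[z (t + s')](subrK (z (t + s))) -addrA.
  by apply: le_trans (ler_normD _ _) _; rewrite lerD// distrC.
apply: filterS H => -[j u] /= H.
apply: segC_norm_le => s Is.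
rewrite -[X in `|X|]/(hst z t s - hst (z_ j) u s) !hist_in//.
exact: H.
Qed.

End history.

(** * Strict differentiability *)

Section segment_mean_value.
Context {R : realType} {V W : normedModType R}.

Lemma differentiable_has_rderiv (f : V -> W) (x v : V) (s : R) A :
  differentiable f (x + s *: v) ->
  has_rderiv A (fun u => f (x + u *: v)) s ('d f (x + s *: v) v).
Proof.
move=> df; have /cvg_ex[l fl] := @diff_derivable _ _ _ f _ v df.
have E : 'd f (x + s *: v) v = l.
  by rewrite -deriveE//; apply/cvg_lim => //; exact: norm_hausdorff.
rewrite E /has_rderiv.
apply: cvg_trans (_ : _ --> l); first by apply: cvg_app; exact: cvg_within.
rewrite (_ : (fun h => _) = fun h : R => h^-1 *: ((f \o shift (x + s *: v)) (h *: v) - f (x + s *: v))) //.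
by apply/funext => h /=; rewrite scalerDl addrA (addrC (h *: v)).
Qed.

Lemma segment_mean_value (f : V -> W) (x y : V) (c : W) (K : R) :
  (forall v, differentiable f v) ->
  (forall s, 0 <= s <= 1 -> `|'d f (x + s *: (y - x)) (y - x) - c| <= K) ->
  `|f y - f x - c| <= K.
Proof.
move=> df dK.
pose phi (s : R) := f (x + s *: (y - x)).
have cphi : continuous phi.
  move=> s; apply: (@continuous_comp _ _ _ (fun s : R => x + s *: (y - x)) f).
    by apply: cvgD; [exact: cvg_cst|apply: cvgZ; [exact: cvg_id|exact: cvg_cst]].
  exact: differentiable_continuous.
have := @mean_value_rderiv R W phi (fun s => 'd f (x + s *: (y - x)) (y - x)) 0 0 1 c K
  (lexx 0) ler01 cphi.
rewrite subr0 scale1r mulr1 /phi scale0r addr0 scale1r (addrC x) subrK; apply.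
  by move=> t _; apply: differentiable_has_rderiv.
by move=> t /andP[t0 /ltW t1]; apply: dK; rewrite t0.
Qed.

Lemma segment_near (J : Type) (G : set_system J) (x y : J -> V) x0 d : Filter G ->
  x @ G --> x0 -> y @ G --> x0 -> 0 < d ->
  \forall j \near G, forall s, 0 <= s <= 1 -> `|x0 - (y j + s *: (x j - y j))| < d.
Proof.
move=> GF xG yG d0; have d30 : 0 < d / 3 by rewrite divr_gt0.
have /cvgrPdist_lt/(_ _ d30) near_x := xG.
have /cvgrPdist_lt/(_ _ d30) near_y := yG.
apply: filterS2 near_x near_y => j xj yj s /andP[s0 s1].
rewrite opprD addrA; apply: le_lt_trans (ler_normB _ _) _.
rewrite normrZ ger0_norm//.
have h1 : `|x j - y j| <= `|x0 - x j| + `|x0 - y j|.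
  by rewrite (distrC x0); exact: ler_distD.
have h2 : s * `|x j - y j| <= `|x j - y j| by rewrite ler_piMl.
move: xj yj h1 h2; move: `|x0 - x j| `|x0 - y j| `|x j - y j| => p q w.
by lra.
Qed.

End segment_mean_value.

Section operator_bounds.
Context {R : realType}.

Lemma diff_bounded (V W : normedModType R) (f : V -> W) (x : V) :
  differentiable f x -> exists2 K, 0 < K & forall v, `|'d f x v| <= K * `|v|.
Proof.
move=> df; have := (linear_bounded_continuous ('d f x)).2 (diff_continuous df).
by move=> /linear_boundedP/pinfty_ex_gt0[K K0 KP]; exists K.
Qed.

(** [opnorm] is a real supremum, which would be 0 on an unbounded set; the bound [K] excludes this
    case. *)
Lemma opnorm_ub (V W : normedModType R) (f : V -> W) (K : R) :
  (forall (a : R) v, f (a *: v) = a *: f v) -> (forall v, `|f v| <= K * `|v|) ->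
  forall v, `|f v| <= opnorm f * `|v|.
Proof.
move=> fZ fK v.
have f0 : f 0 = 0 by rewrite -(scale0r (0 : V)) fZ scale0r.
have [->|v0] := eqVneq v 0; first by rewrite f0 !normr0 mulr0.
have nv0 : 0 < `|v| by rewrite normr_gt0.
have -> : f v = `|v| *: f (`|v|^-1 *: v) by rewrite fZ scalerA divff ?gt_eqF// scale1r.
rewrite normrZ normr_id mulrC ler_pM2r//.
apply: sup_upper_bound; last first.
  exists (`|v|^-1 *: v) => //=.
  by rewrite normrZ ger0_norm ?invr_ge0// mulVf// gt_eqF.
split; first by exists `|f 0|, 0 => //=; rewrite normr0.
exists `|K| => _ [u /= u1 <-]; apply: le_trans (fK u) _.
apply: le_trans (ler_wpM2r (normr_ge0 _) (ler_norm K)) _.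
by rewrite ler_piMr.
Qed.

Lemma mulmx_norm_le (m n : nat) (v : 'rV[R]_m) (A : 'M[R]_(m, n)) :
  `|v *m A| <= m%:R * `|v| * `|A|.
Proof.
rewrite [leLHS]/Num.Def.normr/= mx_normrE; apply/bigmax_leP; split.
  by rewrite !mulr_ge0.
move=> [i j] _ /=; rewrite mxE.
apply: le_trans (ler_norm_sum _ _ _) _.
rewrite -mulrA mulr_natl -[X in _ *+ X]card_ord -sumr_const.
apply: ler_sum => k _; rewrite normrM.
by apply: ler_pM => //; rewrite [leRHS]/Num.Def.normr/= mx_normrE;
  [apply: le_trans (le_bigmax _ _ (i, k))|apply: le_trans (le_bigmax _ _ (k, j))].
Qed.

End operator_bounds.

Section strict_differentiability.
Context {R : realType} {r : {posnum R}} {n : nat} {Omega : metricType R}.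
Local Notation E := 'rV[R]_n.
Local Notation C := (segC r n).
Variables (F : Omega * E * E -> E) (tau : Omega * C -> R).

Lemma D2tau_bound om x : cond_H2 tau ->
  exists2 K, 0 < K & forall v, `|D2tau tau om x v| <= K * `|v|.
Proof. by move=> [_ dtau _ _]; apply: diff_bounded; exact: dtau. Qed.

Lemma D2tauZ om x (a : R) v : D2tau tau om x (a *: v) = a * D2tau tau om x v.
Proof. exact: linearZ. Qed.

Lemma D2tauB om x v w : D2tau tau om x (v - w) = D2tau tau om x v - D2tau tau om x w.
Proof. exact: linearB. Qed.

(** Strict differentiability, with both arguments moving: on the segment from [y j] to [x j] the
    derivative stays near that at the limit point, by continuity of [D2tau] in operator norm.
    Differentiability at [x0] alone would only compare with the value at [x0]. *)
Lemma tau_strict (J : Type) (G : set_system J) (om : J -> Omega) (x y : J -> C) om0 x0 :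
  cond_H2 tau -> Filter G -> om @ G --> om0 -> x @ G --> x0 -> y @ G --> x0 ->
  forall eta, 0 < eta -> \forall j \near G,
    `|tau (om j, x j) - tau (om j, y j) - D2tau tau om0 x0 (x j - y j)|
      <= eta * `|x j - y j|.
Proof.
move=> H2 GF omG xG yG eta eta0; have [_ dtau cD _] := H2.
have /cvgrPdist_le/(_ _ eta0)[[A B] [/= Aom Bx] AB] := cD (om0, x0).
move: Bx => /nbhs_ballP[d /= d0 dB].
have near_z := segment_near GF xG yG d0.
have near_om : \forall j \near G, A (om j) by exact: (omG _ Aom).
apply: filterS2 near_om near_z => j Aj zj.
have dt v : differentiable (fun z => tau (om j, z)) v by exact: dtau.
apply: (segment_mean_value (f := fun z => tau (om j, z)) (W := R^o) dt) => s s01.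
set z := y j + s *: (x j - y j).
have zB : ball x0 d z by rewrite -ball_normE; exact: zj.
have := AB (om j, z) (conj Aj (dB _ zB)); rewrite /= sub0r normrN => H.
have [K K0 KP] := D2tau_bound (om j) z H2; have [L L0 LP] := D2tau_bound om0 x0 H2.
apply: le_trans (@opnorm_ub _ _ _ (D2tau tau (om j) z \- D2tau tau om0 x0) (K + L) _ _ _) _.
- move=> a v; set p := D2tau tau (om j) z; set q := D2tau tau om0 x0.
  rewrite -[LHS]/(p (a *: v) - q (a *: v)) -[RHS]/(a * (p v - q v)).
  by rewrite /p /q !D2tauZ mulrBr.
- by move=> v; apply: le_trans (ler_normB _ _) _; rewrite mulrDl lerD.
by rewrite ler_wpM2r// (le_trans (ler_norm _)).
Qed.

Lemma D2F_jacobian om a b v : D2F F om a b v = v *m 'J (fun y => F (om, y, b)) a.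
Proof. by rewrite /jacobian mul_rV_lin1. Qed.

Lemma D3F_jacobian om a b v : D3F F om a b v = v *m 'J (fun z => F (om, a, z)) b.
Proof. by rewrite /jacobian mul_rV_lin1. Qed.

Lemma jacobian_strict (J : Type) (G : set_system J) (f : J -> E -> E) (x y : J -> E)
    (A : 'M[R]_n) : Filter G -> (forall j v, differentiable (f j) v) ->
  (forall eta, 0 < eta -> \forall j \near G, forall s, 0 <= s <= 1 ->
     `|'J (f j) (y j + s *: (x j - y j)) - A| <= eta) ->
  forall eta, 0 < eta -> \forall j \near G,
    `|f j (x j) - f j (y j) - (x j - y j) *m A| <= eta * `|x j - y j|.
Proof.
move=> GF df fA eta eta0.
have e0 : 0 < eta / (n%:R + 1) by rewrite divr_gt0// ltr_wpDl.
apply: filterS (fA _ e0) => j Aj.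
apply: segment_mean_value => [v|s s01]; first exact: df.
rewrite -deriveE// deriveEjacobian// -mulmxBr; apply: le_trans (mulmx_norm_le _ _) _.
apply: le_trans (ler_wpM2l _ (Aj s s01)) _; first by rewrite mulr_ge0.
rewrite mulrAC; apply: ler_wpM2r => //.
by rewrite mulrCA; apply: ler_piMr; rewrite ?ltW// ltr_pdivrMr ?ltr_wpDl// mul1r ltrDl.
Qed.

(** Only partial derivatives are given, so the increment is split at [F (om j, a2 j, b1 j)]: on each
    leg one variable runs through a segment and the other tends to its limit. *)
Lemma F_strict (J : Type) (G : set_system J) (om : J -> Omega) (a1 a2 b1 b2 : J -> E)
    om0 a0 b0 : cond_H1 F -> Filter G -> om @ G --> om0 ->
  a1 @ G --> a0 -> a2 @ G --> a0 -> b1 @ G --> b0 -> b2 @ G --> b0 ->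
  forall eta, 0 < eta -> \forall j \near G,
    `|F (om j, a1 j, b1 j) - F (om j, a2 j, b2 j)
      - (D2F F om0 a0 b0 (a1 j - a2 j) + D3F F om0 a0 b0 (b1 j - b2 j))|
      <= eta * (`|a1 j - a2 j| + `|b1 j - b2 j|).
Proof.
move=> [_ d2 d3 c2 c3] GF omG a1G a2G b1G b2G eta eta0.
have h2 : \forall j \near G, `|F (om j, a1 j, b1 j) - F (om j, a2 j, b1 j)
    - (a1 j - a2 j) *m 'J (fun y => F (om0, y, b0)) a0| <= eta * `|a1 j - a2 j|.
  apply: (jacobian_strict (f := fun j y => F (om j, y, b1 j)) GF _ _ eta0) => // e e0.
  have /cvgrPdist_le/(_ _ e0)[[U V] [/= [[A B] [/= Aom Ba] AB] Vb] UV] := c2 (om0, a0, b0).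
  move: Ba => /nbhs_ballP[d /= d0 dB].
  have near_om : \forall j \near G, A (om j) by exact: (omG _ Aom).
  have near_b : \forall j \near G, V (b1 j) by exact: (b1G _ Vb).
  apply: filterS3 near_om near_b (segment_near GF a1G a2G d0) => j Aj Vj zj s s01.
  rewrite distrC; apply: (UV (om j, a2 j + s *: (a1 j - a2 j), b1 j)); split => //.
  by apply: AB; split => //; apply: dB; rewrite -ball_normE; exact: zj.
have h3 : \forall j \near G, `|F (om j, a2 j, b1 j) - F (om j, a2 j, b2 j)
    - (b1 j - b2 j) *m 'J (fun z => F (om0, a0, z)) b0| <= eta * `|b1 j - b2 j|.
  apply: (jacobian_strict (f := fun j z => F (om j, a2 j, z)) GF _ _ eta0) => // e e0.
  have /cvgrPdist_le/(_ _ e0)[[U V] [/= [[A B] [/= Aom Ba] AB] Vb] UV] := c3 (om0, a0, b0).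
  move: Vb => /nbhs_ballP[d /= d0 dB].
  have near_om : \forall j \near G, A (om j) by exact: (omG _ Aom).
  have near_a : \forall j \near G, B (a2 j) by exact: (a2G _ Ba).
  apply: filterS3 near_om near_a (segment_near GF b1G b2G d0) => j Aj Bj zj s s01.
  rewrite distrC; apply: (UV (om j, a2 j, b2 j + s *: (b1 j - b2 j))); split.
    by apply: AB; split.
  by apply: dB; rewrite -ball_normE; exact: zj.
apply: filterS2 h2 h3 => j; rewrite D2F_jacobian D3F_jacobian.
set u := _ *m _; set v := _ *m _ => e2 e3.
have -> : F (om j, a1 j, b1 j) - F (om j, a2 j, b2 j) - (u + v) =
  (F (om j, a1 j, b1 j) - F (om j, a2 j, b1 j) - u)
  + (F (om j, a2 j, b1 j) - F (om j, a2 j, b2 j) - v).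
  by rewrite addrACA -opprD addrA subrK.
by apply: le_trans (ler_normD _ _) _; rewrite mulrDr lerD.
Qed.

End strict_differentiability.

(** * Uniform bounds on compact sets *)

Section compact_bounds.
Context {R : realType}.

Lemma compact_loc_unif (T : topologicalType) (K : set T) (Q : R -> T -> Prop) :
  compact K -> (forall M N x, M <= N -> Q M x -> Q N x) ->
  (forall x, K x -> exists M, \forall y \near x, Q M y) ->
  exists2 M, 0 < M & forall x, K x -> Q M x.
Proof.
move=> /compact_near_coveringP cK mQ fK.
have : \forall M \near +oo, K `<=` Q M.
  apply: cK => x /fK[M fM].
  exists ([set y | Q M y], [set N | M < N]).
    by split => //=; exists M; split => //; exact: num_real.
  by move=> [y N] [/= fy MN]; apply: mQ fy; exact: ltW.
move=> [M [Mr MP]]; exists (`|M| + 1); first by rewrite ltr_wpDl.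
by move=> x Kx; apply: MP => //; rewrite (le_lt_trans (ler_norm M))// ltrDl.
Qed.

Lemma compact_loc_bounded (T : topologicalType) (K : set T) (f : T -> R) :
  compact K -> (forall x, K x -> exists M, \forall y \near x, f y <= M) ->
  exists2 M, 0 < M & forall x, K x -> f x <= M.
Proof.
move=> cK; apply: (compact_loc_unif (Q := fun M x => f x <= M)) => //.
by move=> M N x MN fM; exact: le_trans fM MN.
Qed.

Lemma continuous_loc_bounded (T : topologicalType) (f : T -> R) (x : T) :
  {for x, continuous f} -> exists M, \forall y \near x, f y <= M.
Proof.
move=> cf; exists (f x + 1).
by apply: (cvgr_le _ cf); rewrite ltrDl.
Qed.

Lemma norm_ball_compact n (B : R) : compact [set a : 'rV[R]_n | `|a| <= B].
Proof.
apply: bounded_closed_compact.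
  exists B; split; first exact: num_real.
  by move=> M BM a /= aB; rewrite (le_trans aB)// ltW.
rewrite (_ : mkset _ = (fun a : 'rV[R]_n => `|a|) @^-1` [set x | x <= B])//.
by apply: closed_comp => [a _|]; [exact: norm_continuous|exact: closed_le].
Qed.

Lemma segment_norm_le (V : normedModType R) (x y : V) (s B : R) :
  0 <= s <= 1 -> `|x| <= B -> `|y| <= B -> `|x + s *: (y - x)| <= B.
Proof.
move=> /andP[s0 s1] xB yB.
have -> : x + s *: (y - x) = (1 - s) *: x + s *: y.
  by rewrite scalerBr scalerBl scale1r addrA addrAC.
apply: le_trans (ler_normD _ _) _; rewrite !normrZ !ger0_norm ?subr_ge0//.
have -> : B = (1 - s) * B + s * B by rewrite -mulrDl subrK mul1r.
by rewrite lerD// ler_wpM2l// subr_ge0.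
Qed.

Lemma segC_le_segW (r : {posnum R}) n (x : segW r n) : `|(x : segC r n)| <= `|x|.
Proof. by rewrite [leRHS]/(segW_norm x) le_max lexx. Qed.

Lemma segW_segC_continuous (r : {posnum R}) n :
  continuous (fun x : segW r n => segW_segC x).
Proof.
move=> x A /nbhs_ballP[e /= e0 eA].
have : nbhs x (ball x e) by exact: nbhsx_ballx.
apply: (@filterS _ (nbhs x)) => y; rewrite -ball_normE => xy.
apply: eA; rewrite -ball_normE /=.
by apply: le_lt_trans xy; exact: (segC_le_segW (x - y)).
Qed.

End compact_bounds.

(** * Continuous convergence along filters *)

Section continuous_convergence.
Context {R : realType} {V : normedModType R}.

(* Continuous convergence at t of a family of functions along a filter; it is
   stable under composition and, for equi-Lipschitz families, follows from
   pointwise convergence. *)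
Definition ccvg (J : Type) (G : set_system J) (z_ : J -> R -> V) (z : R -> V) (t : R) :=
  z_ js.1 js.2 @[js --> filter_prod G (nbhs t)] --> z t.

Lemma ccvg_comp (J L : Type) (G : set_system J) (H : set_system L)
    (z_ : J -> R -> V) z t (i : L -> J) (th : L -> R) :
  Filter G -> Filter H -> ccvg G z_ z t -> i @ H --> G -> th @ H --> t ->
  z_ (i l) (th l) @[l --> H] --> z t.
Proof.
move=> GF HF zt iH thH.
apply: (@cvg_comp _ _ _ (fun l => (i l, th l)) (fun js => z_ js.1 js.2) H
  (filter_prod G (nbhs t)) (nbhs (z t))) zt.
exact: (cvg_pair iH thH).
Qed.

Lemma ccvg_pointwise (J : Type) (G : set_system J) (z_ : J -> R -> V) z t :
  Filter G -> ccvg G z_ z t -> z_ j t @[j --> G] --> z t.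
Proof.
move=> GF zt; apply: (ccvg_comp (i := id) (th := fun=> t)) zt _ _; last exact: cvg_cst.
exact: cvg_id.
Qed.

Lemma ccvg_continuous (J : Type) (G : set_system J) (z_ : J -> R -> V) z :
  ProperFilter G -> (forall t, ccvg G z_ z t) -> continuous z.
Proof.
move=> GP zt t; apply/cvgrPdist_le => e e0.
have /cvgrPdist_le/(_ _ e0)[[A B] [/= GA tB] AB] := zt t.
apply: (@filterS _ (nbhs t) _ _ _ _ tB) => s Bs.
have zs : `|z t - z_ j s| @[j --> G] --> `|z t - z s|.
  by apply: cvg_norm; apply: cvgB; [exact: cvg_cst|exact: ccvg_pointwise].
apply: (@closed_cvg _ _ G _ _ [set x : R | x <= e] _ _ _ zs); first exact: closed_le.
by apply: filterS GA => j Aj; apply: (AB (j, s)).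
Qed.

Lemma ccvg_lipschitz (J : Type) (G : set_system J) (z_ : J -> R -> V) z (N d : R) t :
  Filter G -> 0 < d ->
  (forall j s, `|s - t| < d -> `|z_ j s - z_ j t| <= N * `|s - t|) ->
  z_ j t @[j --> G] --> z t -> ccvg G z_ z t.
Proof.
move=> GF d0 zN zt; apply/cvgrPdist_le => e e0.
have e20 : 0 < e / 2 by rewrite divr_gt0.
have N0 : 0 < `|N| + 1 by rewrite ltr_wpDl.
pose d' := Num.min d (e / 2 / (`|N| + 1)).
have d'0 : 0 < d' by rewrite lt_min d0 divr_gt0.
have /cvgrPdist_le/(_ _ e20) GA := zt.
exists ([set j | `|z t - z_ j t| <= e / 2], ball t d').
  by split => //=; exact: nbhsx_ballx.
move=> [j s] [/= Aj]; rewrite /ball/= distrC lt_min => /andP[sd se].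
rewrite (splitr e); apply: le_trans (ler_distD (z_ j t) _ _) _.
apply: lerD => //; rewrite distrC; apply: le_trans (zN j s sd) _.
have : `|s - t| * (`|N| + 1) < e / 2 by rewrite -ltr_pdivlMr.
move=> /ltW; apply: le_trans; rewrite mulrC ler_wpM2l//.
by apply: le_trans (ler_norm N) _; rewrite lerDl.
Qed.

Lemma cvg_prod_within (J : Type) (T : topologicalType) (G : set_system J) (D : set R)
    (f : J * R -> T) (t : R) (l : T) :
  f @ filter_prod G (nbhs t) --> l -> f @ filter_prod G (within D (nbhs t)) --> l.
Proof.
move=> h U /h[[A B] [/= GA tB] AB]; exists (A, B) => //=; split => //.
exact: cvg_within tB.
Qed.

Lemma ccvg_of_segC (r : {posnum R}) n (J : Type) (G : set_system J)
    (x_ : J -> segC r n) (x : segC r n) t : Filter G -> x_ @ G --> x ->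
  continuous x ->
  ((x_ js.1 : R -> 'rV[R]_n) js.2) @[js --> filter_prod G (nbhs t)] --> x t.
Proof.
move=> GF xG cx; apply/cvgrPdist_le => e e0.
have e20 : 0 < e / 2 by rewrite divr_gt0.
have /cvgrPdist_le/(_ _ e20) GA := xG.
have /cvgrPdist_le/(_ _ e20) tB := cx t.
exists ([set j | `|x - x_ j| <= e / 2], [set s | `|x t - x s| <= e / 2]) => //.
move=> [j s] [/= Aj Bs].
rewrite (splitr e); apply: le_trans (ler_distD (x s) _ _) _.
apply: lerD => //; apply: le_trans Aj.
exact: (segC_norm_ub (x - x_ j) s).
Qed.

End continuous_convergence.

Lemma cvg_pair_fst (J : Type) (T1 T2 : topologicalType) (G : set_system J)
    {FG : Filter G} (f : J -> T1 * T2) (c : T1 * T2) :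
  f @ G --> c -> (f j).1 @[j --> G] --> c.1.
Proof. by move=> fc; apply: (@continuous_cvg _ _ _ G FG f fst) fc => //; exact: cvg_fst. Qed.
Lemma cvg_segW_segC (R : realType) (r : {posnum R}) n (Omega : metricType R)
    (J : Type) (G : set_system J) {FG : Filter G} (f : J -> Omega * segW r n)
    (c : Omega * segW r n) :
  f @ G --> c -> segW_segC (f j).2 @[j --> G] --> segW_segC c.2.
Proof.
move=> fc; apply: (@continuous_cvg _ _ _ G FG f (fun z => segW_segC z.2)) fc => //.
apply: continuous_comp; [exact: cvg_snd|exact: segW_segC_continuous].
Qed.

(** * Trajectories in P *)

Section trajectories.
Context {R : realType} {r : {posnum R}} {n : nat} {Omega : metricType R}.
Local Notation E := 'rV[R]_n.
Local Notation I := (hist_itv r).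
Local Notation C := (segC r n).
Local Notation W := (segW r n).
Local Notation hst := (@hist R r n).
Variables (sigma : R -> Omega -> Omega).
Variables (F : Omega * E * E -> E) (tau : Omega * C -> R).
Variable P : set (Omega * W).

Hypotheses (compact_Omega : compact [set: Omega])
  (flow_sigma : continuous_flow sigma) (F_H1 : cond_H1 F)
  (tau_bounds : forall p, 0 <= tau p <= r%:num) (tau_H2 : cond_H2 tau)
  (P_invariant : pos_invariant sigma F tau P) (P_compact : compact P).

Definition rhs (om : Omega) (y : R -> E) (t : R) : E :=
  F (sigma t om, y t, y (t - tau (sigma t om, hst y t))).

Definition inP (om : Omega) (x : C) : Prop := exists2 w : W, P (om, w) & (w : C) = x.

(** What the estimates need from a solution staying in [P], detached from [maxsol], so that limits
    of solutions can be treated before they are identified as solutions. Continuity on the whole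
    line serves [hist]. *)
Definition traj (om : Omega) (y : R -> E) : Prop :=
  [/\ continuous y, forall t, 0 <= t -> inP (sigma t om) (hst y t) &
      forall t, 0 <= t -> has_rderiv `[0, +oo[ y t (rhs om y t)].

Lemma F_bounded B : exists2 N, 0 < N &
  forall om a b, `|a| <= B -> `|b| <= B -> `|F (om, a, b)| <= N.
Proof.
have [cF _ _ _ _] := F_H1.
pose K := [set: Omega] `*` [set a : E | `|a| <= B] `*` [set a : E | `|a| <= B].
have cK : compact K.
  apply: compact_setX; last exact: norm_ball_compact.
  by apply: compact_setX => //; exact: norm_ball_compact.
have [|N N0 NP] := compact_loc_bounded (f := fun q => `|F q|) cK.
  by move=> q _; apply: continuous_loc_bounded; apply: cvg_norm; exact: cF.
by exists N => // om a b aB bB; apply: (NP (om, a, b)).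
Qed.

Lemma F_partials_bounded B : exists2 N, 0 < N & forall om a b, `|a| <= B -> `|b| <= B ->
  forall v, `|D2F F om a b v| <= N * `|v| /\ `|D3F F om a b v| <= N * `|v|.
Proof.
have [_ d2 d3 c2 c3] := F_H1.
pose K := [set: Omega] `*` [set a : E | `|a| <= B] `*` [set a : E | `|a| <= B].
have cK : compact K.
  apply: compact_setX; last exact: norm_ball_compact.
  by apply: compact_setX => //; exact: norm_ball_compact.
have [|N N0 NP] := compact_loc_bounded (f := fun q : Omega * E * E =>
    `|'J (fun y => F (q.1.1, y, q.2)) q.1.2|) cK.
  by move=> q _; apply: continuous_loc_bounded; apply: cvg_norm; exact: c2.
have [|L L0 LP] := compact_loc_bounded (f := fun q : Omega * E * E =>
    `|'J (fun z => F (q.1.1, q.1.2, z)) q.2|) cK.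
  by move=> q _; apply: continuous_loc_bounded; apply: cvg_norm; exact: c3.
exists ((n%:R + 1) * (N + L)); first by apply: mulr_gt0; [rewrite ltr_wpDl|exact: addr_gt0].
move=> om a b aB bB v; rewrite D2F_jacobian D3F_jacobian.
have H (A : 'M[R]_n) : `|A| <= N + L -> `|v *m A| <= (n%:R + 1) * (N + L) * `|v|.
  move=> AN; apply: le_trans (mulmx_norm_le _ _) _.
  rewrite mulrAC ler_wpM2r//; apply: ler_pM => //.
  by rewrite lerDl.
split; apply: H.
  by apply: (le_trans (NP (om, a, b) _)) => //; rewrite lerDl ltW.
by apply: (le_trans (LP (om, a, b) _)) => //; rewrite lerDr ltW.
Qed.

Lemma F_lipschitz B : exists2 L, 0 < L & forall om a1 b1 a2 b2,
  `|a1| <= B -> `|b1| <= B -> `|a2| <= B -> `|b2| <= B ->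
  `|F (om, a1, b1) - F (om, a2, b2)| <= L * (`|a1 - a2| + `|b1 - b2|).
Proof.
have [_ d2 d3 _ _] := F_H1.
have [L L0 LP] := F_partials_bounded B; exists L => // om a1 b1 a2 b2 a1B b1B a2B b2B.
have -> : F (om, a1, b1) - F (om, a2, b2) =
    (F (om, a1, b1) - F (om, a2, b1) - 0) + (F (om, a2, b1) - F (om, a2, b2) - 0).
  by rewrite !subr0 addrA subrK.
apply: le_trans (ler_normD _ _) _; rewrite mulrDr; apply: lerD.
  apply: (segment_mean_value (f := fun y => F (om, y, b1))) => // s s01.
  by rewrite subr0; apply: (LP om _ b1 _ b1B _).1; exact: segment_norm_le.
apply: (segment_mean_value (f := fun z => F (om, a2, z))) => // s s01.
by rewrite subr0; apply: (LP om a2 _ a2B _ _).2; exact: segment_norm_le.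
Qed.

Lemma P_bounded : exists2 B, 0 < B & forall om x, inP om x -> `|x| <= B.
Proof.
have [|B B0 BP] := compact_loc_bounded (f := fun p : Omega * W => `|p.2|) P_compact.
  move=> p _; apply: continuous_loc_bounded.
  by apply: cvg_norm; exact: cvg_snd.
exists B => // om x [w Pw <-]; apply: le_trans (segC_le_segW w) _.
exact: BP Pw.
Qed.

Lemma D2tau_loc_bounded (q0 : Omega * C) : exists M, \forall q \near q0,
  forall v, `|D2tau tau q.1 q.2 v| <= M * `|v|.
Proof.
have [_ _ cD _] := tau_H2; have [K K0 KP] := D2tau_bound q0.1 q0.2 tau_H2.
exists (K + 1); have /cvgrPdist_le/(_ _ ltr01) := cD q0.
move=> h; apply: (@filterS _ (nbhs q0) _ _ _ _ h) => q; rewrite sub0r normrN => Dq v.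
have [L L0 LP] := D2tau_bound q.1 q.2 tau_H2.
rewrite -[D2tau tau q.1 q.2 v](subrK (D2tau tau q0.1 q0.2 v)) addrC.
apply: le_trans (ler_normD _ _) _; rewrite mulrDl mul1r lerD//.
apply: le_trans (@opnorm_ub _ _ _ (D2tau tau q.1 q.2 \- D2tau tau q0.1 q0.2) (L + K) _ _ _) _.
- move=> a u; set p := D2tau tau q.1 q.2; set p0 := D2tau tau q0.1 q0.2.
  rewrite -[LHS]/(p (a *: u) - p0 (a *: u)) -[RHS]/(a * (p u - p0 u)).
  by rewrite /p /p0 !D2tauZ mulrBr.
- by move=> u; apply: le_trans (ler_normB _ _) _; rewrite mulrDl lerD.
by rewrite ler_piMl// (le_trans (ler_norm _)).
Qed.

(** [P] need not be convex, so mean value segments may leave it; they are covered by a continuous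
    image of the compact set of pairs of points of [P] and parameters in [0, 1]. *)
Lemma tau_lipschitz : exists2 L, 0 < L &
  (forall om x y, inP om x -> inP om y ->
    `|tau (om, x) - tau (om, y)| <= L * `|x - y|) /\
  (forall om x v, inP om x -> `|D2tau tau om x v| <= L * `|v|).
Proof.
have [_ dtau _ _] := tau_H2.
pose K := P `*` P `*` `[0, 1 : R]%classic.
have cK : compact K.
  apply: compact_setX; last exact: segment_compact.
  exact: compact_setX.
pose g (q : (Omega * W) * (Omega * W) * R) : Omega * C :=
  (q.1.1.1, segW_segC q.1.1.2 + q.2 *: (segW_segC q.1.2.2 - segW_segC q.1.1.2)).
have cg : continuous g.
  move=> q; have c1 : segW_segC z.1.1.2 @[z --> q] --> segW_segC q.1.1.2.
    apply: (@continuous_comp _ _ _ (fun z : (Omega * W) * (Omega * W) * R => z.1.1.2) (@segW_segC R r n)).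
      apply: (@continuous_comp _ _ _ (fun z : (Omega * W) * (Omega * W) * R => z.1.1) snd).
        apply: (@continuous_comp _ _ _ fst fst); exact: cvg_fst.
      exact: cvg_snd.
    exact: segW_segC_continuous.
  have c2 : segW_segC z.1.2.2 @[z --> q] --> segW_segC q.1.2.2.
    apply: (@continuous_comp _ _ _ (fun z : (Omega * W) * (Omega * W) * R => z.1.2.2) (@segW_segC R r n)).
      apply: (@continuous_comp _ _ _ (fun z : (Omega * W) * (Omega * W) * R => z.1.2) snd).
        apply: (@continuous_comp _ _ _ fst snd); [exact: cvg_fst|exact: cvg_snd].
      exact: cvg_snd.
    exact: segW_segC_continuous.
  have cA : z.1.1.1 @[z --> q] --> q.1.1.1.
    apply: (@continuous_comp _ _ _ (fun z : (Omega * W) * (Omega * W) * R => z.1.1) fst).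
      apply: (@continuous_comp _ _ _ fst fst); exact: cvg_fst.
    exact: cvg_fst.
  have cB : segW_segC z.1.1.2 + z.2 *: (segW_segC z.1.2.2 - segW_segC z.1.1.2) @[z --> q]
      --> segW_segC q.1.1.2 + q.2 *: (segW_segC q.1.2.2 - segW_segC q.1.1.2).
    apply: cvgD => //; apply: cvgZ; first exact: cvg_snd.
    exact: cvgB.
  exact: (cvg_pair cA cB).
have [||L L0 LP] := compact_loc_unif (Q := fun M q => forall v,
    `|D2tau tau (g q).1 (g q).2 v| <= M * `|v|) cK.
- by move=> M N q MN h v; apply: le_trans (h v) _; rewrite ler_wpM2r.
- by move=> q _; have [M hM] := D2tau_loc_bounded (g q); exists M; exact: (cg q _ hM).
exists L => //; split.
  move=> om _ _ [x Px <-] [y Py <-].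
  have dt v : differentiable (fun z => tau (om, z)) v by exact: dtau.
  have := segment_mean_value (f := fun z => tau (om, z)) (W := R^o)
    (x := segW_segC y) (y := segW_segC x) (c := 0) (K := L * `|segW_segC x - segW_segC y|) dt.
  rewrite subr0; apply => s s01; rewrite subr0.
  apply: (LP ((om, y), (om, x), s)).
  by split; [split|rewrite /= in_itv].
move=> om _ v [x Px <-].
have := LP ((om, x), (om, x), 0) _ v; rewrite /g/= scale0r addr0; apply.
by split; [split|rewrite /= in_itv/= lexx ler01].
Qed.

Lemma traj_bounded om y B t : traj om y ->
  (forall om x, inP om x -> `|x| <= B) -> - r%:num <= t -> `|y t| <= B.
Proof.
move=> [cy yP _] BP rt; have m0 : 0 <= Num.max t 0 by rewrite le_max lexx orbT.
apply: le_trans (BP _ _ (yP _ m0)); apply: hist_ub => //.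
apply/andP; split; last by rewrite le_max lexx.
rewrite lerBlDr ge_max; apply/andP; split; first by rewrite lerDl.
by rewrite -lerBlDr sub0r.
Qed.

Lemma tau_window om y t (D := t - tau (sigma t om, hst y t)) :
  t - r%:num <= D <= t.
Proof.
have /andP[tau0 taur] := tau_bounds (sigma t om, hst y t).
by rewrite /D lerD2l lerN2 taur gerBl.
Qed.

Lemma traj_lipschitz : exists2 N, 0 < N & forall om y, traj om y ->
  (forall t, 0 <= t -> `|rhs om y t| <= N) /\
  (forall s t, 0 <= s -> 0 <= t -> `|y s - y t| <= N * `|s - t|).
Proof.
have [B B0 BP] := P_bounded; have [N N0 NP] := F_bounded B.
exists N => // om y yT; have [cy yP yd] := yT.
have gN t : 0 <= t -> `|rhs om y t| <= N.
  move=> t0; have rt : - r%:num <= t by rewrite (le_trans _ t0)// oppr_le0.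
  apply: NP; apply: (traj_bounded yT BP) => //.
  have /andP[+ _] := tau_window om y t; apply: le_trans.
  by rewrite lerDr.
split => // s t s0 t0.
apply: (@rderiv_lipschitz _ _ y (rhs om y) 0 0 (Num.max s t) N (lexx 0) cy).
- by move=> u /andP[u0 _]; exact: yd.
- by move=> u /andP[u0 _]; exact: gN.
- by rewrite s0 le_max lexx.
- by rewrite t0 le_max lexx orbT.
Qed.

Lemma traj_split y s : continuous y -> - r%:num <= s ->
  y s = hst y 0 s + (y (Num.max s 0) - y 0).
Proof.
move=> cy rs; rewrite histE// add0r /clamp.
have [s0|s0] := leP s 0; first by rewrite max_r// subrr addr0.
by rewrite max_r ?oppr_le0// addrC subrK.
Qed.

Lemma traj_window_lipschitz om y : traj om y -> exists2 K, 0 <= K &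
  forall s t, - r%:num <= s -> - r%:num <= t -> `|y s - y t| <= K * `|s - t|.
Proof.
move=> yT; have [N N0 /(_ _ _ yT)[_ yN]] := traj_lipschitz.
have [cy yP _] := yT; have [w _ wE] := yP 0 (lexx 0).
have [K wK] := (segW_predP (segW_segC w)).1 (valP w).
exists (`|K| + N); first by rewrite addr_ge0// ltW.
move=> s t rs rt; rewrite (traj_split cy rs) (traj_split cy rt) -wE.
rewrite opprD addrACA subrACA subrr subr0 mulrDl.
apply: le_trans (ler_normD _ _) _; apply: lerD.
  by apply: le_trans (wK s t) _; rewrite ler_wpM2r// ler_norm.
apply: le_trans (yN _ _ _ _) _; rewrite ?le_max ?lexx ?orbT//.
by rewrite ler_pM2l// maxr0_dist.
Qed.

(** A state-dependent delay evaluates the two solutions at different times [d1] and [d2]. Inserting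
    [y2 d1] leaves a difference at one time and an increment of [y2]; so [K] is required of [y2]
    only. *)
Lemma traj_rhs_diff K : 0 <= K -> exists2 c, 0 < c & forall om y1 y2,
  traj om y1 -> traj om y2 ->
  (forall s t, - r%:num <= s -> - r%:num <= t -> `|y2 s - y2 t| <= K * `|s - t|) ->
  forall t, 0 <= t -> `|rhs om y1 t - rhs om y2 t| <= c * `|hst (fun s => y1 s - y2 s) t|.
Proof.
move=> K0; have [B B0 BP] := P_bounded; have [L L0 LP] := F_lipschitz B.
have [L' L'0 [L'P _]] := tau_lipschitz.
exists (L * (1 + (1 + K * L'))).
  by rewrite mulr_gt0// addr_gt0// ltr_pwDl// mulr_ge0// ltW.
move=> om y1 y2 y1T y2T y2K t t0.
have [cy1 y1P _] := y1T; have [cy2 y2P _] := y2T.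
have ce : continuous (fun s => y1 s - y2 s).
  by move=> s; apply: cvgB; [exact: cy1|exact: cy2].
have rt : - r%:num <= t by rewrite (le_trans _ t0)// oppr_le0.
have W1 := tau_window om y1 t; have W2 := tau_window om y2 t.
set d1 := _ - _ in W1; set d2 := _ - _ in W2.
have rd (d : R) : t - r%:num <= d <= t -> - r%:num <= d.
  by move=> /andP[+ _]; apply: le_trans; rewrite lerDr.
rewrite /rhs -/d1 -/d2.
apply: le_trans (LP _ _ _ _ _ _ _ _ _) _.
- exact: (traj_bounded y1T BP).
- by apply: (traj_bounded y1T BP); exact: rd.
- exact: (traj_bounded y2T BP).
- by apply: (traj_bounded y2T BP); exact: rd.
rewrite -mulrA ler_pM2l// mulrDl mul1r; apply: lerD.
  by apply: (hist_ub (y := fun s => y1 s - y2 s) ce); rewrite lexx andbT gerBl.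
have -> : y1 d1 - y2 d2 = (y1 d1 - y2 d1) + (y2 d1 - y2 d2) by rewrite addrA subrK.
apply: le_trans (ler_normD _ _) _; rewrite mulrDl mul1r; apply: lerD.
  exact: (hist_ub (y := fun s => y1 s - y2 s) ce).
apply: le_trans (y2K _ _ (rd _ W1) (rd _ W2)) _.
rewrite -mulrA; apply: ler_wpM2l => //.
have -> : d1 - d2 = tau (sigma t om, hst y2 t) - tau (sigma t om, hst y1 t).
  by rewrite /d1 /d2; ring.
rewrite distrC histB//; apply: L'P; [exact: y1P|exact: y2P].
Qed.

Lemma traj_gronwall K T : 0 <= K -> exists2 A, 0 <= A & forall om y1 y2,
  traj om y1 -> traj om y2 ->
  (forall s t, - r%:num <= s -> - r%:num <= t -> `|y2 s - y2 t| <= K * `|s - t|) ->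
  forall t, 0 <= t <= T -> `|hst y1 t - hst y2 t| <= A * `|hst y1 0 - hst y2 0|.
Proof.
move=> K0; have [c c0 cP] := traj_rhs_diff K0.
(* The exponent is a number of steps of length [1 / (2 * c)] that covers [0, T]; each step may
   double the difference. *)
exists (2 ^+ Num.bound (T * (2 * c))); first exact: exprn_ge0.
move=> om y1 y2 y1T y2T y2K t tT; have [t0 _] := andP tT.
have [cy1 y1P y1d] := y1T; have [cy2 y2P y2d] := y2T.
rewrite -!histB//; apply: (delay_gronwall c0 _ _ _ tT).
- by move=> s; apply: cvgB; [exact: cy1|exact: cy2].
- by move=> s /andP[s0 _]; apply: has_rderivB; [exact: y1d|exact: y2d].
- by move=> s /andP[s0 _]; exact: cP.
rewrite ler_pdivlMr ?mulr_gt0//; have [_ tT'] := andP tT.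
have c20 : 0 <= 2 * c by rewrite mulr_ge0// ltW.
have Tc : 0 <= T * (2 * c) by rewrite mulr_ge0// (le_trans t0).
by apply: le_trans (ltW (archi_boundP Tc)); rewrite ler_wpM2r.
Qed.

Lemma traj_unique om y1 y2 : traj om y1 -> traj om y2 -> hst y1 0 = hst y2 0 ->
  forall t, 0 <= t -> hst y1 t = hst y2 t.
Proof.
move=> y1T y2T y12 t t0; have [K K0 y2K] := traj_window_lipschitz y2T.
have [A A0 AP] := traj_gronwall t K0.
have := AP _ _ _ y1T y2T y2K t; rewrite t0 lexx => /(_ isT).
rewrite y12 subrr normr0 mulr0 normr_le0 => /eqP/subr0_eq.
exact.
Qed.

Lemma traj_shift om y c : traj om y -> 0 <= c -> traj (sigma c om) (fun t => y (t + c)).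
Proof.
have [_ _ sD] := flow_sigma.
move=> [cy yP yd] c0.
have cyc : continuous (fun t => y (t + c)).
  move=> u; apply: (@continuous_comp _ _ _ (fun s => s + c) y); last exact: cy.
  by apply: cvgD; [exact: cvg_id|exact: cvg_cst].
split => // t t0; first by rewrite hist_shift// -sD; apply: yP; rewrite addr_ge0.
have -> : rhs (sigma c om) (fun t => y (t + c)) t = rhs om y (t + c).
  by rewrite /rhs hist_shift// -sD addrAC.
apply: (has_rderivW (B := [set t | `[0, +oo[%classic (t + c)])).
  by move=> u; rewrite /= !in_itv/= !andbT => u0; rewrite addr_ge0.
by apply: has_rderiv_shift; apply: yd; rewrite addr_ge0.
Qed.

(* sol is arbitrary outside [-r, lifetime[; for a global solution, gsol agrees
   with it on [-r, +oo[ and is continuous on R. *)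
Definition gsol (p : Omega * W) (t : R) : E :=
  p.2 t + (sol sigma F tau p (Num.max t 0) - sol sigma F tau p 0).

(** The default of [maxsol] has lifetime 0, so an infinite lifetime forces a genuine maximal
    solution. *)
Lemma lifetime_solution p : lifetime sigma F tau p = +oo%E ->
  is_solution sigma F tau p +oo%E (sol sigma F tau p).
Proof.
rewrite /lifetime /sol /maxsol; case: xgetP => [q _ [Hq _] q1|_ /= q1].
  by rewrite -q1.
by move: q1 => /eqP; rewrite lt_eqF// ltry.
Qed.

Lemma segC_total_continuous (x : C) : continuous x.
Proof.
move=> u V Vx; have Iu := clamp_itv r u.
have h : segC_fun x @ within I (nbhs (clamp r u)) --> segC_fun x (clamp r u).
  by have /subspace_continuousP/(_ _ Iu) := @segC_continuous R r n x.
rewrite segC_clamp in h.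
have H := @clamp_continuous R r u _ (h V Vx).
apply: (@filterS _ (nbhs u) _ _ _ _ H) => s /=.
by rewrite segC_clamp; apply; exact: clamp_itv.
Qed.

Lemma has_rderiv_eq (V : normedModType R) (A : set R) (f g : R -> V) x l :
  (forall u, A u -> f u = g u) -> A x -> has_rderiv A f x l -> has_rderiv A g x l.
Proof.
move=> fg Ax /has_rderivP H; apply/has_rderivP => e e0.
by apply: filterS (H e e0) => h + Ah; rewrite -!fg//; exact.
Qed.

(** * Solutions with infinite lifetime *)

Section global_solution.
Variable p : Omega * W.
Hypothesis p_global : lifetime sigma F tau p = +oo%E.

Lemma gsol_sol t : - r%:num <= t -> gsol p t = sol sigma F tau p t.
Proof.
move=> rt; have [_ _ yp _] := lifetime_solution p_global; rewrite /gsol.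
have [t0|t0] := leP t 0.
  by rewrite subrr addr0 yp//; apply/hist_itvE; rewrite rt.
rewrite -(segC_clamp p.2 t) /clamp min_r ?(ltW t0)// max_r ?oppr_le0//.
rewrite (yp 0); first by rewrite addrC subrK.
by apply/hist_itvE; rewrite lexx oppr_le0 andbT.
Qed.

Lemma gsol_split t : gsol p t = p.2 t + (gsol p (Num.max t 0) - gsol p 0).
Proof.
have r0 u : 0 <= u -> - r%:num <= u by move=> u0; rewrite (le_trans _ u0)// oppr_le0.
have m0 : 0 <= Num.max t 0 by rewrite le_max lexx orbT.
by rewrite (gsol_sol (r0 _ (lexx 0))) (gsol_sol (r0 _ m0)).
Qed.

Lemma gsol_continuous : continuous (gsol p).
Proof.
have [_ cy _ _] := lifetime_solution p_global.
move=> u; apply: cvgD; first exact: segC_total_continuous.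
apply: cvgB; last exact: cvg_cst.
apply: (@continuous_comp _ _ _ (fun t : R => Num.max t 0) (sol sigma F tau p)).
  exact: maxr0_continuous.
set s := Num.max u 0; have s0 : 0 <= s by rewrite le_max lexx orbT.
set A := [set t | _] in cy.
have As : \forall v \near s, A v.
  have : \forall v \near s, - r%:num < v.
    by apply: lt_nbhsr; rewrite (lt_le_trans _ s0)// oppr_lt0.
  by apply: filterS => v rv; split; [exact: ltW|rewrite ltry].
have /subspace_continuousP/(_ _ (nbhs_singleton As)) h := cy.
move=> V /h H; apply: (@filterS2 _ (nbhs s) _ _ _ _ _ As H) => v Av.
exact.
Qed.

Lemma hist_sol t : 0 <= t -> hst (sol sigma F tau p) t = hst (gsol p) t.
Proof.
move=> t0; rewrite /hist; congr insubd; apply/funext => s; rewrite gsol_sol//.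
have /hist_itvE/andP[rs _] := clamp_itv r s.
by rewrite (le_trans rs)// lerDr.
Qed.

Lemma gsol_rderiv t : 0 <= t -> has_rderiv `[0, +oo[ (gsol p) t (rhs p.1 (gsol p) t).
Proof.
move=> t0; have [_ _ _ yd] := lifetime_solution p_global.
have r0 u : 0 <= u -> - r%:num <= u by move=> u0; rewrite (le_trans _ u0)// oppr_le0.
have := yd t t0 (ltry _); rewrite hist_sol//.
have /andP[dr _] := tau_window p.1 (gsol p) t.
rewrite -gsol_sol ?r0// -gsol_sol; last by rewrite (le_trans _ dr)// lerDr.
apply: has_rderiv_eq; last by rewrite /= in_itv/= t0.
by move=> u; rewrite /= in_itv/= andbT => u0; rewrite gsol_sol ?r0.
Qed.

Lemma gsol_init s : I s -> gsol p s = p.2 s.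
Proof.
move=> Is; have /andP[rs _] := (hist_itvE r s).1 Is; rewrite gsol_sol//.
by have [_ _ + _] := lifetime_solution p_global; apply.
Qed.

Lemma hist_gsol0 : hst (gsol p) 0 = p.2.
Proof.
apply: segCP => s; rewrite inE => Is.
by rewrite hist_in ?add0r ?gsol_init//; exact: gsol_continuous.
Qed.

(** [usol] falls back on 0 unless the history is Lipschitz. The constant combines that of the
    initial function with a bound on [F] over the range of the solution on [- r, t]. *)
Lemma usolE t : 0 <= t -> segW_segC (usol sigma F tau t p) = hst (gsol p) t.
Proof.
move=> t0; rewrite /usol hist_sol//; have cy := gsol_continuous.
apply: insubdK; apply/segW_predP.
have [|B B0 BP] := compact_loc_bounded (f := fun s => `|gsol p s|)
    (segment_compact (a := - r%:num) (b := t)).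
  by move=> s _; apply: continuous_loc_bounded; apply: cvg_norm; exact: cy.
have yB s : - r%:num <= s <= t -> `|gsol p s| <= B.
  by move=> st; apply: BP; rewrite /= in_itv.
have [N N0 NP] := F_bounded B.
have yN : forall s u, 0 <= s <= t -> 0 <= u <= t -> `|gsol p s - gsol p u| <= N * `|s - u|.
  apply: (@rderiv_lipschitz _ _ _ (rhs p.1 (gsol p)) 0) => // u /andP[u0 ut].
    exact: gsol_rderiv.
  have /andP[dr du] := tau_window p.1 (gsol p) u.
  apply: NP; apply: yB.
    by rewrite ut (le_trans _ u0)// oppr_le0.
  by rewrite (le_trans du ut) (le_trans _ dr)// lerDr.
have [K wK] := (segW_predP (segW_segC p.2)).1 (valP p.2).
exists (`|K| + N) => s u; rewrite !histE//.
have H v : 0 <= Num.max (t + clamp r v) 0 <= t.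
  rewrite le_max lexx orbT/= ge_max t0 andbT gerDl.
  by have /hist_itvE/andP[] := clamp_itv r v.
have dE : `|t + clamp r s - (t + clamp r u)| <= `|s - u|.
  by rewrite opprD addrACA subrr add0r; exact: clamp_dist.
rewrite /gsol opprD addrACA subrACA subrr subr0 mulrDl.
apply: le_trans (ler_normD _ _) _; apply: lerD.
  apply: le_trans (wK _ _) _; apply: le_trans (ler_wpM2r (normr_ge0 _) (ler_norm K)) _.
  by rewrite ler_wpM2l.
have E v : 0 <= v -> sol sigma F tau p v = gsol p v.
  by move=> v0; rewrite gsol_sol// (le_trans _ v0)// oppr_le0.
have /andP[s0 _] := H s; have /andP[u0 _] := H u.
rewrite !E//; apply: le_trans (yN _ _ (H s) (H u)) _.
by rewrite ler_pM2l// (le_trans (maxr0_dist _ _)).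
Qed.

End global_solution.

Lemma traj_gsol p : P p -> traj p.1 (gsol p).
Proof.
move=> Pp; have [pg pP] := P_invariant Pp; split.
- exact: gsol_continuous.
- by move=> t t0; exists (usol sigma F tau t p); [exact: pP|exact: usolE].
- by move=> t t0; exact: gsol_rderiv.
Qed.

Lemma Pi_P p t : P p -> 0 <= t -> P (Pi sigma F tau t p).
Proof. by move=> Pp t0; have [_] := P_invariant Pp; apply. Qed.

Lemma P_global p : P p -> lifetime sigma F tau p = +oo%E.
Proof. by move=> /P_invariant[]. Qed.

Lemma segW_inj (x y : W) : segW_segC x = segW_segC y -> x = y.
Proof. exact: val_inj. Qed.

Lemma Pi0 p : P p -> Pi sigma F tau 0 p = p.
Proof.
move=> Pp; have [_ s0 _] := flow_sigma; rewrite /Pi s0.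
rewrite [RHS]surjective_pairing; congr pair; apply: segW_inj.
by rewrite usolE ?hist_gsol0//; exact: P_global.
Qed.

Lemma hist_gsolD p s t : P p -> 0 <= s -> 0 <= t ->
  hst (gsol p) (s + t) = hst (gsol (Pi sigma F tau t p)) s.
Proof.
move=> Pp s0 t0; have Ppt := Pi_P Pp t0.
have yT := traj_gsol Pp; have cy := gsol_continuous (P_global Pp).
apply: etrans (esym (hist_shift r t s cy)) _.
apply: (traj_unique (traj_shift yT t0) (traj_gsol Ppt) _ s0).
apply: etrans (hist_shift r t 0 cy) _; rewrite add0r.
apply: etrans (esym (usolE (P_global Pp) t0)) _.
exact: (esym (hist_gsol0 (P_global Ppt))).
Qed.

Lemma PiD p s t : P p -> 0 <= s -> 0 <= t ->
  Pi sigma F tau (s + t) p = Pi sigma F tau s (Pi sigma F tau t p).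
Proof.
move=> Pp s0 t0; have [_ _ sD] := flow_sigma.
rewrite /Pi sD; congr pair; apply: segW_inj.
apply: etrans (usolE (P_global Pp) (addr_ge0 s0 t0)) _.
apply: etrans (hist_gsolD Pp s0 t0) _.
exact: (esym (usolE (P_global (Pi_P Pp t0)) s0)).
Qed.

(** * Variational solutions and continuous dependence *)

Local Notation vsol := (@is_variational_solution R r n Omega sigma F tau).

(** [Z] frozen to the left of [- r]: the variational problem fixes [Z] on [- r, +oo[ only, while the
    facts on [hist] ask for continuity everywhere. *)
Definition left_ext (Z : R -> E) (t : R) : E := Z (Num.max (t + r%:num) 0 - r%:num).

Lemma left_extE Z t : - r%:num <= t -> left_ext Z t = Z t.
Proof. by move=> rt; rewrite /left_ext max_l ?addrK// -lerBlDr sub0r. Qed.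

Lemma left_ext_continuous Z : {within `[- r%:num, +oo[, continuous Z} ->
  continuous (left_ext Z).
Proof.
move=> cZ t; set m := fun t : R => Num.max (t + r%:num) 0 - r%:num.
have mr u : `[- r%:num, +oo[%classic (m u).
  by rewrite /= in_itv/= andbT lerBrDr addNr le_max lexx orbT.
have cm : m u @[u --> t] --> m t.
  apply: cvgB; last exact: cvg_cst.
  apply: (@continuous_comp _ _ _ (fun u : R => u + r%:num) (fun u : R => Num.max u 0)).
    by apply: cvgD; [exact: cvg_id|exact: cvg_cst].
  exact: maxr0_continuous.
have /subspace_continuousP/(_ _ (mr t)) h := cZ.
move=> V VZ; have H := cm _ (h V VZ).
by apply: (@filterS _ (nbhs t) _ _ _ _ H) => u /=; apply; exact: mr.
Qed.

Lemma hist_left_ext Z t : 0 <= t -> hst Z t = hst (left_ext Z) t.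
Proof.
move=> t0; rewrite /hist; congr insubd; apply/funext => s; rewrite left_extE//.
have /hist_itvE/andP[rs _] := clamp_itv r s.
by rewrite (le_trans rs)// lerDr.
Qed.

Lemma left_ext_vsol q v Z : vsol q v Z -> vsol q v (left_ext Z).
Proof.
move=> [cZ iZ dZ]; split.
- exact: continuous_subspaceT (left_ext_continuous cZ).
- by move=> s Is; rewrite left_extE ?iZ//; have /hist_itvE/andP[] := Is.
- move=> t t0; rewrite -hist_left_ext//.
  have := dZ t t0; apply: has_rderiv_eq; last by rewrite /= in_itv/= t0.
  move=> u; rewrite /= in_itv/= andbT => u0; rewrite left_extE//.
  by rewrite (le_trans _ u0)// oppr_le0.
Qed.

Local Opaque hist usol gsol.

Lemma rhs_ccvg (J : Type) (G : set_system J) (om_ : J -> Omega) om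
    (y_ : J -> R -> E) y t : Filter G -> om_ @ G --> om ->
  (forall j, continuous (y_ j)) -> continuous y -> (forall s, ccvg G y_ y s) ->
  [/\ sigma js.2 (om_ js.1) @[js --> filter_prod G (nbhs t)] --> sigma t om,
      hst (y_ js.1) js.2 @[js --> filter_prod G (nbhs t)] --> hst y t,
      tau (sigma js.2 (om_ js.1), hst (y_ js.1) js.2) @[js --> filter_prod G (nbhs t)]
        --> tau (sigma t om, hst y t),
      y_ js.1 (js.2 - tau (sigma js.2 (om_ js.1), hst (y_ js.1) js.2))
        @[js --> filter_prod G (nbhs t)] --> y (t - tau (sigma t om, hst y t)) &
      rhs (om_ js.1) (y_ js.1) js.2 @[js --> filter_prod G (nbhs t)] --> rhs om y t].
Proof.
move=> GF omG cy_ cy yG; set H := filter_prod G (nbhs t).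
have HF : Filter H by exact: filter_prod_filter.
have f1 : js.1 @[js --> H] --> G by exact: cvg_fst.
have f2 : js.2 @[js --> H] --> t by exact: cvg_snd.
have c1 : sigma js.2 (om_ js.1) @[js --> H] --> sigma t om.
  by apply: sigma_cvg => //; exact: (@cvg_comp _ _ _ fst om_ H G (nbhs om) f1 omG).
have c2 : hst (y_ js.1) js.2 @[js --> H] --> hst y t by apply: hist_cvg => // s _; exact: yG.
have c3 : tau (sigma js.2 (om_ js.1), hst (y_ js.1) js.2) @[js --> H]
    --> tau (sigma t om, hst y t).
  have [ct _ _ _] := tau_H2.
  apply: (@cvg_comp _ _ _ (fun js => (sigma js.2 (om_ js.1), hst (y_ js.1) js.2)) tau H
    (nbhs (sigma t om, hst y t)) (nbhs (tau (sigma t om, hst y t)))).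
    exact: (cvg_pair c1 c2).
  exact: ct.
have c4 : y_ js.1 (js.2 - tau (sigma js.2 (om_ js.1), hst (y_ js.1) js.2))
        @[js --> H] --> y (t - tau (sigma t om, hst y t)).
  exact: (ccvg_comp GF HF (yG _) f1 (cvgB f2 c3)).
split => //.
have [cF _ _ _ _] := F_H1.
apply: (@cvg_comp _ _ _ (fun js => (sigma js.2 (om_ js.1), y_ js.1 js.2,
    y_ js.1 (js.2 - tau (sigma js.2 (om_ js.1), hst (y_ js.1) js.2)))) F H
    (nbhs (sigma t om, y t, y (t - tau (sigma t om, hst y t)))) (nbhs (rhs om y t))).
  exact: (cvg_pair (cvg_pair c1 (yG t)) c4).
exact: cF.
Qed.

(** Continuous dependence by compactness: pointwise limits [z0] exist along [G] by boundedness, the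
    common Lipschitz bound makes the convergence continuous, the limit is a trajectory over [a.1],
    and uniqueness identifies it with [gsol a]. *)
Lemma gsol_ccvg_traj (J : Type) (G : set_system J) (p : J -> Omega * W) a :
  UltraFilter G -> (forall j, P (p j)) -> P a -> p @ G --> a ->
  forall t, ccvg G (fun j => gsol (p j)) (gsol a) t.
Proof.
move=> GU Pp Pa pa.
have GP : ProperFilter G := @ultra_proper _ _ GU.
have GF : Filter G := @filter_filter _ _ GP.
have [N N0 NP] := traj_lipschitz; have [B B0 BP] := P_bounded.
have pT j := traj_gsol (Pp j); have aT := traj_gsol Pa.
have pom : (p j).1 @[j --> G] --> a.1.
  by apply: (@cvg_comp _ _ _ p fst G (nbhs a)) => //; exact: cvg_fst.
have pW : (p j).2 @[j --> G] --> a.2.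
  by apply: (@cvg_comp _ _ _ p snd G (nbhs a)) => //; exact: cvg_snd.
have pC : segW_segC (p j).2 @[j --> G] --> segW_segC a.2.
  by apply: (@cvg_comp _ _ _ _ (@segW_segC R r n) G (nbhs a.2)) => //; exact: segW_segC_continuous.
have bnd j t : 0 <= t -> `|gsol (p j) t| <= B.
  by move=> t0; apply: (traj_bounded (pT j) BP); rewrite (le_trans _ t0)// oppr_le0.
have /choice[z0 z0P] : forall t : R, exists l : E, 0 <= t -> gsol (p j) t @[j --> G] --> l.
  move=> t; have [t0|t0] := leP 0 t; last by exists 0.
  have [|l _ lP] := ultra_conv GU (@norm_ball_compact R n B) (f := fun j => gsol (p j) t).
    by apply: nearW => j; exact: bnd.
  by exists l.
(* Before time 0 convergence comes from the initial functions in C, after it from the Lipschitz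
   bound; the sum separates the two. *)
pose z t := a.2 t + (z0 (Num.max t 0) - z0 0).
have zcc t : ccvg G (fun j => gsol (p j)) z t.
  rewrite /ccvg; under eq_fun do rewrite (gsol_split (P_global (Pp _))).
  apply: cvgD; first exact: (ccvg_of_segC GF pC (@segC_total_continuous a.2)).
  have f1 : js.1 @[js --> filter_prod G (nbhs t)] --> G by exact: cvg_fst.
  apply: cvgB; last first.
    exact: (@cvg_comp _ _ _ fst (fun j => gsol (p j) 0) _ G (nbhs (z0 0)) f1 (z0P 0 (lexx 0))).
  apply: (@ccvg_lipschitz _ _ _ G (fun j s => gsol (p j) (Num.max s 0))
      (fun s => z0 (Num.max s 0)) N 1 t) => //.
    move=> j s _; apply: le_trans ((NP _ _ (pT j)).2 _ _ _ _) _.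
    - by rewrite le_max lexx orbT.
    - by rewrite le_max lexx orbT.
    - by rewrite ler_pM2l// maxr0_dist.
  by apply: z0P; rewrite le_max lexx orbT.
have cz : continuous z := ccvg_continuous GP zcc.
have cp j : continuous (gsol (p j)) := gsol_continuous (P_global (Pp j)).
have rcc t := @rhs_ccvg J G _ _ _ _ t GF pom cp cz zcc.
have zT : traj a.1 z.
  split => // t t0.
    have [|b Pb pb] := ultra_conv GU P_compact (f := fun j => Pi sigma F tau t (p j)).
      by apply: nearW => j; exact: Pi_P.
    have b1 : sigma t a.1 = b.1.
      apply: (cvg_ultra_unique (metric_hausdorff (T := Omega)) GP (f := fun j => sigma t (p j).1)).
        by apply: sigma_cvg => //; exact: cvg_cst.
      by apply: (@cvg_comp _ _ _ _ fst G (nbhs b) _ pb); exact: cvg_fst.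
    exists b.2; first by rewrite b1 -surjective_pairing.
    apply: (cvg_ultra_unique (@norm_hausdorff _ C) GP (f := fun j => hst (gsol (p j)) t)).
      have h : segW_segC (usol sigma F tau t (p j)) @[j --> G] --> segW_segC b.2.
        apply: (@cvg_comp _ _ _ (fun j => Pi sigma F tau t (p j)) (fun q => segW_segC q.2) G (nbhs b) _ pb).
        apply: (@cvg_comp _ _ _ snd (@segW_segC R r n) (nbhs b) (nbhs b.2)); first exact: cvg_snd.
        exact: segW_segC_continuous.
      by under eq_fun do rewrite -(usolE (P_global (Pp _)) t0).
    have [_ c2 _ _ _] := rcc t.
    apply: (@cvg_comp _ _ _ (fun j => (j, t)) _ G (filter_prod G (nbhs t)) _ _ c2).
    exact: (cvg_pair cvg_id (cvg_cst t)).
  apply: (@rderiv_limit _ _ J G (fun j => gsol (p j)) (fun j => rhs (p j).1 (gsol (p j)))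
    z (rhs a.1 z) 0) => //.
  - by move=> j s s0; have [_ _] := pT j; apply.
  - by move=> s s0; exact: (ccvg_pointwise GF (zcc s)).
  - move=> s s0; have [_ _ _ _ c5] := rcc s.
    exact: cvg_prod_within.
have zE : z = gsol a.
  have h0 : hst z 0 = hst (gsol a) 0.
    rewrite (hist_gsol0 (P_global Pa)); apply: segCP => s; rewrite inE => Is.
    rewrite hist_in// add0r /z; have /hist_itvE/andP[_ s0] := Is.
    by rewrite max_r// subrr addr0.
  have zt t : 0 <= t -> z t = gsol a t.
    move=> t0; have := traj_unique zT aT h0 t0 => /(congr1 (fun x : C => x 0)).
    have I0 : I 0 by apply/hist_itvE; rewrite lexx oppr_le0 andbT.
    rewrite !hist_in ?addr0//.
    by case: aT.
  have z00 : z 0 = a.2 0 by rewrite /z max_l// subrr addr0.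
  apply/funext => t; rewrite (gsol_split (P_global Pa)).
  have m0 : 0 <= Num.max t 0 by rewrite le_max lexx orbT.
  rewrite -(zt _ (lexx 0)) -(zt _ m0) z00 [LHS]/z; congr (_ + _).
  rewrite [in RHS]/z (max_l m0) -(segC_clamp a.2 (Num.max t 0)) /clamp (min_r m0).
  by rewrite (@max_r _ _ (- r%:num)) ?oppr_le0// [in RHS]addrC addKr.
by move=> t; rewrite -zE.
Qed.

(** The equation controls histories in C; a limit in W is supplied by compactness of [P] and
    recognized from its image in C. *)
Lemma Pi_ultra (J : Type) (G : set_system J) (s : J -> R) (p : J -> Omega * W) (t : R) a :
  UltraFilter G -> (forall j, 0 <= s j) -> (forall j, P (p j)) -> 0 <= t -> P a ->
  s @ G --> t -> p @ G --> a ->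
  Pi sigma F tau (s j) (p j) @[j --> G] --> Pi sigma F tau t a.
Proof.
move=> GU s0 Pp t0 Pa st pa.
have GP : ProperFilter G := @ultra_proper _ _ GU.
have GF : Filter G := @filter_filter _ _ GP.
have [|b Pb pb] := ultra_conv GU P_compact (f := fun j => Pi sigma F tau (s j) (p j)).
  by apply: nearW => j; exact: Pi_P.
suff -> : Pi sigma F tau t a = b by [].
have pom : (p j).1 @[j --> G] --> a.1.
  by apply: (@cvg_comp _ _ _ p fst G (nbhs a)) => //; exact: cvg_fst.
have b1 : sigma t a.1 = b.1.
  apply: (cvg_ultra_unique (metric_hausdorff (T := Omega)) GP (f := fun j => sigma (s j) (p j).1)).
    exact: sigma_cvg.
  by apply: (@cvg_comp _ _ _ _ fst G (nbhs b) _ pb); exact: cvg_fst.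
have cp j : continuous (gsol (p j)) := gsol_continuous (P_global (Pp j)).
have [_ c2 _ _ _] := @rhs_ccvg J G _ _ _ _ t GF pom cp (gsol_continuous (P_global Pa))
  (gsol_ccvg_traj GU Pp Pa pa).
rewrite [RHS]surjective_pairing -b1 /Pi; congr pair; apply: segW_inj.
apply: etrans (usolE (P_global Pa) t0) _.
apply: (cvg_ultra_unique (@norm_hausdorff _ C) GP (f := fun j => hst (gsol (p j)) (s j))).
  apply: (@cvg_comp _ _ _ (fun j => (j, s j)) _ G (filter_prod G (nbhs t)) _ _ c2).
  exact: (cvg_pair cvg_id st).
have h : segW_segC (usol sigma F tau (s j) (p j)) @[j --> G] --> segW_segC b.2.
  apply: (@cvg_comp _ _ _ (fun j => Pi sigma F tau (s j) (p j)) (fun q => segW_segC q.2) G (nbhs b) _ pb).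
  apply: (@cvg_comp _ _ _ snd (@segW_segC R r n) (nbhs b) (nbhs b.2)); first exact: cvg_snd.
  exact: segW_segC_continuous.
rewrite (_ : (fun j => _) = fun j => segW_segC (usol sigma F tau (s j) (p j)))//.
by apply/funext => j; rewrite (usolE (P_global (Pp j)) (s0 j)).
Qed.

(** A [lim] is determined only along a proper filter. A small step stays in [- r, 0]: to the left
    unless [s] is the left endpoint, and then to the right. *)
Lemma hist_itv_rderiv_proper s : I s -> ProperFilter (within [set h | I (s + h)] 0^').
Proof.
move=> /hist_itvE/andP[rs s0]; apply: Build_ProperFilter_ex => B.
move=> BF; have : nbhs 0 (fun h : R => h != 0 -> I (s + h) -> B h) := BF.
move=> /nbhs_ballP[d /= d0 dB].
have r0 : 0 < r%:num by [].
have d2 : 0 < d / 2 by rewrite divr_gt0.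
have dd : d / 2 < d by rewrite ltr_pdivrMr// mulr_natr mulr2n ltrDl.
have [ls|sl] := ltP (- r%:num) s.
  pose h := Num.min (d / 2) (s + r%:num).
  have h0 : 0 < h by rewrite lt_min d2 -ltrBlDr sub0r.
  have hd : h <= d / 2 by rewrite ge_min lexx.
  have hs : h <= s + r%:num by rewrite ge_min lexx orbT.
  exists (- h); apply: dB.
  - by rewrite /ball/= sub0r opprK ger0_norm ?ltW// (le_lt_trans hd).
  - by rewrite oppr_eq0 gt_eqF.
  - by apply/hist_itvE/andP; split; lra.
pose h := Num.min (d / 2) r%:num.
have h0 : 0 < h by rewrite lt_min d2.
have hd : h <= d / 2 by rewrite ge_min lexx.
have hs : h <= r%:num by rewrite ge_min lexx orbT.
exists h; apply: dB.
- by rewrite /ball/= sub0r normrN ger0_norm ?ltW// (le_lt_trans hd).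
- by rewrite gt_eqF.
- by apply/hist_itvE/andP; split; lra.
Qed.

(** After one delay the whole history lies where the equation holds, so its derivative exists
    everywhere and not just almost everywhere. *)
Lemma segW_deriv_usol p t s : P p -> r%:num <= t -> I s ->
  segW_deriv (usol sigma F tau t p) s = rhs p.1 (gsol p) (t + s).
Proof.
move=> Pp rt Is; have pg := P_global Pp; have cy := gsol_continuous pg.
have t0 : 0 <= t by rewrite (le_trans _ rt).
have /hist_itvE/andP[rs s0] := Is.
have PF := hist_itv_rderiv_proper Is.
apply: cvg_lim; first exact: norm_hausdorff.
have ts : 0 <= t + s by lra.
have := gsol_rderiv pg ts.
rewrite [X in has_rderiv _ _ X _]addrC => /has_rderiv_shift H.
suff : has_rderiv I (usol sigma F tau t p) s (rhs p.1 (gsol p) (t + s)) by [].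
apply: (has_rderiv_eq (f := fun u => gsol p (u + t))) => //.
  by move=> u Iu; rewrite (usolE pg t0) hist_in// addrC.
apply: has_rderivW H => u /hist_itvE/andP[ru u0].
by rewrite /= in_itv/= andbT; lra.
Qed.

(** Replaces [w] by its linearization [c] in a quotient by [e]: the error is small relative to [nn],
    and [nn / e] stays bounded. *)
Lemma scaled_limit (V : normedModType R) (L : Type) (H : set_system L) (e nn : L -> R)
    (w c : L -> V) (c0 : V) (K : R) : Filter H -> (forall l, 0 < e l) ->
  (forall eta, 0 < eta -> \forall l \near H, `|w l - c l| <= eta * nn l) ->
  (\forall l \near H, (e l)^-1 * nn l <= K) ->
  (e l)^-1 *: c l @[l --> H] --> c0 -> (e l)^-1 *: w l @[l --> H] --> c0.
Proof.
move=> HF e0 wc nK cc; apply/cvgrPdist_le => d d0.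
have d20 : 0 < d / 2 by rewrite divr_gt0.
have K0 : 0 < `|K| + 1 by rewrite ltr_wpDl.
have eta0 : 0 < d / 2 / (`|K| + 1) by rewrite divr_gt0.
have /cvgrPdist_le/(_ _ d20) h1 := cc.
apply: filterS3 h1 (wc _ eta0) nK => l h1 h2 h3.
rewrite (splitr d); apply: le_trans (ler_distD ((e l)^-1 *: c l) _ _) _.
apply: lerD => //; rewrite -scalerBr normrZ gtr0_norm ?invr_gt0// distrC.
have ei : 0 <= (e l)^-1 by rewrite invr_ge0 ltW.
apply: le_trans (ler_wpM2l ei h2) _.
rewrite mulrCA -[leRHS](divfK (lt0r_neq0 K0)); apply: ler_wpM2l; first exact: ltW.
by apply: le_trans h3 (le_trans (ler_norm K) _); rewrite lerDl.
Qed.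

Lemma cvg_norm_bounded (V : normedModType R) (L : Type) (H : set_system L) (w : L -> V) c :
  Filter H -> w @ H --> c -> \forall l \near H, `|w l| <= `|c| + 1.
Proof.
have lt1 : `|c| < `|c| + 1 by rewrite ltrDl.
by move=> HF wc; exact: (cvgr_le _ (cvg_norm wc) _ lt1).
Qed.

Lemma between_dist (u v x c d : R) : `|c - u| < d -> `|c - v| < d ->
  Num.min u v <= x -> x <= Num.max u v -> `|c - x| < d.
Proof.
rewrite !ltr_norml => /andP[u1 u2] /andP[v1 v2].
by rewrite ge_min le_max => /orP[?|?] /orP[?|?]; apply/andP; split; lra.
Qed.

Lemma mean_value_rderiv_sym (V : normedModType R) (f g : R -> V) (a0 u v : R) (c : V) (eta : R) :
  a0 <= u -> a0 <= v -> continuous f ->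
  (forall t, a0 <= t -> has_rderiv `[a0, +oo[ f t (g t)) ->
  (forall t, Num.min u v <= t <= Num.max u v -> `|g t - c| <= eta) ->
  `|f u - f v - (u - v) *: c| <= eta * `|u - v|.
Proof.
move=> au av cf fg gc.
have H x y : a0 <= x -> x <= y -> (forall t, x <= t <= y -> `|g t - c| <= eta) ->
    `|f y - f x - (y - x) *: c| <= eta * (y - x).
  move=> ax xy gxy; apply: (mean_value_rderiv ax xy cf) => t /andP[xt ty].
    by apply: fg; rewrite (le_trans ax).
  by apply: gxy; rewrite xt ltW.
have [uv|vu] := leP u v.
  have -> : f u - f v - (u - v) *: c = - (f v - f u - (v - u) *: c).
    by rewrite !opprB -scaleNr opprB addrC addrA addrAC -addrA; congr (_ + _); rewrite addrC.
  rewrite normrN (distrC u v) (ger0_norm (_ : 0 <= v - u)) ?subr_ge0//; apply: H => // t.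
  by move=> tuv; apply: gc; rewrite (min_l uv) (max_r uv).
rewrite (ger0_norm (_ : 0 <= u - v)); last by rewrite subr_ge0 ltW.
apply: H => //; first exact: ltW.
by move=> t tuv; apply: gc; rewrite (min_r (ltW vu)) (max_l (ltW vu)).
Qed.

Lemma D3F_linear om x y u c v :
  D3F F om x y (u + c *: v) = D3F F om x y u + c *: D3F F om x y v.
Proof. by rewrite addrC [RHS]addrC; exact: linearP. Qed.

Lemma D2F_lim (L : Type) (H : set_system L) (u : L -> E) (u0 : E) om x y : Filter H ->
  u @ H --> u0 -> D2F F om x y (u l) @[l --> H] --> D2F F om x y u0.
Proof.
move=> HF uH; have [_ d2 _ _ _] := F_H1.
apply: (@cvg_comp _ _ _ u (D2F F om x y) H (nbhs u0)) => //.
exact: (diff_continuous (d2 om x y)).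
Qed.

Lemma D3F_lim (L : Type) (H : set_system L) (u : L -> E) (u0 : E) om x y : Filter H ->
  u @ H --> u0 -> D3F F om x y (u l) @[l --> H] --> D3F F om x y u0.
Proof.
move=> HF uH; have [_ _ d3 _ _] := F_H1.
apply: (@cvg_comp _ _ _ u (D3F F om x y) H (nbhs u0)) => //.
exact: (diff_continuous (d3 om x y)).
Qed.

Lemma D2tau_lim (L : Type) (H : set_system L) (u : L -> C) (u0 : C) om x : Filter H ->
  u @ H --> u0 -> D2tau tau om x (u l) @[l --> H] --> D2tau tau om x u0.
Proof.
move=> HF uH; have [_ dt _ _] := tau_H2.
apply: (@cvg_comp _ _ _ u (D2tau tau om x) H (nbhs u0)) => //.
exact: (diff_continuous (dt om x)).
Qed.

(** * Normalized differences of trajectories *)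

Section difference_quotient.
Variables (J : Type) (G : set_system J) (p q : J -> Omega * W) (a : Omega * W).
Variables (e : J -> R) (z : R -> E).
Hypotheses (GU : UltraFilter G) (Pp : forall j, P (p j)) (Pq : forall j, P (q j))
  (pq : forall j, (p j).1 = (q j).1) (Pa : P a) (pa : p @ G --> a) (qa : q @ G --> a)
  (e_gt0 : forall j, 0 < e j).

(** Freezing before time 0 discards the initial difference, whose Lipschitz constant after division
    by [e j] is not under control; in exchange the history of [z_ j] is the quotient of the
    histories only from time [r] on. *)
Let z_ (j : J) (t : R) : E := (e j)^-1 *: (gsol (p j) (Num.max t 0) - gsol (q j) (Num.max t 0)).
Hypothesis zG : forall t, ccvg G z_ z t.

Let GP : ProperFilter G := @ultra_proper _ _ GU.
Let GF : Filter G := @filter_filter _ _ GP.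

Lemma quotient_continuous j : continuous (z_ j).
Proof.
have c0 k : P k -> continuous (fun t : R => gsol k (Num.max t 0)).
  move=> Pk t; apply: (@continuous_comp _ _ _ (fun t : R => Num.max t 0) (gsol k)).
    exact: maxr0_continuous.
  exact: (gsol_continuous (P_global Pk)).
move=> t; apply: cvgZ; first exact: cvg_cst.
by apply: cvgB; apply: c0.
Qed.

Lemma quotient_hist j t : r%:num <= t ->
  hst (z_ j) t = (e j)^-1 *: (hst (gsol (p j)) t - hst (gsol (q j)) t).
Proof.
move=> rt; have cp := gsol_continuous (P_global (Pp j)).
have cq := gsol_continuous (P_global (Pq j)).
apply: segCP => s; rewrite inE => Is; have /hist_itvE/andP[rs s0] := Is.
have cz : continuous (z_ j) := @quotient_continuous j.
rewrite [LHS]hist_in//.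
rewrite -[RHS]/((e j)^-1 *: (hst (gsol (p j)) t s - hst (gsol (q j)) t s)).
have ts : 0 <= t + s by lra.
rewrite /z_ (max_l ts); congr (_ *: (_ - _)).
  exact: esym (hist_in t cp Is).
exact: esym (hist_in t cq Is).
Qed.

Lemma quotient_rderiv j t : 0 <= t -> has_rderiv `[0, +oo[ (z_ j) t
  ((e j)^-1 *: (rhs (p j).1 (gsol (p j)) t - rhs (q j).1 (gsol (q j)) t)).
Proof.
move=> t0; have [_ _ dp] := traj_gsol (Pp j); have [_ _ dq] := traj_gsol (Pq j).
have := @has_rderivZ _ _ _ _ (e j)^-1 _ _ (has_rderivB (dp t t0) (dq t t0)).
apply: has_rderiv_eq; last by rewrite /= in_itv/= t0.
by move=> u; rewrite /= in_itv/= andbT => u0; rewrite /z_ max_l.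
Qed.

(** The chain rule through the state-dependent delay, carried out on quotients. Starting at [r]
    keeps the delayed times nonnegative, where [z_] is the true quotient and the equation holds. *)
Lemma quotient_limit t : r%:num <= t ->
  (e js.1)^-1 *: (rhs (p js.1).1 (gsol (p js.1)) js.2 - rhs (q js.1).1 (gsol (q js.1)) js.2)
    @[js --> filter_prod G (within `[r%:num, +oo[ (nbhs t))]
  --> linop F tau (Pi sigma F tau t a) (hst z t).
Proof.
move=> rt; set H := filter_prod G _.
have HF : Filter H by exact: filter_prod_filter.
have t0 : 0 <= t by rewrite (le_trans _ rt).
have cp j : continuous (gsol (p j)) := gsol_continuous (P_global (Pp j)).
have cq j : continuous (gsol (q j)) := gsol_continuous (P_global (Pq j)).
have ca : continuous (gsol a) := gsol_continuous (P_global Pa).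
have pom : (p j).1 @[j --> G] --> a.1.
  by apply: (@cvg_comp _ _ _ p fst G (nbhs a)) => //; exact: cvg_fst.
have qom : (q j).1 @[j --> G] --> a.1.
  by apply: (@cvg_comp _ _ _ q fst G (nbhs a)) => //; exact: cvg_fst.
have pcc := gsol_ccvg_traj GU Pp Pa pa; have qcc := gsol_ccvg_traj GU Pq Pa qa.
have pR s := @rhs_ccvg J G _ _ _ _ s GF qom cp ca pcc.
have qR s := @rhs_ccvg J G _ _ _ _ s GF qom cq ca qcc.
have zc : continuous z := ccvg_continuous GP zG.
have z_c j : continuous (z_ j) := @quotient_continuous j.
under eq_fun do rewrite pq.
pose en (js : J * R) := e js.1; have en0 js : 0 < en js by exact: e_gt0.
have near_r : \forall js \near H, r%:num <= js.2.
  exists (setT, `[r%:num, +oo[%classic).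
    by split => /=; [exact: filterT|exact: withinT].
  by move=> js [_]; rewrite /= in_itv/= andbT.
have f1 : js.1 @[js --> H] --> G by exact: cvg_fst.
pose om (js : J * R) := sigma js.2 (q js.1).1.
pose x1 (js : J * R) := hst (gsol (p js.1)) js.2.
pose x2 (js : J * R) := hst (gsol (q js.1)) js.2.
pose a1 (js : J * R) := gsol (p js.1) js.2.
pose a2 (js : J * R) := gsol (q js.1) js.2.
pose t1 js := tau (om js, x1 js); pose t2 js := tau (om js, x2 js).
pose d1 (js : J * R) := js.2 - t1 js; pose d2 (js : J * R) := js.2 - t2 js.
pose b1 js := gsol (p js.1) (d1 js); pose b2 js := gsol (q js.1) (d2 js).
pose om0 := sigma t a.1; pose x0 := hst (gsol a) t; pose T0 := tau (om0, x0).
pose D := t - T0.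
have [h1 h2 h3 h4 _] := pR t; have [_ k2 k3 k4 _] := qR t.
have com : om @ H --> om0 by apply: cvg_prod_within; exact: h1.
have cx1 : x1 @ H --> x0 by apply: cvg_prod_within; exact: h2.
have cx2 : x2 @ H --> x0 by apply: cvg_prod_within; exact: k2.
have ct1 : t1 @ H --> T0 by apply: cvg_prod_within; exact: h3.
have ct2 : t2 @ H --> T0 by apply: cvg_prod_within; exact: k3.
have cb1 : b1 @ H --> gsol a D by apply: cvg_prod_within; exact: h4.
have cb2 : b2 @ H --> gsol a D by apply: cvg_prod_within; exact: k4.
have ca1 : a1 @ H --> gsol a t by apply: cvg_prod_within; exact: (pcc t).
have ca2 : a2 @ H --> gsol a t by apply: cvg_prod_within; exact: (qcc t).
have cs : js.2 @[js --> H] --> t by apply: cvg_prod_within; exact: cvg_snd.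
have cd1 : d1 @ H --> D by exact: (cvgB cs ct1).
have cd2 : d2 @ H --> D by exact: (cvgB cs ct2).
have d_ge0 (tt : R) (js : J * R) : r%:num <= js.2 -> tt <= r%:num -> 0 <= js.2 - tt.
  by move=> rs tr; rewrite subr_ge0 (le_trans tr).
have tr q' : tau q' <= r%:num by have /andP[] := tau_bounds q'.
have qa1 : (en js)^-1 *: (a1 js - a2 js) @[js --> H] --> z t.
  have zt : z_ js.1 js.2 @[js --> H] --> z t by apply: cvg_prod_within; exact: (@zG t).
  apply: cvg_trans zt; apply: near_eq_cvg.
  apply: filterS near_r => js rs; rewrite /z_ max_l//.
  by rewrite (le_trans _ rs).
have qx : (en js)^-1 *: (x1 js - x2 js) @[js --> H] --> hst z t.
  have zz : hst (z_ js.1) js.2 @[js --> filter_prod G (nbhs t)] --> hst z t.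
    exact: (@hist_cvg R r n J G z_ z t GF z_c zc (fun s _ => @zG s)).
  have zz' : hst (z_ js.1) js.2 @[js --> H] --> hst z t by apply: cvg_prod_within; exact: zz.
  apply: cvg_trans zz'; apply: near_eq_cvg.
  by apply: filterS near_r => js rs; exact: quotient_hist.
pose DT := D2tau tau om0 x0 (hst z t).
(* Strict differentiability of [tau] reduces the quotient of the delays to [D2tau] applied to the
   quotient of the histories. *)
have qt : (en js)^-1 * (t1 js - t2 js) @[js --> H] --> DT.
  apply: (scaled_limit (V := R^o) (nn := fun js => `|x1 js - x2 js|)
    (c := fun js => D2tau tau om0 x0 (x1 js - x2 js)) (K := `|hst z t| + 1) HF en0).
  - exact: (tau_strict tau_H2 HF com cx1 cx2).
  - have := cvg_norm_bounded HF qx; apply: filterS => js.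
    by rewrite normrZ gtr0_norm ?invr_gt0.
  - have := @D2tau_lim _ H _ _ om0 x0 HF qx; under eq_fun do rewrite D2tauZ.
    exact.
pose Y' := rhs a.1 (gsol a) D.
(* The delayed values differ by a difference at the common time [d1], which yields [z D], and by an
   increment of the second solution between [d2] and [d1], which yields the term in [Y']. *)
have qb : (en js)^-1 *: (b1 js - b2 js) @[js --> H] --> z D + (- DT) *: Y'.
  have -> : (fun js => (en js)^-1 *: (b1 js - b2 js)) = (fun js =>
      (en js)^-1 *: (gsol (p js.1) (d1 js) - gsol (q js.1) (d1 js))
      + (en js)^-1 *: (gsol (q js.1) (d1 js) - gsol (q js.1) (d2 js))).
    by apply/funext => js; rewrite -scalerDr addrA subrK.
  apply: cvgD.
    apply: cvg_trans (ccvg_comp GF HF (@zG D) f1 cd1); apply: near_eq_cvg.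
    apply: filterS near_r => js rs; rewrite /z_ max_l//.
    by apply: d_ge0 => //; exact: tr.
  apply: (scaled_limit (nn := fun js => `|d1 js - d2 js|)
    (c := fun js => (d1 js - d2 js) *: Y') (K := `|- DT| + 1) HF en0).
  (* Near time [D] the derivatives of the solutions from [q] are close to [Y'], uniformly in the
     index; this replaces differentiability of each solution at [D]. *)
  - move=> eta eta0; have [_ _ _ _ R5] := qR D.
    have /cvgrPdist_le/(_ _ eta0)[[A B] [/= GA DB] AB] := R5.
    move: DB => /nbhs_ballP[d /= d0 dB].
    have near_A : \forall js \near H, A js.1 by exact: (f1 _ GA).
    have /cvgrPdist_lt/(_ _ d0) n1 := cd1.
    have /cvgrPdist_lt/(_ _ d0) n2 := cd2.
    apply: filterS (filterI near_A (filterI near_r (filterI n1 n2))) => js [Aj [rs [m1 m2]]].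
    have [_ _ qd] := traj_gsol (Pq js.1).
    apply: (mean_value_rderiv_sym (a0 := 0) _ _ (@cq js.1) qd).
    + by apply: d_ge0 => //; exact: tr.
    + by apply: d_ge0 => //; exact: tr.
    move=> u /andP[mu uM]; rewrite distrC; apply: (AB (js.1, u)); split => //=.
    by apply: dB; apply: between_dist m1 m2 _ _.
  - have : (en js)^-1 * (d1 js - d2 js) @[js --> H] --> (- DT : R^o).
      have -> : (fun js => (en js)^-1 * (d1 js - d2 js)) =
          (fun js => - ((en js)^-1 * (t1 js - t2 js))).
        by apply/funext => js; rewrite /d1 /d2; ring.
      exact: cvgN.
    move=> qd; have := cvg_norm_bounded (V := R^o) HF qd; apply: filterS => js.
    by rewrite normrM gtr0_norm ?invr_gt0.
  - under eq_fun do rewrite scalerA; apply: cvgZr_tmp.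
    have -> : (fun js => (en js)^-1 * (d1 js - d2 js)) =
        (fun js => - ((en js)^-1 * (t1 js - t2 js))).
      by apply/funext => js; rewrite /d1 /d2; ring.
    exact: cvgN.
have qF : (en js)^-1 *: (F (om js, a1 js, b1 js) - F (om js, a2 js, b2 js)) @[js --> H] -->
    D2F F om0 (gsol a t) (gsol a D) (z t)
    + D3F F om0 (gsol a t) (gsol a D) (z D + (- DT) *: Y').
  apply: (scaled_limit (nn := fun js => `|a1 js - a2 js| + `|b1 js - b2 js|)
    (c := fun js => D2F F om0 (gsol a t) (gsol a D) (a1 js - a2 js)
      + D3F F om0 (gsol a t) (gsol a D) (b1 js - b2 js))
    (K := `|z t| + 1 + (`|z D + (- DT) *: Y'| + 1)) HF en0).
  - exact: (F_strict F_H1 HF com ca1 ca2 cb1 cb2).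
  - apply: filterS2 (cvg_norm_bounded HF qa1) (cvg_norm_bounded HF qb) => js.
    rewrite !normrZ !gtr0_norm ?invr_gt0// mulrDr; exact: lerD.
  - under eq_fun do rewrite scalerDr.
    apply: cvgD.
      have := @D2F_lim _ H _ _ om0 (gsol a t) (gsol a D) HF qa1.
      by under eq_fun do rewrite /D2F linearZ.
    have := @D3F_lim _ H _ _ om0 (gsol a t) (gsol a D) HF qb.
    by under eq_fun do rewrite /D3F linearZ.
(* What remains is to read off the entries of [linop]; [Y'] is the derivative of the state at [- T0]
   because [t] is at least [r]. *)
suff -> : linop F tau (Pi sigma F tau t a) (hst z t) =
    D2F F om0 (gsol a t) (gsol a D) (z t)
    + D3F F om0 (gsol a t) (gsol a D) (z D + (- DT) *: Y') by exact: qF.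
have I0 : I 0 by apply/hist_itvE; rewrite lexx oppr_le0 andbT.
have T00 : 0 <= T0 by have /andP[] := tau_bounds (om0, x0).
have IT : I (- T0) by apply/hist_itvE; rewrite lerN2 oppr_le0 T00 andbT; exact: tr.
have xE : segW_segC (usol sigma F tau t a) = x0 := usolE (P_global Pa) t0.
have e1 : x0 0 = gsol a t by rewrite /x0 (hist_in t ca I0) addr0.
have e2 : x0 (- T0) = gsol a D by rewrite /x0 (hist_in t ca IT).
have e3 : hst z t 0 = z t by rewrite (hist_in t zc I0) addr0.
have e4 : hst z t (- T0) = z D by rewrite (hist_in t zc IT).
have e5 : segW_deriv (usol sigma F tau t a) (- T0) = Y' := segW_deriv_usol Pa rt IT.
rewrite /linop /Pi xE -/om0 -/T0 e1 e2 e3 e4 e5 -/DT D3F_linear scaleNr.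
by rewrite addrA.
Qed.

End difference_quotient.

Lemma gsolD p c t : P p -> 0 <= c -> - r%:num <= t ->
  gsol (Pi sigma F tau c p) t = gsol p (t + c).
Proof.
move=> Pp c0 rt; have m0 : 0 <= Num.max t 0 by rewrite le_max lexx orbT.
have tm : t <= Num.max t 0 by rewrite le_max lexx.
have Im : I (t - Num.max t 0).
  apply/hist_itvE; rewrite subr_le0 tm andbT lerBrDr.
  by have [t0|t0] := leP t 0; [rewrite addr0|rewrite gerDr oppr_le0].
have cp := gsol_continuous (P_global Pp); have cc := gsol_continuous (P_global (Pi_P Pp c0)).
have E := etrans (esym (hist_in (Num.max t 0 + c) cp Im)) (etrans
  (congr1 (fun x : C => x (t - Num.max t 0)) (hist_gsolD Pp m0 c0))
  (hist_in (Num.max t 0) cc Im)).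
have e1 : Num.max t 0 + c + (t - Num.max t 0) = t + c by ring.
have e2 : Num.max t 0 + (t - Num.max t 0) = t by ring.
rewrite e1 e2 in E; exact: esym E.
Qed.

Lemma linopB q (u v : C) : linop F tau q (u - v) = linop F tau q u - linop F tau q v.
Proof.
case: q => om x; rewrite /linop D2tauB.
set d := tau _; set D2 := D2F _ _ _ _; set D3 := D3F _ _ _ _.
have L2 w1 w2 : D2 (w1 - w2) = D2 w1 - D2 w2 by exact: linearB.
have L3 w1 w2 : D3 (w1 - w2) = D3 w1 - D3 w2 by exact: linearB.
rewrite -[(u - v) 0]/(u 0 - v 0) -[(u - v) (- d)]/(u (- d) - v (- d)) L2 L3 scalerBl.
by rewrite [X in X - _ = _]addrACA -opprD subrACA.
Qed.

(** * Uniform bounds on sets that extend backwards *)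

Section backward_extension.
Variable M : set (Omega * W).
Hypotheses (sMP : M `<=` P)
  (M_onto : forall q, M q -> exists2 q', M q' & Pi sigma F tau r%:num q' = q).

(** Points of [M] are states reached after time [r], so the Lipschitz bound for nonnegative times
    reaches back to [- r], with one constant for all of [M]. *)
Lemma M_lipschitz : exists2 N, 0 < N & forall q, M q ->
  forall s t, - r%:num <= s -> - r%:num <= t -> `|gsol q s - gsol q t| <= N * `|s - t|.
Proof.
have [N N0 NP] := traj_lipschitz; exists N => // q Mq s t rs rt.
have [q' Mq' <-] := M_onto Mq; have Pq' := sMP Mq'.
have r0 : 0 <= r%:num by [].
rewrite (gsolD Pq' r0 rs) (gsolD Pq' r0 rt).
have -> : s - t = (s + r%:num) - (t + r%:num) by ring.
by apply: (NP _ _ (traj_gsol Pq')).2; rewrite -lerBlDr sub0r.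
Qed.

(** The delicate term contains the derivative of [x], bounded by [N] because [x] is itself a state
    at time [r] of a solution in [M]. *)
Lemma linop_bounded : exists2 c, 0 < c &
  forall q u, M q -> `|linop F tau q u| <= c * `|u|.
Proof.
have [N N0 NP] := traj_lipschitz; have [B B0 BP] := P_bounded.
have [K K0 KP] := F_partials_bounded B; have [L L0 [_ LP]] := tau_lipschitz.
exists (K + K + L * (K * N)); first by rewrite !addr_gt0// mulr_gt0// mulr_gt0.
move=> q u Mq; have [q' Mq' qE] := M_onto Mq; have Pq' := sMP Mq'; have Pq := sMP Mq.
case: q Mq qE Pq => om x Mq qE Pq; rewrite /linop.
have ix : inP om x by exists x.
have xB s : `|segW_segC x s| <= B.
  by apply: le_trans (BP _ _ ix); exact: segC_norm_ub.
set d := tau _.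
have Id : I (- d).
  have /andP[d0 dr] := tau_bounds (om, segW_segC x).
  by apply/hist_itvE; rewrite lerN2 dr oppr_le0.
have xE : x = usol sigma F tau r%:num q' by move: qE => [_ <-].
have dB : `|segW_deriv x (- d)| <= N.
  rewrite xE (segW_deriv_usol Pq' (lexx _) Id); apply: (NP _ _ (traj_gsol Pq')).1.
  by have /hist_itvE/andP[] := Id; rewrite subr_ge0 lerN2.
have KN := KP om _ _ (xB 0) (xB (- d)).
have uB s : `|u s| <= `|u| by exact: segC_norm_ub.
apply: le_trans (ler_normB _ _) _; rewrite [leRHS]mulrDl; apply: lerD.
  apply: le_trans (ler_normD _ _) _; rewrite mulrDl; apply: lerD.
    by apply: le_trans (KN _).1 _; rewrite ler_pM2l.
  by apply: le_trans (KN _).2 _; rewrite ler_pM2l.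
rewrite normrZ mulrAC; apply: ler_pM => //; first exact: LP.
by apply: le_trans (KN _).2 _; rewrite ler_pM2l.
Qed.

End backward_extension.

Lemma hist_segW (y : R -> E) t L : continuous y ->
  (forall s u, t - r%:num <= s <= t -> t - r%:num <= u <= t -> `|y s - y u| <= L * `|s - u|) ->
  hst y t \in @segW_pred R r n.
Proof.
move=> cy yL; apply/segW_predP; exists `|L| => s u.
have H w : t - r%:num <= t + clamp r w <= t.
  by have /hist_itvE/andP[? ?] := clamp_itv r w; rewrite lerD2l gerDl; apply/andP.
rewrite (histE r t s cy) (histE r t u cy); apply: le_trans (yL _ _ (H s) (H u)) _.
have -> : t + clamp r s - (t + clamp r u) = clamp r s - clamp r u by ring.
apply: le_trans (ler_wpM2r (normr_ge0 _) (ler_norm L)) _.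
by rewrite ler_wpM2l// clamp_dist.
Qed.

Definition dC (p q : Omega * W) : R := `|segW_segC p.2 - segW_segC q.2|.

Lemma dC_Pi p q t : P p -> P q -> 0 <= t ->
  dC (Pi sigma F tau t p) (Pi sigma F tau t q) = `|hst (gsol p) t - hst (gsol q) t|.
Proof.
move=> Pp Pq t0; rewrite /dC /Pi /=; congr (`|_ - _|).
  exact: (usolE (P_global Pp) t0).
exact: (usolE (P_global Pq) t0).
Qed.

Lemma dC_eq p q : p.1 = q.1 -> dC p q = 0 -> p = q.
Proof.
move: p q => [om x] [om' y] /= -> /eqP; rewrite normr_eq0 subr_eq0 => /eqP xy.
by congr pair; exact: segW_inj.
Qed.

(** * Contraction near minimal sets *)

Section contraction_near_M.
Variable M : set (Omega * W).
Hypotheses (sMP : M `<=` P) (M_inv : forall q, M q -> forall t, 0 <= t -> M (Pi sigma F tau t q))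
  (M_compact : compact M)
  (M_onto : forall q, M q -> exists2 q', M q' & Pi sigma F tau r%:num q' = q)
  (M_exponent : (upper_lyapunov sigma F tau M < 0)%E).

(** [varsol] picks some variational solution; uniqueness along [M], from [delay_gronwall] and the
    bound on [linop], lets an explicit one be used in its place. *)
Lemma vsol_unique q v Z1 Z2 : M q -> vsol q v Z1 -> vsol q v Z2 ->
  forall t, 0 <= t -> hst Z1 t = hst Z2 t.
Proof.
move=> Mq V1 V2 t t0; rewrite (hist_left_ext Z1 t0) (hist_left_ext Z2 t0).
have [cZ1 _ _] := V1; have [cZ2 _ _] := V2.
have {V1}[_ i1 d1] := left_ext_vsol V1; have {V2}[_ i2 d2] := left_ext_vsol V2.
have c1 := left_ext_continuous cZ1; have c2 := left_ext_continuous cZ2.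
move: (left_ext Z1) (left_ext Z2) i1 i2 d1 d2 c1 c2 => {cZ1 cZ2} {}Z1 {}Z2 i1 i2 d1 d2 c1 c2.
have [c c0 cP] := linop_bounded sMP M_onto.
pose e s := Z1 s - Z2 s.
have ce : continuous e by move=> s; apply: cvgB; [exact: c1|exact: c2].
have c20 : 0 <= 2 * c by rewrite mulr_ge0// ltW.
have tc : 0 <= t * (2 * c) by rewrite mulr_ge0.
have tt : 0 <= t <= t by rewrite t0 lexx.
have := @delay_gronwall R r n e (fun s => linop F tau (Pi sigma F tau s q) (hst Z1 s)
  - linop F tau (Pi sigma F tau s q) (hst Z2 s)) c t c0 ce _ _ (Num.bound (t * (2 * c))) t tt.
have -> : hst e 0 = 0.
  rewrite histB//; apply/eqP; rewrite subr_eq0; apply/eqP; apply: segCP => s.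
  rewrite inE => Is.
  apply: etrans (hist_in 0 c1 Is) (etrans _ (esym (hist_in 0 c2 Is))).
  by rewrite add0r i1// i2.
rewrite normr0 mulr0 => H.
have : `|hst e t| <= 0.
  apply: H.
  - by move=> s /andP[s0 _]; apply: has_rderivB; [exact: d1|exact: d2].
  - move=> s /andP[s0 _]; rewrite -linopB histB//; apply: cP; exact: M_inv.
  - by rewrite ler_pdivlMr ?mulr_gt0//; apply/ltW/archi_boundP.
by rewrite normr_le0 histB// subr_eq0 => /eqP.
Qed.

Lemma wsolE q v Z t : M q -> vsol q (segW_segC v) Z -> hst Z t \in @segW_pred R r n ->
  0 <= t -> segW_segC (wsol sigma F tau t q v) = hst Z t.
Proof.
move=> Mq VZ ZW t0; rewrite /wsol.
have -> : hst (varsol sigma F tau q (segW_segC v)) t = hst Z t.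
  apply: (vsol_unique Mq _ VZ t0).
  by apply: (@xgetPex _ (cst 0) (vsol q (segW_segC v))); exists Z.
exact: insubdK.
Qed.

Lemma limf_esup_ge0_of_bound (f : R -> R) c : 0 < c ->
  (forall t, 0 <= t -> c <= f t) ->
  (0 <= limf_esup (fun t : R => (t^-1)%:E * lne (f t)%:E) (+oo%R : set_system R))%E.
Proof.
move=> c0 cf; rewrite limf_esupE; apply: le_ereal_inf_tmp => _ [A [N [_ NA]] <-].
apply/lee_addgt0Pr => e e0; rewrite -leeBlDr// sub0e.
(* Beyond [N], to lie in the given neighbourhood of infinity, and beyond [|ln c| / e], so that
   [ln c / t] is at least [- e]. *)
pose t := Num.max (`|N| + 1) (`|ln c| / e + 1).
have Nt : N < t.
  apply: le_lt_trans (ler_norm N) _; apply: (@lt_le_trans _ _ (`|N| + 1)).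
    by rewrite ltrDl.
  by rewrite le_max lexx.
have t0 : 0 < t by rewrite lt_max ltr_wpDl.
have At : A t by exact: NA.
apply: (@le_trans _ _ ((t^-1)%:E * lne (f t)%:E)%E); last first.
  by apply: ereal_sup_ubound; exists t.
have ft : c <= f t by apply: cf; exact: ltW.
have ft0 : 0 < f t by exact: lt_le_trans ft.
rewrite lne_EFin// -EFinM -EFinN lee_fin.
have lc : - `|ln c| <= ln (f t).
  apply: le_trans (_ : ln c <= _); first by rewrite lerNl -normrN ler_norm.
  by rewrite ler_ln.
rewrite mulrC ler_pdivlMr// mulNr; apply: le_trans lc; rewrite lerN2 mulrC.
rewrite -ler_pdivrMr//; apply: (@le_trans _ _ (`|ln c| / e + 1)); first by rewrite lerDl.
by rewrite le_max lexx orbT.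
Qed.

Lemma dC_growth T : exists2 A, 0 <= A & forall p q, P p -> M q -> p.1 = q.1 ->
  forall t, 0 <= t <= T -> dC (Pi sigma F tau t p) (Pi sigma F tau t q) <= A * dC p q.
Proof.
have [N N0 NL] := M_lipschitz sMP M_onto.
have [A A0 AP] := traj_gronwall T (ltW N0); exists A => // p q Pp Mq pq t tT.
have Pq := sMP Mq; have [t0 _] := andP tT.
have E0 : `|hst (gsol p) 0 - hst (gsol q) 0| = dC p q.
  by congr (`|_ - _|); [exact: (hist_gsol0 (P_global Pp))|exact: (hist_gsol0 (P_global Pq))].
have qT := traj_gsol Pq; rewrite -pq in qT.
have := AP _ _ _ (traj_gsol Pp) qT (NL q Mq) t tT.
by rewrite E0 -(dC_Pi Pp Pq t0).
Qed.

Section blowup.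
Variables (U : set_system nat) (p q : nat -> Omega * W) (a : Omega * W).
Hypotheses (UU : UltraFilter U) (ooU : \oo `<=` U)
  (Pp : forall m, P (p m)) (Mq : forall m, M (q m)) (pq : forall m, (p m).1 = (q m).1)
  (Ma : M a) (pa : p @ U --> a) (qa : q @ U --> a)
  (e_gt0 : forall m, 0 < dC (p m) (q m))
  (slow : forall m t, r%:num <= t <= m%:R + r%:num ->
    dC (p m) (q m) / 2 < dC (Pi sigma F tau t (p m)) (Pi sigma F tau t (q m))).

Let e m := dC (p m) (q m).
Let Pq m : P (q m) := sMP (Mq m).
Let z_ (m : nat) (t : R) : E :=
  (e m)^-1 *: (gsol (p m) (Num.max t 0) - gsol (q m) (Num.max t 0)).
Let UP : ProperFilter U := @ultra_proper _ _ UU.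
Let UF : Filter U := @filter_filter _ _ UP.

(** [A] bounds the quotients up to time [T] and [c * A] their derivatives. Neither depends on [m],
    because the constants come from the common Lipschitz bound on [M]. *)
Lemma blowup_bounds T : exists2 L, 0 <= L & forall m,
  (forall t, t <= T -> `|z_ m t| <= L) /\
  (forall s t, s <= T -> t <= T -> `|z_ m s - z_ m t| <= L * `|s - t|).
Proof.
have [N N0 NL] := M_lipschitz sMP M_onto.
have [A A0 AP] := dC_growth (Num.max T 0); have [c c0 cP] := traj_rhs_diff (ltW N0).
exists ((1 + c) * A) => [|m]; first by rewrite mulr_ge0// addr_ge0// ltW.
have cA : c * A <= (1 + c) * A by rewrite ler_wpM2r// lerDr.
have AA : A <= (1 + c) * A by rewrite ler_peMl// lerDl ltW.
have T0 : 0 <= Num.max T 0 by rewrite le_max lexx orbT.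
have ei : 0 < (e m)^-1 by rewrite invr_gt0; exact: e_gt0.
have mT t : t <= T -> 0 <= Num.max t 0 <= Num.max T 0.
  by move=> tT; rewrite le_max lexx orbT/= ge_max !le_max tT lexx orbT.
have hd t : 0 <= t <= Num.max T 0 ->
    `|hst (gsol (p m)) t - hst (gsol (q m)) t| <= A * e m.
  move=> tT; have [t0 _] := andP tT.
  by rewrite -(dC_Pi (Pp m) (Pq m) t0); exact: AP.
have cp := gsol_continuous (P_global (Pp m)); have cq := gsol_continuous (P_global (Pq m)).
split.
  move=> t tT; rewrite /z_ normrZ (gtr0_norm ei) mulrC ler_pdivrMr ?e_gt0//.
  have t0T := mT _ tT; have [t0 _] := andP t0T.
  apply: (@le_trans _ _ (A * e m)); last by rewrite ler_wpM2r// ltW// e_gt0.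
  apply: le_trans (hd _ t0T); rewrite -histB//.
  apply: (hist_ub (y := fun s => gsol (p m) s - gsol (q m) s)).
    by move=> u; apply: cvgB; [exact: cp|exact: cq].
  by rewrite lexx andbT gerBl.
have zl := @rderiv_lipschitz R E (z_ m) (fun t =>
  (e m)^-1 *: (rhs (p m).1 (gsol (p m)) t - rhs (q m).1 (gsol (q m)) t)) 0 0 (Num.max T 0)
  ((1 + c) * A) (lexx 0) (@quotient_continuous _ _ _ e Pp Pq m).
have zm t : z_ m t = z_ m (Num.max t 0).
  by rewrite /z_ (max_l (_ : 0 <= Num.max t 0))// le_max lexx orbT.
move=> s t sT tT; rewrite (zm s) (zm t).
apply: (le_trans (zl _ _ _ _ (mT _ sT) (mT _ tT))).
- by move=> u /andP[u0 _]; exact: (@quotient_rderiv _ _ _ e Pp Pq m u u0).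
- move=> u uT; have [u0 _] := andP uT.
  rewrite normrZ (gtr0_norm ei) mulrC ler_pdivrMr ?e_gt0//.
  have qT := traj_gsol (Pq m); rewrite -(pq m) in qT *.
  apply: le_trans (cP _ _ _ (traj_gsol (Pp m)) qT (NL _ (Mq m)) u u0) _.
  rewrite histB//; apply: le_trans (ler_wpM2l (ltW c0) (hd u uT)) _.
  by rewrite mulrA ler_wpM2r// ltW// e_gt0.
- by rewrite ler_wpM2l// ?maxr0_dist// mulr_ge0// addr_ge0// ltW.
Qed.

Lemma blowup_limit : exists z : R -> E, [/\ forall t, ccvg U z_ z t,
  forall T, exists L, forall s t, s <= T -> t <= T -> `|z s - z t| <= L * `|s - t| &
  forall t, r%:num <= t -> 1 / 2 <= `|hst z t|].
Proof.
have /choice[z zP] : forall t : R, exists l : E, z_ m t @[m --> U] --> l.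
  move=> t; have [L L0 LP] := blowup_bounds t.
  have [|l _ lP] := ultra_conv UU (@norm_ball_compact R n L) (f := z_ ^~ t); last by exists l.
  by apply: nearW => m; exact: (LP m).1.
have zcc t : ccvg U z_ z t.
  have [L L0 LP] := blowup_bounds (t + 1).
  apply: (ccvg_lipschitz (N := L) UF ltr01 _ (zP t)) => m s st; apply: (LP m).2.
    by have := ler_norm (s - t); lra.
  by rewrite lerDl.
exists z; split => //.
  move=> T; have [L L0 LP] := blowup_bounds T; exists L => s t sT tT.
  have zl : `|z_ m s - z_ m t| @[m --> U] --> `|z s - z t|.
    by apply: cvg_norm; apply: cvgB; exact: zP.
  apply: (@closed_cvg _ _ U _ _ [set x : R | x <= L * `|s - t|] _ _ _ zl).
    exact: closed_le.
  by apply: nearW => m; exact: (LP m).2.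
move=> t rt; have zc := ccvg_continuous UP zcc.
have z_c m : continuous (z_ m) := @quotient_continuous _ _ _ e Pp Pq m.
have hc := @hist_cvg R r n nat U z_ z t UF z_c zc (fun s _ => zcc s).
have hl : `|hst (z_ m) t| @[m --> U] --> `|hst z t|.
  apply: cvg_norm.
  apply: (@cvg_comp _ _ _ (fun m : nat => (m, t)) (fun js => hst (z_ js.1) js.2) U
    (filter_prod U (nbhs t)) (nbhs (hst z t)) _ hc).
  exact: (cvg_pair cvg_id (cvg_cst t)).
apply: (@closed_cvg _ _ U _ _ [set x : R | 1 / 2 <= x] _ _ _ hl); first exact: closed_ge.
(* Once [m] exceeds [t], the time [t] lies in [r, m + r], where the distance has not been halved. *)
apply: ooU; exists (Num.bound t) => // m /= mt.
have t0 : 0 <= t by rewrite (le_trans _ rt).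
have tm : t <= m%:R + r%:num.
  apply: le_trans (ltW (archi_boundP t0)) _.
  by apply: (@le_trans _ _ m%:R); [rewrite ler_nat|rewrite lerDl].
have := @slow m t; rewrite rt tm => /(_ isT).
rewrite (dC_Pi (Pp m) (Pq m) t0) (quotient_hist e Pp Pq m rt) normrZ.
rewrite gtr0_norm ?invr_gt0 ?e_gt0// => /ltW h.
by rewrite ler_pdivlMl ?e_gt0// mulrCA mul1r.
Qed.

(** The limit satisfies the variational equation from time [r] on; shifted by [r], it starts at [b]
    in [M] from a Lipschitz function [v]. Its norm in C, hence in W, stays at least 1/2, so its
    exponent is nonnegative. *)
Lemma blowup_absurd : False.
Proof.
have [z [zcc zL zlow]] := blowup_limit.
have zc := ccvg_continuous UP zcc.
have r0 : 0 <= r%:num by [].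
have Pa := sMP Ma.
have zD t : r%:num <= t ->
    has_rderiv `[r%:num, +oo[ z t (linop F tau (Pi sigma F tau t a) (hst z t)).
  apply: (@rderiv_limit _ _ nat U z_ (fun m t => (e m)^-1 *:
     (rhs (p m).1 (gsol (p m)) t - rhs (q m).1 (gsol (q m)) t))
     z (fun t => linop F tau (Pi sigma F tau t a) (hst z t)) r%:num UP).
  - exact: (@quotient_continuous _ _ _ e Pp Pq).
  - move=> m s rs; have s0 : 0 <= s by exact: le_trans rs.
    apply: has_rderivW (@quotient_rderiv _ _ _ e Pp Pq m s s0) => u.
    by rewrite /= !in_itv/= !andbT; exact: le_trans.
  - by move=> s rs; exact: (ccvg_pointwise UF (zcc s)).
  - move=> s rs; exact: (quotient_limit UU Pp Pq pq Pa pa qa e_gt0 zcc rs).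
pose Z (u : R) := z (u + r%:num).
have cZ : continuous Z.
  move=> u; apply: (@continuous_comp _ _ _ (fun s => s + r%:num) z); last exact: zc.
  by apply: cvgD; [exact: cvg_id|exact: cvg_cst].
have hZ u : hst Z u = hst z (u + r%:num) := hist_shift r r%:num u zc.
have ZW u : hst Z u \in @segW_pred R r n.
  have [L LP] := zL (u + r%:num).
  apply: (hist_segW (L := L) cZ) => s w /andP[_ su] /andP[_ wu].
  have -> : s - w = (s + r%:num) - (w + r%:num) by ring.
  by apply: LP; rewrite lerD2r.
pose v : W := insubd (0 : W) (hst Z 0).
have vE : segW_segC v = hst Z 0 := insubdK _ (ZW 0).
pose b := Pi sigma F tau r%:num a.
have Mb : M b by exact: M_inv.
have VZ : vsol b (segW_segC v) Z.
  split; first exact: continuous_subspaceT.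
    by move=> s Is; rewrite vE (hist_in 0 cZ Is) add0r.
  move=> t t0; have rt : r%:num <= t + r%:num by rewrite lerDr.
  have -> : linop F tau (Pi sigma F tau t b) (hst Z t) =
      linop F tau (Pi sigma F tau (t + r%:num) a) (hst z (t + r%:num)).
    by rewrite hZ (PiD Pa t0 r0).
  apply: has_rderivW (has_rderiv_shift (zD _ rt)) => u.
  by rewrite /= !in_itv/= !andbT lerDr.
have low t : 0 <= t -> 1 / 2 <= `|wsol sigma F tau t b v|.
  move=> t0; apply: le_trans (segC_le_segW _).
  rewrite (wsolE Mb VZ (ZW t) t0) hZ; apply: zlow.
  by rewrite lerDr.
have v0 : v != 0.
  apply/eqP => v0; have := low 0 (lexx 0).
  have -> : wsol sigma F tau 0 b v = v.
    by apply: segW_inj; rewrite (wsolE Mb VZ (ZW 0) (lexx 0)) -vE.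
  by rewrite v0 normr0; lra.
have half0 : 0 < 1 / 2 :> R by lra.
have := limf_esup_ge0_of_bound half0 low.
apply/negP; rewrite -ltNge; apply: le_lt_trans M_exponent.
by apply: ereal_sup_ubound; exists (b, v).
Qed.

End blowup.

Lemma contraction_near_minimal : exists T eps K,
  fiber_contraction fst (Pi sigma F tau) dC P r%:num M T eps K.
Proof.
(* One integer governs both the waiting time and the radius, so failure for all [m] gives distances
   tending to 0 on windows that exhaust [r, +oo[. *)
suff [m mP] : exists m : nat, forall p q, P p -> M q -> p.1 = q.1 ->
    dC p q < m.+1%:R^-1 ->
    exists2 t, r%:num <= t <= m%:R + r%:num &
      dC (Pi sigma F tau t p) (Pi sigma F tau t q) <= dC p q / 2.
  have [A A0 AP] := dC_growth (m%:R + r%:num).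
  exists (m%:R + r%:num), m.+1%:R^-1, A; split => //.
  by move=> p q Pp Mq pq dpq; split; [exact: mP|exact: AP].
apply: contrapT => nC.
have /choice[f fP] : forall m : nat, exists f : (Omega * W) * (Omega * W),
    [/\ P f.1, M f.2, f.1.1 = f.2.1, dC f.1 f.2 < m.+1%:R^-1 &
      forall t, r%:num <= t <= m%:R + r%:num ->
        dC f.1 f.2 / 2 < dC (Pi sigma F tau t f.1) (Pi sigma F tau t f.2)].
  move=> m; apply: contrapT => nf; apply: nC; exists m => p q Pp Mq pq dpq.
  apply: contrapT => nt; apply: nf; exists (p, q); split => //= t tm.
  by rewrite ltNge; apply/negP => h; apply: nt; exists t.
pose p m := (f m).1; pose q m := (f m).2.
have Pp m : P (p m) by have [] := fP m.
have Mq m : M (q m) by have [] := fP m.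
have pq m : (p m).1 = (q m).1 by have [] := fP m.
have de m : dC (p m) (q m) < m.+1%:R^-1 by have [] := fP m.
have slow m : forall t, r%:num <= t <= m%:R + r%:num ->
    dC (p m) (q m) / 2 < dC (Pi sigma F tau t (p m)) (Pi sigma F tau t (q m)).
  by have [] := fP m.
have e_gt0 m : 0 < dC (p m) (q m).
  rewrite lt_neqAle normr_ge0 andbT; apply/eqP => /esym e0.
  have pqm := dC_eq (pq m) e0.
  have := slow m r%:num; rewrite lexx lerDr ler0n => /(_ isT).
  by rewrite e0 pqm /dC subrr normr0 mul0r ltxx.
have [U [UU ooU]] := ultraFilterLemma eventually_filter.
have UP : ProperFilter U := @ultra_proper _ _ UU.
have [a Ma qa] := ultra_conv UU M_compact (nearW _ Mq).
have [b Pb pb] := ultra_conv UU P_compact (nearW _ Pp).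
have ba : b = a.
  apply: dC_eq.
    apply: (cvg_ultra_unique (metric_hausdorff (T := Omega)) UP (f := fun m => (p m).1)).
      exact: cvg_pair_fst.
    by under eq_fun do rewrite pq; exact: cvg_pair_fst.
  apply/eqP; rewrite -normr_le0; apply/ler_addgt0Pl => eps eps0; rewrite addr0 normr_id.
  have dl : dC (p m) (q m) @[m --> U] --> dC b a.
    by apply: cvg_norm; apply: cvgB; exact: cvg_segW_segC.
  apply: (@closed_cvg _ _ U _ _ [set x : R | x <= eps] _ _ _ dl); first exact: closed_le.
  have : \forall m \near U, m.+1%:R^-1 < eps.
    by apply: ooU; exact: (near_infty_natSinv_lt (PosNum eps0)).
  by apply: filterS => m /= h; apply: ltW; exact: lt_trans (de m) h.
by rewrite ba in pb; exact: (blowup_absurd UU ooU Pp Mq pq Ma pb qa e_gt0 slow).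
Qed.

End contraction_near_M.

(** * Transfer of the abstract decomposition to the delay equation *)

Hypothesis P_exponents : forall M, minimal_set sigma F tau M -> M `<=` P ->
  (upper_lyapunov sigma F tau M < 0)%E.

Local Notation X := (Omega * W)%type.
Local Notation flow := (Pi sigma F tau).

Lemma P_inv : semiflow_inv flow P.
Proof. by move=> p Pp t t0; exact: Pi_P. Qed.

Lemma dC_cont : continuous (fun z : X * X => dC z.1 z.2).
Proof.
move=> z; apply: cvg_norm; apply: cvgB; apply: cvg_segW_segC.
  exact: cvg_fst.
exact: cvg_snd.
Qed.

Lemma dC_ge0 (p q : X) : 0 <= dC p q. Proof. exact: normr_ge0. Qed.

Lemma dC_refl (p : X) : dC p p = 0. Proof. by rewrite /dC subrr normr0. Qed.

Lemma dC_sym (p q : X) : dC p q = dC q p. Proof. exact: distrC. Qed.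

Lemma dC_tri (p q s : X) : dC p s <= dC p q + dC q s.
Proof. exact: ler_distD. Qed.

Lemma hausdorff_phase : hausdorff_space X.
Proof.
move=> p q pq; apply: dC_eq.
  apply: (metric_hausdorff (T := Omega)) => A B pA qB.
  have [] := pq (fst @^-1` A) (fst @^-1` B).
  - exact: (@cvg_fst _ _ _ _ _ _ pA).
  - exact: (@cvg_fst _ _ _ _ _ _ qB).
  - by move=> x [Ax Bx]; exists x.1.
suff pq2 : p.2 = q.2 by rewrite /dC pq2 subrr normr0.
apply: (@norm_hausdorff R W) => A B pA qB.
have [] := pq (snd @^-1` A) (snd @^-1` B).
- exact: (@cvg_snd _ _ _ _ _ _ pA).
- exact: (@cvg_snd _ _ _ _ _ _ qB).
- by move=> x [Ax Bx]; exists x.2.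
Qed.

(** Inside [P] lifetimes are infinite, so positive invariance reduces to invariance under the
    semiflow. *)
Lemma pos_invariant_sub N : N `<=` P -> pos_invariant sigma F tau N <-> semiflow_inv flow N.
Proof.
move=> sNP; split=> [h p Np t t0|h p Np]; first by have [_] := h p Np; exact.
by split; [exact: P_global (sNP _ Np)|exact: h].
Qed.

Lemma minimal_set_sub M : M `<=` P -> minimal_set sigma F tau M <-> minset flow M.
Proof.
move=> sMP; split=> [] [M0 Mi Mc Mm]; split => //.
- exact/(pos_invariant_sub sMP).
- move=> N sNM N0 Ni Nc; apply: Mm => //.
  by apply/pos_invariant_sub => // x /sNM/sMP.
- exact/(pos_invariant_sub sMP).
- move=> N sNM N0 Ni Nc; apply: Mm => //.
  by apply/pos_invariant_sub => // x /sNM/sMP.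
Qed.

Lemma minimal_subsetsE :
  minimal_subsets sigma F tau P = [set M | minset flow M /\ M `<=` P].
Proof.
by apply/seteqP; split=> M [Mm sMP]; split => //; move: Mm => /(minimal_set_sub sMP).
Qed.

Lemma contraction M : minset flow M -> M `<=` P ->
  exists T eps K, fiber_contraction fst flow dC P r%:num M T eps K.
Proof.
move=> Mm sMP; have [_ Mi Mc _] := Mm.
apply: contraction_near_minimal => //.
  exact: (minset_onto PiD Pi_ultra Mm sMP).
by apply: P_exponents => //; apply/minimal_set_sub.
Qed.

(* On the compact set P, convergence in the C-norm along a fiber upgrades to
   the W-norm, because limits along ultrafilters exist in the W-norm. *)
Lemma attraction_basin M p : M `<=` P -> P p ->
  attraction_domain sigma F tau M p <-> basin fst flow dC M p.
Proof.
move=> sMP Pp; split.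
  move=> [_ [x Mx px]]; exists (p.1, x); split => //.
  apply/cvgrPdist_lt => e e0; move/cvgrPdist_lt : px => /(_ e e0); apply: filterS => t.
  rewrite !sub0r !normrN normr_id => h; rewrite ger0_norm ?dC_ge0//.
  by apply: le_lt_trans h; rewrite /dC /=; apply: le_trans (segC_le_segW _).
move=> [q [Mq qp pq]]; split; first exact: P_global.
exists q.2; first by rewrite -qp -surjective_pairing.
rewrite -qp -surjective_pairing.
apply: cvg_ultra => G GU ooG; have GP : ProperFilter G := @ultra_proper _ _ GU.
have Gt x : P x -> \forall t \near G, P (flow t x).
  move=> Px; apply: ooG; exists 0; split; first exact: num_real.
  by move=> t /ltW t0; exact: P_inv.
have [a Pa pa] := ultra_conv GU P_compact (Gt _ Pp).
have [b Pb qb] := ultra_conv GU P_compact (Gt _ (sMP _ Mq)).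
have ab : a = b.
  apply: dC_eq.
    apply: (cvg_ultra_unique (metric_hausdorff (T := Omega)) GP
      (f := fun t => (flow t p).1)); first exact: cvg_pair_fst.
    by rewrite /Pi /= -qp; exact: (cvg_pair_fst (f := fun t => flow t q)).
  apply: (cvg_ultra_unique (@norm_hausdorff R R) GP
      (f := fun t => dC (flow t p) (flow t q))).
    by apply: cvg_norm; apply: cvgB; exact: cvg_segW_segC.
  by move=> V /pq; exact: ooG.
have w (x c : X) : flow t x @[t --> G] --> c -> usol sigma F tau t x @[t --> G] --> c.2.
  move=> h; apply: (@continuous_cvg _ _ _ G _ (fun t => flow t x) snd c) h.
  exact: cvg_snd.
have -> : 0 = `|a.2 - b.2| by rewrite ab subrr normr0.
by apply: cvg_norm; apply: cvgB; exact: w.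
Qed.

Lemma attraction_basinE M : M `<=` P ->
  P `&` attraction_domain sigma F tau M = P `&` basin fst flow dC M.
Proof.
by move=> sMP; apply/seteqP; split=> p [Pp Mp]; split => //; move: Mp => /attraction_basin; exact.
Qed.

End trajectories.

Theorem theorem5p9 (R : realType) (r : {posnum R}) (n : nat)
    (Omega : metricType R) (sigma : R -> Omega -> Omega)
    (F : Omega * 'rV[R]_n * 'rV[R]_n -> 'rV[R]_n)
    (tau : Omega * segC r n -> R)
    (n_ge1 : (1 <= n)%N)
    (compact_Omega : compact [set: Omega])
    (flow_sigma : continuous_flow sigma)
    (minimal_sigma : minimal_flow sigma)
    (F_H1 : cond_H1 F)
    (tau_bounds : forall p, 0 <= tau p <= r%:num)
    (tau_H2 : cond_H2 tau)
    (P : set (Omega * segW r n))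
    (P_invariant : pos_invariant sigma F tau P)
    (P_compact : compact P)
    (P_exponents : forall M, minimal_set sigma F tau M -> M `<=` P ->
       (upper_lyapunov sigma F tau M < 0)%E) :
  [/\ forall p, P p -> minimal_subsets sigma F tau P (omega_limit sigma F tau p),
      finite_set (minimal_subsets sigma F tau P),
      [/\ forall M, minimal_subsets sigma F tau P M ->
            [/\ compact (P `&` attraction_domain sigma F tau M),
                connected (P `&` attraction_domain sigma F tau M) &
                pos_invariant sigma F tau
                  (P `&` attraction_domain sigma F tau M)],
          trivIset (minimal_subsets sigma F tau P)
            (fun M => P `&` attraction_domain sigma F tau M) &
          P = \bigcup_(M in minimal_subsets sigma F tau P)
                (P `&` attraction_domain sigma F tau M)] &
      P !=set0 -> connected P ->
        exists M, minimal_subsets sigma F tau P = [set M]].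
Proof.
have pi_cont : continuous (fst : Omega * segW r n -> Omega) by move=> p; exact: cvg_fst.
have r_gt0 : 0 < r%:num by [].
have := semiflow_decomposition compact_Omega flow_sigma minimal_sigma
  (@hausdorff_phase R r n Omega) pi_cont r_gt0 P_compact (P_inv P_invariant)
  (Pi0 compact_Omega flow_sigma F_H1 tau_bounds P_invariant)
  (PiD compact_Omega flow_sigma F_H1 tau_bounds tau_H2 P_invariant P_compact)
  (fun t p => erefl)
  (Pi_ultra compact_Omega flow_sigma F_H1 tau_bounds tau_H2 P_invariant P_compact)
  dC_cont dC_ge0 dC_refl dC_sym dC_tri dC_eq
  (contraction compact_Omega flow_sigma F_H1 tau_bounds tau_H2 P_invariant P_compact
    P_exponents).
cbv zeta; rewrite -(minimal_subsetsE P_invariant).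
have basinE M : minimal_subsets sigma F tau P M ->
    P `&` attraction_domain sigma F tau M = P `&` basin fst (Pi sigma F tau) dC M.
  by move=> [_ sMP]; exact: attraction_basinE.
move=> [om fin [dom triv cover] conn].
split; [exact: om|exact: fin|split|exact: conn].
- move=> M PM; have [Mc Mk Mi] := dom _ PM; rewrite (basinE _ PM); split; [exact: Mc|exact: Mk|].
  by apply/(pos_invariant_sub P_invariant) => [p []|].
- move=> M N PM PN [p [Mp Np]]; apply: (triv M N PM PN); exists p.
  by rewrite -(basinE _ PM) -(basinE _ PN).
- by rewrite [LHS]cover; apply: eq_bigcupr => M PM; exact/esym/basinE.
Qed.
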